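(* Only finitely many of the sporadic triangle groups $\Gamma\left(\frac{2\pi}{p},\tau\right)$ are discrete (that is, only finitely many pairs $(p,\tau)$, with $p\ge2$ an integer, $\tau$ a sporadic value and $H_\tau$ of signature $(2,1)$, give a discrete group). More precisely, for integers $p\ge 2$: \begin{itemize} \item For $p \geqslant 7$, $\Gamma(\frac{2\pi}{p},\sigma_1)$ is not discrete. \item For $p=3,5,6,7$, $\Gamma(\frac{2\pi}{p},\overline{\sigma}_1)$ is not discrete. \item For $p \geqslant 6$, $\Gamma(\frac{2\pi}{p},\sigma_2)$ is not discrete. \item For $6 \leqslant p \leqslant 19$, $\Gamma(\frac{2\pi}{p},\overline{\sigma}_2)$ is not discrete. \item For $p=4,5,6$, $\Gamma(\frac{2\pi}{p},\sigma_4)$ is not discrete. \item For $p \notin\{2,3,4,5,6,8,12\}$, $\Gamma(\frac{2\pi}{p},\overline{\sigma}_4)$ is not discrete. \item For $p \notin\{2,3,4,5,6,8,12\}$, $\Gamma(\frac{2\pi}{p},\sigma_5)$ is not discrete. \item $\Gamma(\frac{2\pi}{4},\overline{\sigma}_5)$ is not discrete. \item $\Gamma(\frac{2\pi}{5},\sigma_6)$ and $\Gamma(\frac{2\pi}{5},\overline{\sigma}_6)$ are not discrete. \item For $p \notin\{2,3,4,7,14\}$, $\Gamma(\frac{2\pi}{p},\sigma_7)$ is not discrete. \end{itemize}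
   Context: For an integer $p\ge 2$ put $\psi=2\pi/p$, and for $\tau\in\mathbb{C}$ let $$J=\begin{pmatrix}0&0&1\\1&0&0\\0&1&0\end{pmatrix},\qquad R_1=\begin{pmatrix}e^{2i\psi/3}&\tau&-e^{i\psi/3}\overline{\tau}\\0&e^{-i\psi/3}&0\\0&0&e^{-i\psi/3}\end{pmatrix},$$ $$H_\tau=\begin{pmatrix}2\sin(\psi/2)&-ie^{-i\psi/6}\tau&ie^{i\psi/6}\overline{\tau}\\ ie^{i\psi/6}\overline{\tau}&2\sin(\psi/2)&-ie^{-i\psi/6}\tau\\-ie^{-i\psi/6}\tau&ie^{i\psi/6}\overline{\tau}&2\sin(\psi/2)\end{pmatrix}$$ (so $H_\tau$ depends on $p$ as well). Both $R_1$ and $J$ preserve the Hermitian form $\langle \mathbf z,\mathbf w\rangle=\mathbf w^*H_\tau\mathbf z$. The group $\Gamma(2\pi/p,\tau)$ is the group generated by $R_1$ and $J$. The sporadic values are $\sigma_j,\overline{\sigma}_j$ ($1\le j\le 9$), where $\sigma_1=e^{i\pi/3}+e^{-i\pi/6}2\cos(\pi/4)$, $\sigma_2=e^{i\pi/3}+e^{-i\pi/6}2\cos(\pi/5)$, $\sigma_3=e^{i\pi/3}+e^{-i\pi/6}2\cos(2\pi/5)$, $\sigma_4=e^{2\pi i/7}+e^{4\pi i/7}+e^{8\pi i/7}$, $\sigma_5=e^{2\pi i/9}+e^{-i\pi/9}2\cos(2\pi/5)$, $\sigma_6=e^{2\pi i/9}+e^{-i\pi/9}2\cos(4\pi/5)$,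 $\sigma_7=e^{2\pi i/9}+e^{-i\pi/9}2\cos(2\pi/7)$, $\sigma_8=e^{2\pi i/9}+e^{-i\pi/9}2\cos(4\pi/7)$, $\sigma_9=e^{2\pi i/9}+e^{-i\pi/9}2\cos(6\pi/7)$. A sporadic triangle group is a group $\Gamma(2\pi/p,\tau)$ with $p\ge 2$ an integer, $\tau$ a sporadic value, and $H_\tau$ of signature $(2,1)$; it is then a subgroup of $\mathrm{SU}(H_\tau)\cong\mathrm{SU}(2,1)$, and discreteness refers to this Lie group. For all the pairs $(p,\tau)$ listed in the bullet points, $H_\tau$ has signature $(2,1)$. *)

(* Defs.v *)
From HB Require Import structures.
From mathcomp Require Import all_boot all_order all_algebra.
From mathcomp Require Import sesquilinear spectral complex.
From mathcomp Require Import all_classical all_reals all_analysis.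

Set Implicit Arguments.
Unset Strict Implicit.
Unset Printing Implicit Defensive.

Import Order.TTheory GRing.Theory Num.Theory.
Import numFieldNormedType.Exports.

Local Open Scope classical_set_scope.
Local Open Scope ring_scope.
Local Open Scope sesquilinear_scope.

Definition cis (R : realType) (t : R) : R[i] := Complex (cos t) (sin t).

Definition cplx (R : realType) (x : R) : R[i] := (x%:C)%C.

Definition mx3 (C : nmodType) (s : seq (seq C)) : 'M[C]_3 :=
  \matrix_(i, j) nth 0 (nth [::] s i) j.

Inductive generated (F : fieldType) (n : nat) (S : set 'M[F]_n) : set 'M[F]_n :=
| generated_in A : S A -> generated S A
| generated_1 : generated S 1%:M
| generated_mul A B : generated S A -> generated S B -> generated S (A *m B)
| generated_inv A : generated S A -> generated S (invmx A).

(* The topology on complex matrices is entrywise; a matrix group such as SU(H)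
   carries the induced topology, so whether the points of a subgroup are
   isolated in it can be tested in the ambient space of all matrices. *)
Definition discrete_mx (R : realType) (n : nat) (G : set 'M[R[i]]_n) : Prop :=
  G `<=` isolated (G : set 'M[(R[i] : numFieldType)]_n).

(* Numbers of positive and of negative terms in a diagonalization of the
   Hermitian form w^* H z; well defined by Sylvester's law of inertia.
   An H satisfying this is automatically Hermitian. *)
Definition has_signature (R : realType) (n : nat) (H : 'M[R[i]]_n)
    (a b : nat) : Prop :=
  exists (P : 'M[R[i]]_n) (d : 'rV[R]_n),
    [/\ P \in unitmx,
        P ^t* *m H *m P = diag_mx (map_mx (@cplx R) d),
        #|[set i | 0 < d 0 i]%SET| = a &
        #|[set i | d 0 i < 0]%SET| = b].

Definition psi (R : realType) (p : nat) : R := 2 * pi / p%:R.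

Definition Jmx (R : realType) : 'M[R[i]]_3 :=
  mx3 [:: [:: 0; 0; 1];
          [:: 1; 0; 0];
          [:: 0; 1; 0]].

Definition R1mx (R : realType) (p : nat) (tau : R[i]) : 'M[R[i]]_3 :=
  let s : R := psi R p in
  mx3 [:: [:: cis (2 * s / 3); tau;            - cis (s / 3) * tau^*];
          [:: 0;               cis (- (s / 3)); 0];
          [:: 0;               0;              cis (- (s / 3))]].

Definition Hmx (R : realType) (p : nat) (tau : R[i]) : 'M[R[i]]_3 :=
  let s : R := psi R p in
  let a : R[i] := cplx (2 * sin (s / 2)) in
  let x : R[i] := - 'i * cis (- (s / 6)) * tau in
  let y : R[i] := 'i * cis (s / 6) * tau^* in
  mx3 [:: [:: a; x; y];
          [:: y; a; x];
          [:: x; y; a]].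

Definition Gamma (R : realType) (p : nat) (tau : R[i]) : set 'M[R[i]]_3 :=
  generated [set R1mx p tau; Jmx R].

(* sigma_j for 1 <= j <= 9; other indices are junk and never used. *)
Definition sigma (R : realType) (j : nat) : R[i] :=
  match j with
  | 1 => cis (pi / 3) + cis (- (pi / 6)) * cplx (2 * cos (pi / 4))
  | 2 => cis (pi / 3) + cis (- (pi / 6)) * cplx (2 * cos (pi / 5))
  | 3 => cis (pi / 3) + cis (- (pi / 6)) * cplx (2 * cos (2 * pi / 5))
  | 4 => cis (2 * pi / 7) + cis (4 * pi / 7) + cis (8 * pi / 7)
  | 5 => cis (2 * pi / 9) + cis (- (pi / 9)) * cplx (2 * cos (2 * pi / 5))
  | 6 => cis (2 * pi / 9) + cis (- (pi / 9)) * cplx (2 * cos (4 * pi / 5))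
  | 7 => cis (2 * pi / 9) + cis (- (pi / 9)) * cplx (2 * cos (2 * pi / 7))
  | 8 => cis (2 * pi / 9) + cis (- (pi / 9)) * cplx (2 * cos (4 * pi / 7))
  | 9 => cis (2 * pi / 9) + cis (- (pi / 9)) * cplx (2 * cos (6 * pi / 7))
  | _ => 0
  end.

Definition sporadic (R : realType) (tau : R[i]) : Prop :=
  exists2 j : nat, (1 <= j <= 9)%N & tau = sigma R j \/ tau = (sigma R j)^*.

Definition sporadic_triangle_pair (R : realType) (p : nat) (tau : R[i]) : Prop :=
  [/\ (2 <= p)%N, sporadic tau & has_signature (Hmx p tau) 2 1].

(* Main.v *)
Require Import Defs.
From HB Require Import structures.
From mathcomp Require Import all_boot all_order all_algebra all_field.
From mathcomp Require Import sesquilinear spectral complex.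
From mathcomp Require Import all_classical all_reals all_analysis.
From Stdlib Require Import ZArith.
From mathcomp Require Import ring lra zify ssrZ.
Delimit Scope nat_scope with N.

Set Implicit Arguments.
Unset Strict Implicit.
Unset Printing Implicit Defensive.

Import Order.TTheory GRing.Theory Num.Theory.
Import numFieldNormedType.Exports.

Local Open Scope classical_set_scope.
Local Open Scope ring_scope.
Local Open Scope sesquilinear_scope.

(** R1, R2 = J R1 J^-1 and R3 = J R2 J^-1 are complex reflections, up to scalars
    of modulus one. If R1 R2 acts on the span of its two polar vectors with
    eigenvalues of ratio [cis (2 phi)] where phi is a rational multiple of pi, then
    a power of it is a complex reflection C whose polar vector z is orthogonal to
    these two. Each case contradicts discreteness in one of three ways.

    (1) Jorgensen's inequality for C^j and its image under J: conjugating one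
    reflection by the other repeatedly yields infinitely many elements that converge
    to C^j.

    (2) If R1 and J C^j J^-1 generate a group in which their product is elliptic on
    the span of their polar vectors, then discreteness makes its angle a rational
    multiple of pi, so all Galois conjugates of the cosine of this angle are at
    most 1 in absolute value; one exhibits a conjugate that is larger.

    (3) The same for R1 and its conjugate by R2 R3.

    For p >= 60 criterion (1) applies to all 18 values of tau as soon as
    det H_tau < 0, which holds when the signature is (2,1). For p < 60 the criteria
    are trigonometric inequalities, decided in ball arithmetic. *)

(** * Galois conjugates and ball arithmetic *)

(** Discreteness only says that points are isolated; it says nothing about orders of elements. The
    link is recurrence: if all eigenvalues of a diagonalizable matrix have modulus one, some
    positive power is arbitrarily close to the identity, so in a discrete group that power is the
    identity and the eigenvalues are roots of unity. All quantities that occur (det H, coordinates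
    of polar vectors, traces) are integer polynomials in cosines of rational multiples of pi. One
    expression tree therefore serves twice: ball arithmetic evaluates it, and multiplying all angles
    by [k] gives its Galois conjugate. That an angle is rational becomes the equation V_n(y) = 2 for
    a Chebyshev-type polynomial V_n; conjugation preserves it, while V_n(y) > 2 for y > 2. Criterion
    (1) needs a power of C that is nearly scalar without being scalar. Where C has small order, its
    nontrivial powers stay far from scalars, and criterion (2) takes over. *)

Definition PhiQ (n : nat) : {poly rat} := map_poly intr (Cyclotomic n).

Lemma map_PhiQ (F : numFieldType) n :
  map_poly ratr (PhiQ n) = map_poly intr (Cyclotomic n) :> {poly F}.
Proof.
rewrite -map_poly_comp; apply: eq_map_poly => a /=; exact: ratr_int.
Qed.

Lemma root_PhiQ (F : numFieldType) n (z : F) :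
  n.-primitive_root z -> root (map_poly ratr (PhiQ n)) z.
Proof.
move=> prz; have n_gt0 := prim_order_gt0 prz.
have : root (map_poly intr ('X^n - 1) : {poly F}) z.
  by rewrite rmorphB rmorph1 /= map_polyXn rootE !hornerE prim_expr_order ?subrr.
rewrite -(prod_Cyclotomic n_gt0) rmorph_prod rootE horner_prod prodf_seq_eq0 => /hasP[d].
rewrite -dvdn_divisors //= => d_n.
have [-> | d_neq_n] := eqVneq d n; first by rewrite map_PhiQ.
move=> zd; exfalso.
have d_gt0 : (0 < d)%N := dvdn_gt0 n_gt0 d_n.
have : root (map_poly intr ('X^d - 1) : {poly F}) z.
  rewrite -(prod_Cyclotomic d_gt0) rmorph_prod rootE horner_prod prodf_seq_eq0; apply/hasP.
  by exists d; rewrite -?dvdn_divisors.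
rewrite rmorphB rmorph1 /= map_polyXn rootE !hornerE subr_eq0.
rewrite -(prim_order_dvd prz) => n_d.
by move: d_neq_n; rewrite eqn_dvd d_n n_d.
Qed.

(** The minimality of cyclotomic polynomials is available over [algC], while the root [z] lives in
    [F]. The gcd of [PhiQ n] and [P] is a rational polynomial, so a common root in [F] makes it
    nonconstant and yields a common root in [algC]. *)
Lemma PhiQ_dvd (F : numFieldType) n (z : F) (P : {poly rat}) :
  n.-primitive_root z -> root (map_poly ratr P) z -> PhiQ n %| P.
Proof.
move=> prz Pz; have n_gt0 := prim_order_gt0 prz.
have Phi_n0 : PhiQ n != 0.
  by rewrite monic_neq0 ?monic_map // Cyclotomic_monic.
have : ~~ coprimep (PhiQ n) P.
  apply/negP; rewrite -(coprimep_map (@ratr F)).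
  by move/coprimep_root => /(_ _ (root_PhiQ prz)); rewrite -rootE Pz.
move=> ncop; have : size (map_poly (@ratr algC) (gcdp (PhiQ n) P)) != 1%N.
  by rewrite size_map_poly.
case/closed_rootP => y; rewrite gcdp_map root_gcd => /andP[Phi_y P_y].
have [y0 pry0] := C_prim_root_exists n_gt0.
have pry : n.-primitive_root y.
  by rewrite -(root_cyclotomic pry0) -(Cintr_Cyclotomic pry0) -map_PhiQ.
have [pf [Dpf _ dv_pf]] := minCpolyP y.
move: P_y; rewrite dv_pf; suff -> : pf = PhiQ n by [].
apply: (map_inj_poly (fmorph_inj (@ratr algC)) (rmorph0 _)).
by rewrite -Dpf (minCpoly_cyclotomic pry) -(Cintr_Cyclotomic pry) -map_PhiQ.
Qed.

Lemma root_cyclotomic_conj (F : numFieldType) n k (z : F) (P : {poly rat}) :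
    n.-primitive_root z -> coprime k n ->
  root (map_poly ratr P) z -> root (map_poly ratr P) (z ^+ k).
Proof.
move=> prz kn /(PhiQ_dvd prz)/dvdpP[Q ->].
by rewrite rmorphM rootM /= (@root_PhiQ _ n) ?orbT ?prim_root_exp_coprime.
Qed.

(** * Taylor bounds for sine and cosine *)

Section Taylor.
Context {R : realType}.
Implicit Types x y : R.

Lemma derive_ge0_ge0 (f df : R -> R) : (forall x, is_derive x 1 f (df x)) ->
  f 0 = 0 -> (forall x, 0 <= x -> 0 <= df x) -> forall x, 0 <= x -> 0 <= f x.
Proof.
move=> fdf f0 df0 x; rewrite le_eqVlt => /predU1P[<-|x0]; first by rewrite f0.
have cf : {within `[0, x]%classic, continuous f}.
  apply: derivable_within_continuous => y _.
  by have := fdf y; case.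
have [c] := MVT x0 (fun y _ => fdf y) cf.
rewrite in_itv /= f0 !subr0 => /andP[c0 _] ->.
by rewrite mulr_ge0 ?df0 ?ltW.
Qed.

Definition cosT n x := \sum_(i < n) (-1) ^+ i * x ^+ i.*2 / (i.*2)`!%:R.
Definition sinT n x := \sum_(i < n) (-1) ^+ i * x ^+ i.*2.+1 / (i.*2.+1)`!%:R.

Lemma taylor_coef (s a f y : R) : a != 0 -> f != 0 ->
  s / (a * f) * (a * y) = s * y / f.
Proof. by move=> a0 f0; field; apply/andP. Qed.

Lemma is_derive_sinT n x : is_derive x 1 (sinT n) (cosT n x).
Proof.
elim: n => [|n IH].
  have -> : sinT 0 = cst 0 by apply/funext => y; rewrite /sinT big_ord0.
  by rewrite /cosT big_ord0; exact: is_derive_cst.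
have -> : sinT n.+1 = sinT n + ((-1) ^+ n / (n.*2.+1)`!%:R) *: ((@id R) ^+ n.*2.+1).
  apply/funext => y; rewrite /sinT big_ord_recr /= fctE /= [in RHS]/GRing.scale /=.
  by congr (_ + _); rewrite -[RHS]/(_ * _) exprfctE /= mulrAC.
apply: (is_derive_eq (is_deriveD IH (is_deriveZ _ (is_deriveX n.*2.+1 (is_derive_id x 1))))).
rewrite /cosT big_ord_recr /=; congr (_ + _).
rewrite /GRing.scale /= mulr1 factS natrM.
by rewrite taylor_coef // pnatr_eq0 -lt0n fact_gt0.
Qed.

Lemma is_derive_cosT n x : is_derive x 1 (cosT n.+1) (- sinT n x).
Proof.
elim: n => [|n IH].
  have -> : cosT 1 = cst 1.
    by apply/funext => y; rewrite /cosT big_ord1 expr0 expr0 fact0 !mul1r invr1.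
  by rewrite /sinT big_ord0 oppr0; exact: is_derive_cst.
have -> : cosT n.+2 = cosT n.+1 + ((-1) ^+ n.+1 / (n.+1.*2)`!%:R) *: ((@id R) ^+ n.+1.*2).
  apply/funext => y; rewrite /cosT big_ord_recr /= fctE /= [in RHS]/GRing.scale /=.
  by congr (_ + _); rewrite -[RHS]/(_ * _) exprfctE /= mulrAC.
apply: (is_derive_eq (is_deriveD IH (is_deriveZ _ (is_deriveX n.+1.*2 (is_derive_id x 1))))).
rewrite /sinT big_ord_recr /= opprD; congr (_ + _).
rewrite /GRing.scale /= mulr1 doubleS factS natrM exprS mulN1r.
by rewrite taylor_coef ?mulNr // pnatr_eq0 -lt0n fact_gt0.
Qed.

(** The remainder of the sine has the remainder of the cosine as derivative, and the latter has
    minus the previous remainder of the sine. All vanish at 0, so the alternating signs propagate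
    from cos x <= 1. *)
Lemma taylor_sin_cos n :
  (forall x, 0 <= x -> 0 <= (-1) ^+ n.+1 * (cos x - cosT n.+1 x)) /\
  (forall x, 0 <= x -> 0 <= (-1) ^+ n.+1 * (sin x - sinT n.+1 x)).
Proof.
have step m : (forall x, 0 <= x -> 0 <= (-1) ^+ m * (cos x - cosT m x)) ->
    forall x, 0 <= x -> 0 <= (-1) ^+ m * (sin x - sinT m x).
  move=> H; apply: (@derive_ge0_ge0 (fun x => (-1) ^+ m * (sin x - sinT m x)) _ _ _ H).
    move=> x; have H1 := is_derive_sinT m x.
    have -> : (fun x => (-1) ^+ m * (sin x - sinT m x)) = (-1) ^+ m *: (sin - sinT m : R -> R) by [].
    exact: is_deriveZ.
  rewrite sin0 /sinT big1 ?subrr ?mulr0 // => i _.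
  by rewrite exprS !mul0r mulr0 mul0r.
elim: n => [|n [_ IH]].
  have H : forall x, 0 <= x -> 0 <= (-1) ^+ 1 * (cos x - cosT 1 x).
    move=> x _; rewrite /cosT big_ord1 expr0 expr0 fact0 !mul1r invr1.
    by have := cos_le1 x; lra.
  by split=> //; exact: step.
have H : forall x, 0 <= x -> 0 <= (-1) ^+ n.+2 * (cos x - cosT n.+2 x).
  have E x : is_derive x 1 (fun x => (-1) ^+ n.+2 * (cos x - cosT n.+2 x))
      ((-1) ^+ n.+1 * (sin x - sinT n.+1 x)).
    have H1 := is_derive_cosT n.+1 x.
    have -> : (fun x => (-1) ^+ n.+2 * (cos x - cosT n.+2 x)) = (-1) ^+ n.+2 *: (cos - cosT n.+2 : R -> R) by [].
    by apply: is_derive_eq; rewrite /GRing.scale /= (exprS _ n.+1); ring.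
  apply: (derive_ge0_ge0 E _ IH).
  rewrite cos0 /cosT big_ord_recl big1 ?addr0 => [|i _].
    by rewrite expr0 fact0 !mul1r invr1 subrr mulr0.
  by rewrite doubleS exprS !mul0r mulr0 mul0r.
by split=> //; exact: step.
Qed.

Lemma cosT_le_cos n x : 0 <= x -> ~~ odd n -> cosT n.+2 x <= cos x.
Proof.
move=> x0 en; have [/(_ x x0) + _] := taylor_sin_cos n.+1.
by rewrite -signr_odd /= negbK (negbTE en) expr0 mul1r subr_ge0.
Qed.

Lemma cos_le_cosT n x : 0 <= x -> ~~ odd n -> cos x <= cosT n.+1 x.
Proof.
move=> x0 en; have [/(_ x x0) + _] := taylor_sin_cos n.
by rewrite -signr_odd /= (negbTE en) expr1 mulN1r oppr_ge0 subr_le0.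
Qed.

End Taylor.

HB.lock Definition ZR (R : realType) (z : Z) : R := (int_of_Z z)%:~R.

Section ZR.
Context {R : realType}.
Local Notation ZR := (@ZR R).

Lemma ZRD a b : ZR (a + b)%Z = ZR a + ZR b.
Proof. by rewrite unlock -intrD; congr (_%:~R); lia. Qed.

Lemma ZRN a : ZR (- a)%Z = - ZR a.
Proof. by rewrite unlock -mulrNz; congr (_%:~R); lia. Qed.

Lemma ZRB a b : ZR (a - b)%Z = ZR a - ZR b.
Proof. by rewrite unlock -intrB; congr (_%:~R); lia. Qed.

Lemma ZRM a b : ZR (a * b)%Z = ZR a * ZR b.
Proof. by rewrite unlock -intrM; congr (_%:~R); lia. Qed.

Lemma ZR_le a b : (a <= b)%Z -> ZR a <= ZR b.
Proof. by move=> ab; rewrite unlock ler_int; lia. Qed.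

Lemma ZR_lt a b : (a < b)%Z -> ZR a < ZR b.
Proof. by move=> ab; rewrite unlock ltr_int; lia. Qed.

Lemma ZR_abs a : ZR (Z.abs a) = `|ZR a|.
Proof. by rewrite unlock -intr_norm; congr (_%:~R); lia. Qed.

Lemma ZR_nat (n : nat) : ZR (Z.of_nat n) = n%:R.
Proof.
elim: n => [|n IH]; first by rewrite unlock.
by rewrite Nat2Z.inj_succ -Z.add_1_r ZRD IH -natr1 unlock.
Qed.

Lemma ZR1 : ZR 1 = 1.
Proof. exact: (ZR_nat 1). Qed.

Lemma ZR2 : ZR 2 = 2.
Proof. exact: (ZR_nat 2). Qed.

Lemma ZR0 : ZR 0 = 0.
Proof. exact: (ZR_nat 0). Qed.

Lemma ZR_gt0 a : (0 < a)%Z -> 0 < ZR a.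
Proof. by rewrite -[X in X < _]ZR0; exact: ZR_lt. Qed.

Lemma ZR_ge0 a : (0 <= a)%Z -> 0 <= ZR a.
Proof. by rewrite -[X in X <= _]ZR0; exact: ZR_le. Qed.

Lemma ZR_div_le a d : (0 < d)%Z -> ZR (a / d) * ZR d <= ZR a.
Proof. by move=> d0; rewrite -ZRM; apply: ZR_le; rewrite Z.mul_comm; exact: Z.mul_div_le. Qed.

Lemma ZR_div_gt a d : (0 < d)%Z -> ZR a < (ZR (a / d) + 1) * ZR d.
Proof.
move=> d0; rewrite -ZR1.
rewrite -ZRD -ZRM; apply: ZR_lt.
by rewrite Z.mul_comm Z.add_1_r; exact: Z.mul_succ_div_gt.
Qed.

End ZR.

(* Balls are pairs (midpoint, radius) of integers, in units of [2 ^ -40]. *)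
Definition scale : Z := 1099511627776%Z.

Definition badd (a b : Z * Z) : Z * Z := (a.1 + b.1, a.2 + b.2)%Z.
Definition bopp (a : Z * Z) : Z * Z := (- a.1, a.2)%Z.
Definition bcst (z : Z) : Z * Z := (z * scale, 0)%Z.
Definition bscale (z : Z) (a : Z * Z) : Z * Z := (z * a.1, Z.abs z * a.2)%Z.
(** The [+ 2], here and in [bmul], pays for two floors, that of the midpoint and that of the radius;
    each loses less than one unit. *)
Definition bdiv (d : Z) (a : Z * Z) : Z * Z := (a.1 / d, a.2 / d + 2)%Z.
Definition bmul (a b : Z * Z) : Z * Z :=
  (Z.shiftr (a.1 * b.1) 40,
   Z.shiftr (Z.abs a.1 * b.2 + Z.abs b.1 * a.2 + a.2 * b.2) 40 + 2)%Z.
Definition bhull (a b : Z * Z) : Z * Z := (a.1, a.2 + Z.abs (b.1 - a.1) + b.2)%Z.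
Definition bpos (a : Z * Z) : bool := (a.2 <? a.1)%Z.

Fixpoint bcos_loop (n : nat) (i : Z) (y t s : Z * Z) : (Z * Z) * (Z * Z) :=
  if n is n'.+1 then
    bcos_loop n' (i + 1)%Z y
      (bopp (bdiv ((2 * i + 1) * (2 * i + 2))%Z (bmul t y))) (badd s t)
  else (s, badd s t).
Definition bcosT (n : nat) (x : Z * Z) : (Z * Z) * (Z * Z) :=
  bcos_loop n 0%Z (bmul x x) (bcst 1) (bcst 0).
(** The sums of 12 and 13 terms bracket the cosine from below and above. On [0, pi] they differ by
    at most pi^24 / 24!, less than two units. *)
Definition bcos (x : Z * Z) : Z * Z := let: (a, b) := bcosT 12 x in bhull a b.
(** With this radius the halved endpoints lie about 100 units from pi / 2, enough for [bcos] to
    decide the sign of the cosine there. *)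
Definition bpi : Z * Z := (3454217652358, 200)%Z.

Section Balls.
Context {R : realType}.
Implicit Types (x y : R) (a b : Z * Z).
Local Notation ZR := (@ZR R).

Definition bin x a := `|x * ZR scale - ZR a.1| <= ZR a.2.

Lemma scale_gt0 : 0 < ZR scale.
Proof. exact: ZR_gt0. Qed.

Lemma bin_add x y a b : bin x a -> bin y b -> bin (x + y) (badd a b).
Proof.
rewrite /bin /= !ZRD => xa yb.
have -> : (x + y) * ZR scale - (ZR a.1 + ZR b.1) =
  (x * ZR scale - ZR a.1) + (y * ZR scale - ZR b.1) :> R by ring.
exact: le_trans (ler_normD _ _) (lerD xa yb).
Qed.

Lemma bin_opp x a : bin x a -> bin (- x) (bopp a).
Proof. by rewrite /bin /= ZRN mulNr -opprD normrN. Qed.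

Lemma bin_cst z : bin (ZR z) (bcst z).
Proof. by rewrite /bin /= ZRM subrr normr0 ZR0. Qed.

Lemma bin_scale z x a : bin x a -> bin (ZR z * x) (bscale z a).
Proof.
rewrite /bin /= !ZRM ZR_abs -mulrA -mulrBr normrM => xa.
exact: ler_wpM2l.
Qed.

Lemma bin_div d x a : (0 < d)%Z -> bin x a -> bin (x / ZR d) (bdiv d a).
Proof.
rewrite /bin /= ZRD => d0 xa.
have D0 : 0 < ZR d := ZR_gt0 d0.
have h1 := @ZR_div_le R a.1 _ d0; have h2 := @ZR_div_gt R a.1 _ d0.
have h3 := @ZR_div_gt R a.2 _ d0.
rewrite -(ler_pM2r D0) -[X in _ * X <= _](gtr0_norm D0) -normrM mulrBl.
have -> : x / ZR d * ZR scale * ZR d = x * ZR scale :> R by field; rewrite gt_eqF.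
have -> : x * ZR scale - ZR (a.1 / d) * ZR d =
  (x * ZR scale - ZR a.1) + (ZR a.1 - ZR (a.1 / d) * ZR d) :> R by ring.
apply: le_trans (ler_normD _ _) _.
rewrite [`|ZR a.1 - _|]ger0_norm ?subr_ge0 // ZR2.
move: h1 h2 h3 xa; lra.
Qed.

Lemma bin_mul x y a b : bin x a -> bin y b -> bin (x * y) (bmul a b).
Proof.
rewrite /bin /bmul !Z.shiftr_div_pow2 // -[(2 ^ 40)%Z]/scale [_.2]/= ZRD [_.1]/= => xa yb.
set E := (Z.abs a.1 * b.2 + Z.abs b.1 * a.2 + a.2 * b.2)%Z.
have s0 := scale_gt0.
have h1 := @ZR_div_le R (a.1 * b.1) scale erefl.
have h2 := @ZR_div_gt R (a.1 * b.1) scale erefl.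
have h3 := @ZR_div_gt R E scale erefl.
rewrite -(ler_pM2r s0) -[X in _ * X <= _](gtr0_norm s0) -normrM mulrBl.
have -> : x * y * ZR scale * ZR scale - ZR (a.1 * b.1 / scale) * ZR scale =
  (ZR a.1 * (y * ZR scale - ZR b.1) + ZR b.1 * (x * ZR scale - ZR a.1)
  + (x * ZR scale - ZR a.1) * (y * ZR scale - ZR b.1)) +
  (ZR (a.1 * b.1) - ZR (a.1 * b.1 / scale) * ZR scale) :> R by rewrite ZRM; ring.
apply: le_trans (ler_normD _ _) _.
rewrite [X in _ + X]ger0_norm ?subr_ge0 //.
have hE : `|ZR a.1 * (y * ZR scale - ZR b.1) + ZR b.1 * (x * ZR scale - ZR a.1)
  + (x * ZR scale - ZR a.1) * (y * ZR scale - ZR b.1)| <= ZR E.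
  rewrite /E !ZRD !ZRM !ZR_abs.
  apply: le_trans (ler_normD _ _) _; apply: lerD.
    by apply: le_trans (ler_normD _ _) _; rewrite !normrM; apply: lerD; apply: ler_wpM2l.
  by rewrite normrM; apply: ler_pM.
rewrite ZR2; move: hE h1 h2 h3; lra.
Qed.

Lemma bin_hull x y z a b : bin x a -> bin y b -> x <= z <= y -> bin z (bhull a b).
Proof.
rewrite /bin /= !ZRD ZR_abs ZRB => xa yb /andP[xz zy].
have s0 := scale_gt0.
have : x * ZR scale <= z * ZR scale by rewrite ler_pM2r.
have : z * ZR scale <= y * ZR scale by rewrite ler_pM2r.
move: xa yb; rewrite !ler_norml => /andP[xa1 xa2] /andP[yb1 yb2] h1 h2.
have h3 := ler_norm (ZR b.1 - ZR a.1); have h4 := normr_ge0 (ZR b.1 - ZR a.1).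
by apply/andP; split; lra.
Qed.

Lemma bin_pos x a : bin x a -> bpos a -> 0 < x.
Proof.
rewrite /bin /bpos => xa /Z.ltb_lt/(@ZR_lt R) h.
have s0 := scale_gt0.
rewrite -(pmulr_lgt0 _ s0); move: xa; rewrite ler_norml => /andP[xa1 xa2]; lra.
Qed.

Lemma bin_cosT n x a : bin x a ->
  bin (cosT n x) (bcosT n a).1 /\ bin (cosT n.+1 x) (bcosT n a).2.
Proof.
move=> xa.
pose term i : R := (-1) ^+ i * x ^+ i.*2 / (i.*2)`!%:R.
have termS i : term i.+1 = - (term i * (x * x) / ZR ((2 * Z.of_nat i + 1) * (2 * Z.of_nat i + 2))).
  rewrite /term (_ : (_ * _)%Z = Z.of_nat (i.*2.+1 * i.*2.+2)); last by lia.
  rewrite ZR_nat doubleS !factS !natrM !exprS.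
  by field; rewrite pnatr_eq0 -lt0n fact_gt0 !gt_eqF ?ltr_wpDr.
suff H m i t s : bin (term i) t -> bin (cosT i x) s ->
    bin (cosT (i + m) x) (bcos_loop m (Z.of_nat i) (bmul a a) t s).1 /\
    bin (cosT (i + m).+1 x) (bcos_loop m (Z.of_nat i) (bmul a a) t s).2.
  rewrite -[n]add0n; apply: H.
    by rewrite /term expr0 fact0 !mul1r invr1; rewrite -ZR1; exact: (bin_cst 1).
  by rewrite /cosT big_ord0; rewrite -ZR0; exact: (bin_cst 0).
elim: m i t s => [|m IH] i t s ht hs.
  by rewrite addn0; split=> //; rewrite /cosT big_ord_recr /=; exact: bin_add.
rewrite addnS -addSn /= (_ : (_ + 1)%Z = Z.of_nat i.+1); last by lia.
apply: IH.
  by rewrite termS; apply/bin_opp/bin_div; [lia | do 2 apply: bin_mul => //].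
by rewrite /cosT big_ord_recr /=; exact: bin_add.
Qed.

Lemma bin_cos x a : 0 <= x -> bin x a -> bin (cos x) (bcos a).
Proof.
move=> x0 xa; have [h1 h2] := bin_cosT 12 xa.
rewrite /bcos; case: (bcosT 12 a) h1 h2 => b c h1 h2; apply: bin_hull h1 h2 _.
by rewrite cosT_le_cos // cos_le_cosT.
Qed.

(** pi / 2 is located by a sign change: the cosine is positive at half the lower endpoint and
    negative at half the upper one. The only prior bound on pi is [pi_ge2]. *)
Lemma bin_pi : bin (pi : R) bpi.
Proof.
have s0 := scale_gt0.
have bhalf z : bin (ZR z / 2 / ZR scale) (bdiv 2 (z, 0)%Z).
  rewrite (_ : _ / _ / _ = ZR z / ZR scale / ZR 2); last first.
    by rewrite ZR2 mulrAC.
  by apply: bin_div => //; rewrite /bin /= divfK ?gt_eqF // subrr normr0 ZR0.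
pose lo := (bpi.1 - bpi.2)%Z; pose hi := (bpi.1 + bpi.2)%Z.
have lo_pi : ZR lo / 2 / ZR scale < pi / 2.
  rewrite ltNge; apply/negP => h.
  have : 0 < cos (ZR lo / 2 / ZR scale).
    apply: (@bin_pos _ (bcos (bdiv 2 (lo, 0)%Z))); last by vm_compute.
    apply: bin_cos (bhalf lo).
    by rewrite !mulr_ge0 ?invr_ge0 ?(ltW s0) //; exact: ZR_ge0.
  have h2 : ZR lo / 2 / ZR scale <= pi.
    apply: le_trans (pi_ge2 R).
    rewrite ler_pdivrMr // ler_pdivrMr // -[in X in _ <= X]ZR2 -!ZRM.
    exact: ZR_le.
  have p0 := pi_gt0 R.
  rewrite -(subrK pi (ZR lo / 2 / ZR scale)) cosDpi oppr_gt0 => c0.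
  suff : 0 <= cos (ZR lo / 2 / ZR scale - pi) by rewrite leNgt c0.
  by apply: cos_ge0_pihalf; apply/andP; split; lra.
have pi_hi : pi / 2 < ZR hi / 2 / ZR scale.
  rewrite ltNge; apply/negP => h.
  have h0 : 0 <= ZR hi / 2 / ZR scale.
    by rewrite !mulr_ge0 ?invr_ge0 ?(ltW s0) //; exact: ZR_ge0.
  have : 0 < - cos (ZR hi / 2 / ZR scale).
    apply: (@bin_pos _ (bopp (bcos (bdiv 2 (hi, 0)%Z)))); last by vm_compute.
    exact/bin_opp/bin_cos.
  rewrite oppr_gt0 ltNge cos_ge0_pihalf // h andbT.
  by have p0 := pi_gt0 R; lra.
rewrite /bin ler_norml; apply/andP; split.
  move: lo_pi; rewrite ltr_pdivrMr // mulrAC ltr_pM2r ?invr_gt0 //.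
  by rewrite /lo ZRB; lra.
move: pi_hi; rewrite ltr_pdivlMr // mulrAC ltr_pM2r ?invr_gt0 //.
by rewrite /hi ZRD; lra.
Qed.

End Balls.

(** * Unit complex numbers and trigonometric expressions in rational angles *)

Section Cis.
Context {R : realType}.
Implicit Types x y : R.

Lemma cisD x y : cis (x + y) = cis x * cis y.
Proof. by rewrite /cis cosD sinD; apply/eqP; rewrite eq_complex /= addrC eqxx /= addrC. Qed.

Lemma cis0 : cis (0 : R) = 1.
Proof. by rewrite /cis cos0 sin0. Qed.

Lemma cisX x n : cis x ^+ n = cis (x * n%:R).
Proof.
elim: n => [|n IH]; first by rewrite mulr0 cis0.
by rewrite exprS IH -cisD -natr1 mulrDr mulr1 addrC.
Qed.

Lemma cisN x : cis (- x) = (cis x)^*.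
Proof. by rewrite /cis cosN sinN. Qed.

Lemma cis_conj x : cis x * (cis x)^* = 1.
Proof. by rewrite -cisN -cisD subrr cis0. Qed.

Lemma cis_neq0 x : cis x != 0.
Proof.
by apply/eqP => c0; have := cis_conj x; rewrite c0 mul0r => /eqP; rewrite eq_sym oner_eq0.
Qed.

Lemma cisV x : (cis x)^-1 = cis (- x).
Proof. by apply: (mulfI (cis_neq0 x)); rewrite divff ?cis_neq0 // -cisD subrr cis0. Qed.

Lemma nat2piE n : 2 * pi * n%:R = 0 + (pi *+ 2) *+ n :> R.
Proof. by rewrite add0r -[RHS]mulr_natr -[pi *+ 2]mulr_natl. Qed.

Lemma cos_nat2pi n : cos (2 * pi * n%:R) = 1 :> R.
Proof. by rewrite nat2piE (periodicn (@cosD2pi R)) cos0. Qed.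

Lemma sin_nat2pi n : sin (2 * pi * n%:R) = 0 :> R.
Proof. by rewrite nat2piE (periodicn (@sinD2pi R)) sin0. Qed.

Lemma cis_nat2pi n : cis (2 * pi * n%:R) = 1 :> R[i].
Proof. by rewrite /cis cos_nat2pi sin_nat2pi. Qed.

Lemma prim_cis n : (0 < n)%N -> n.-primitive_root (cis (2 * pi / n%:R : R)).
Proof.
move=> n0; have n0R : n%:R != 0 :> R by rewrite pnatr_eq0 -lt0n.
have p0 := pi_gt0 R.
apply/andP; split=> //; apply/forallP => -[i ilt] /=.
rewrite unity_rootE cisX; have [in_ | ni] := eqVneq i.+1 n.
  by rewrite in_ divfK // -[2 * pi]mulr1 (cis_nat2pi 1) eqxx.
apply/eqP; apply/eqP.
rewrite (_ : _ * _ = pi * (i.+1%:R / n%:R) *+ 2); last first.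
  by rewrite -[RHS]mulr_natl; ring.
move=> /(congr1 (@complex.Re _)) /=; rewrite cos_mulr2n cos2sin2.
have : 0 < sin (pi * (i.+1%:R / n%:R) : R).
  apply: sin_gt0_pi; rewrite mulr_gt0 // ?divr_gt0 ?ltr0n //=.
  by rewrite gtr_pMr // ltr_pdivrMr ?ltr0n // mul1r ltr_nat ltn_neqAle ni.
set s := sin _ => s0; have s2 : 0 < s ^+ 2 by rewrite exprn_gt0.
by rewrite -[in LHS](mulr_natl (1 - _)) => h; lra.
Qed.

End Cis.

(** Reduction modulo a full turn, then folding [r] to [d - r], brings the angle into [0, pi], where
    the truncation in [bcos] is sharp. *)
Definition bcos_frac (m : Z) (d : positive) : Z * Z :=
  let r := (m mod Zpos d)%Z in
  let r' := (if (2 * r <=? Zpos d)%Z then r else Zpos d - r)%Z in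
  bcos (bdiv (Zpos d) (bscale (2 * r') bpi)).

Lemma bin_cos_frac (R : realType) (m : Z) (d : positive) : (0 <= m)%Z ->
  bin (cos (2 * pi * ZR R m / ZR R (Zpos d))) (bcos_frac m d).
Proof.
rewrite /bcos_frac => m0; set r := (m mod Zpos d)%Z; set r' := (if _ then _ else _).
have d0 : 0 < ZR R (Zpos d) by exact: ZR_gt0.
have [r0 rd] := Z.mod_pos_bound m (Zpos d) erefl.
have r'0 : (0 <= r')%Z by rewrite /r'; case: ifP => _; rewrite /r; lia.
have -> : cos (2 * pi * ZR R m / ZR R (Zpos d)) = cos (ZR R (2 * r') * pi / ZR R (Zpos d)).
  have -> : ZR R m = ZR R (Zpos d) * (Z.to_nat (m / Zpos d))%:R + ZR R r.
    rewrite -ZR_nat Z2Nat.id; last exact: Z.div_pos.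
    by rewrite -ZRM -ZRD; congr (ZR R _); exact: Z.div_mod.
  rewrite (_ : _ / _ = 2 * pi * ZR R r / ZR R (Zpos d) + (pi *+ 2) *+ Z.to_nat (m / Zpos d)); last first.
    by rewrite -[RHS]addrC -[_ *+ Z.to_nat _]mulr_natr -[pi *+ 2]mulr_natl; field; rewrite gt_eqF.
  rewrite (periodicn (@cosD2pi R)) ZRM ZR2 /r'; case: ifP => _.
    by rewrite -(mulrAC 2).
  rewrite ZRB -[RHS]cosN -[RHS](@cosD2pi R); congr cos.
  by rewrite -[pi *+ 2]mulr_natl; field; rewrite gt_eqF.
apply: bin_cos.
  by rewrite divr_ge0 ?mulr_ge0 ?(ltW d0) ?pi_ge0 //; apply: ZR_ge0; lia.
by apply: bin_div => //; apply: bin_scale; exact: bin_pi.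
Qed.

(* [teval k] is the image of [teval 1] under the Galois conjugation raising roots
   of unity to the power [k]: [Tcos n d] stands for [cos (2 pi n / d)]. *)
Inductive texp :=
  | TZ of Z | Tcos of N & positive | Tadd of texp & texp | Tmul of texp & texp | Topp of texp.

Fixpoint teval (R : realType) (k : N) (e : texp) : R :=
  match e with
  | TZ z => ZR R z
  | Tcos n d => cos (2 * pi * ZR R (Z.of_N (k * n)) / ZR R (Zpos d))
  | Tadd e1 e2 => teval R k e1 + teval R k e2
  | Tmul e1 e2 => teval R k e1 * teval R k e2
  | Topp e1 => - teval R k e1
  end.

Fixpoint tball (k : N) (e : texp) : Z * Z :=
  match e with
  | TZ z => bcst z
  | Tcos n d => bcos_frac (Z.of_N (k * n)) d
  | Tadd e1 e2 => badd (tball k e1) (tball k e2)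
  | Tmul e1 e2 => bmul (tball k e1) (tball k e2)
  | Topp e1 => bopp (tball k e1)
  end.

Definition tpos (k : N) (e : texp) : bool := bpos (tball k e).

Fixpoint twf (m : positive) (e : texp) : bool :=
  match e with
  | TZ z => true
  | Tcos n d => (Zpos m mod Zpos d =? 0)%Z
  | Tadd e1 e2 => twf m e1 && twf m e2
  | Tmul e1 e2 => twf m e1 && twf m e2
  | Topp e1 => twf m e1
  end.

Section Teval.
Context {R : realType}.
Local Notation ZR := (ZR R).

Lemma bin_teval k e : bin (teval R k e) (tball k e).
Proof.
elim: e => [z|n d|e1 IH1 e2 IH2|e1 IH1 e2 IH2|e1 IH1] /=.
- exact: bin_cst.
- by apply: bin_cos_frac; lia.
- exact: bin_add.
- exact: bin_mul.
- exact: bin_opp.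
Qed.

Lemma tpos_gt0 k e : tpos k e -> 0 < teval R k e.
Proof. exact/bin_pos/bin_teval. Qed.

(** Each cosine is half the sum of a power of the [m]-th root of unity and its inverse. The inverse
    gets a natural exponent: with m = d q, the power n (d - 1) q is inverse to n q. *)
Lemma teval_poly (m : positive) (e : texp) : twf m e ->
  exists P : {poly rat}, forall k : N,
    (map_poly ratr P).[cis (2 * pi / (Pos.to_nat m)%:R : R) ^+ N.to_nat k] = (teval R k e)%:C%C.
Proof.
set z := cis _.
elim: e => [c _|n d /= wf|e1 IH1 e2 IH2 /= /andP[/IH1[P1 h1] /IH2[P2 h2]]|
  e1 IH1 e2 IH2 /= /andP[/IH1[P1 h1] /IH2[P2 h2]]|e1 IH1 /= /IH1[P1 h1]].
- exists ((int_of_Z c)%:~R)%:P => k; rewrite map_polyC hornerC /= ratr_int.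
  by rewrite unlock rmorph_int.
- pose q := Z.to_nat (Zpos m / Zpos d); pose i := (N.to_nat n * q)%N.
  pose j := (N.to_nat n * (Pos.to_nat d).-1 * q)%N.
  have mE : Pos.to_nat m = (Pos.to_nat d * q)%N.
    move/Z.eqb_eq: wf => wf; have := Z.div_mod (Zpos m) (Zpos d) (fun h => ltac:(discriminate h)).
    have : (0 <= Zpos m / Zpos d)%Z by exact: Z.div_pos.
    rewrite wf /q; nia.
  have m0 : (0 < Pos.to_nat m)%N by lia.
  have d0 : (0 < Pos.to_nat d)%N by lia.
  have zi (k : N) : z ^+ N.to_nat k ^+ i = cis (2 * pi * ZR (Z.of_N (k * n)) / ZR (Zpos d)).
    rewrite /z !cisX; congr cis.
    rewrite (_ : Z.of_N (k * n) = Z.of_nat (N.to_nat k * N.to_nat n)); last by lia.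
    rewrite (_ : Zpos d = Z.of_nat (Pos.to_nat d)); last by lia.
    rewrite !ZR_nat /i mE !natrM.
    have q0 : (q%:R : R) != 0 by rewrite pnatr_eq0; lia.
    by field; rewrite q0 pnatr_eq0; lia.
  have zj (k : N) : z ^+ N.to_nat k ^+ j = (cis (2 * pi * ZR (Z.of_N (k * n)) / ZR (Zpos d)))^*.
    rewrite -zi; apply: (mulfI (x := z ^+ N.to_nat k ^+ i)).
      by rewrite !expf_eq0 (negbTE (cis_neq0 _)) !andbF.
    rewrite zi cis_conj -zi -exprD /i /j -mulnDl -{1}[N.to_nat n]muln1 -mulnDr add1n prednK //.
    rewrite -mulnA -mE -exprM mulnA mulnC exprM.
    by rewrite [z ^+ _](prim_expr_order (prim_cis m0)) expr1n.
  exists (2^-1 *: ('X^i + 'X^j)) => k.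
  rewrite map_polyZ rmorphD /= !map_polyXn !hornerE zi zj fmorphV /= rmorph_nat.
  rewrite addcJ /= mulrA mulVf ?mul1r // pnatr_eq0.
- by exists (P1 + P2) => k; rewrite rmorphD hornerD h1 h2 -rmorphD.
- by exists (P1 * P2) => k; rewrite rmorphM hornerM h1 h2 -rmorphM.
- by exists (- P1) => k; rewrite rmorphN hornerN h1 -rmorphN.
Qed.

Lemma teval_conj (m : positive) (k : N) (e : texp) :
  twf m e -> Z.gcd (Z.of_N k) (Zpos m) = 1%Z -> teval R 1 e = 0 -> teval R k e = 0.
Proof.
move=> /teval_poly[P hP] gcd1 e0.
have m0 : (0 < Pos.to_nat m)%N by lia.
have km : coprime (N.to_nat k) (Pos.to_nat m) by rewrite /coprime; lia.
have := hP 1%num; rewrite e0 expr1 => P0.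
have := root_cyclotomic_conj (prim_cis (R := R) m0) km (P := P).
rewrite !rootE P0 hP eqxx => /(_ isT) /eqP h.
by have /= := congr1 (@complex.Re _) h.
Qed.

(* [hcheb Y E n] evaluates to [E ^ n * V_n (Y / E)], where [V_n] is the
   polynomial with [V_n (2 cos t) = 2 cos (n t)]. *)
Fixpoint hcheb2 (Y E : texp) (n : nat) : texp * texp :=
  if n is n'.+1 then
    let: (a, b) := hcheb2 Y E n' in
    (b, Tadd (Tmul Y b) (Topp (Tmul (Tmul E E) a)))
  else (TZ 2, Y).

Lemma twf_hcheb2 m Y E n : twf m Y -> twf m E ->
  twf m (hcheb2 Y E n).1 && twf m (hcheb2 Y E n).2.
Proof.
move=> wY wE; elim: n => [|n] //=; case: (hcheb2 Y E n) => a b /= /andP[-> ->].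
by rewrite wY wE.
Qed.

Fixpoint cheb2 (y : R) (n : nat) : R * R :=
  if n is n'.+1 then let: (a, b) := cheb2 y n' in (b, y * b - a) else (2, y).

Lemma teval_hcheb2 k Y E n (y : R) : teval R k Y = y * teval R k E ->
  teval R k (hcheb2 Y E n).1 = teval R k E ^+ n * (cheb2 y n).1 /\
  teval R k (hcheb2 Y E n).2 = teval R k E ^+ n.+1 * (cheb2 y n).2.
Proof.
move=> hY; elim: n => [|n] /=; first by rewrite hY expr0 expr1 mul1r mulrC ZR2.
case: (hcheb2 Y E n) => a b; case: (cheb2 y n) => c d /= [-> ->]; split=> //.
by rewrite hY !exprS; ring.
Qed.

Lemma cheb2_cos t n : cheb2 (2 * cos t) n = (2 * cos (n%:R * t), 2 * cos (n.+1%:R * t)).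
Proof.
elim: n => [|n /= ->]; first by rewrite /= mul0r cos0 mulr1 mul1r.
congr pair.
have -> : n.+2%:R * t = n.+1%:R * t + t by rewrite -natr1; ring.
have -> : n%:R * t = n.+1%:R * t - t by rewrite -natr1; ring.
by rewrite cosB cosD; ring.
Qed.

Lemma cheb2_gt2 (y : R) n : 2 < y -> 2 <= (cheb2 y n).1 < (cheb2 y n).2.
Proof.
move=> y2; elim: n => [|n] /=; first by rewrite lexx.
case: (cheb2 y n) => c d /= /andP[c2 cd]; apply/andP; split; first lra.
have : 0 < (y - 2) * d by rewrite mulr_gt0 //; lra.
lra.
Qed.

(* If [N / D = 2 cos t] with [t / pi] rational then every Galois conjugate of
   [N / D] is at most 2 in absolute value. *)
Lemma rational_angle_conj (m : positive) (k : N) (N D : texp) (t : R) (n : nat) :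
    twf m N -> twf m D -> Z.gcd (Z.of_N k) (Zpos m) = 1%Z -> (0 < n)%N ->
    teval R 1 D != 0 -> teval R 1 N = 2 * cos t * teval R 1 D ->
    cos (n%:R * (2 * t)) = 1 ->
    teval R k D != 0 -> teval R k N ^+ 2 <= 4 * teval R k D ^+ 2.
Proof.
move=> wN wD gcd1 n0 D0 ND c1 Dk0.
(* Y / E = (N / D)^2 - 2 = 2 cos (2 t): the hypothesis concerns multiples of 2 t, not of t.
   Numerator and denominator stay apart because [texp] has no division. *)
pose E := Tmul D D; pose Y := Tadd (Tmul N N) (Topp (Tmul (TZ 2) E)).
have wE : twf m E by rewrite /= wD.
have wY : twf m Y by rewrite /= wN wD.
pose yk := teval R k N ^+ 2 / teval R k D ^+ 2 - 2.
have hYk : teval R k Y = yk * teval R k E.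
  by rewrite /= /yk ZR2; field.
have hY1 : teval R 1 Y = 2 * cos (2 * t) * teval R 1 E.
  by rewrite /= ND ZR2 [2 * t]mulr_natl cos_mulr2n; ring.
have h2 i : teval R i (Tmul (TZ 2) E) = 2 * teval R i E by rewrite /= ZR2.
have V2 : (cheb2 2 n).1 = 2.
  by have := cheb2_cos 0 n; rewrite cos0 mulr1 => -> /=; rewrite mulr0 cos0 mulr1.
(* This is E^n (V_n(Y / E) - V_n(2)), which vanishes because V_n(2 cos 2t) = 2 cos (2 n t) = 2 =
   V_n(2). *)
pose Z0 := Tadd (hcheb2 Y E n).1 (Topp (hcheb2 (Tmul (TZ 2) E) E n).1).
have wZ : twf m Z0.
  rewrite /=; have /andP[-> _] := twf_hcheb2 n wY wE.
  by have /andP[-> _] := twf_hcheb2 n (Y := Tmul (TZ 2) E) wE wE.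
have : teval R k Z0 = 0.
  apply: (teval_conj wZ gcd1) => /=.
  have [-> _] := teval_hcheb2 n hY1; have [-> _] := teval_hcheb2 n (h2 1%num).
  by rewrite V2 cheb2_cos /= c1 mulr1 subrr.
rewrite /=; have [-> _] := teval_hcheb2 n hYk; have [-> _] := teval_hcheb2 n (h2 k).
rewrite V2 -mulrBr => /eqP; rewrite mulf_eq0 expf_eq0 mulf_eq0 orbb (negbTE Dk0) andbF /=.
rewrite subr_eq0 => /eqP yk2.
suff : yk <= 2.
  by rewrite /yk lerBlDr ler_pdivrMr ?exprn_even_gt0 //; lra.
rewrite leNgt; apply/negP => ygt2.
case: n yk2 n0 {c1 V2 Z0 wZ} => // n yk2 _.
have := cheb2_gt2 n ygt2; move: yk2 => /=; case: (cheb2 yk n) => c d /= ->.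
by case/andP=> h1; rewrite ltNge h1.
Qed.

End Teval.

(** * Complex reflections in discrete groups *)

Section Discrete.
Context {R : realType}.
Local Notation C := R[i].

Lemma discrete_mx_eq n (G : set 'M[C]_n) (A : 'M[C]_n) :
  discrete_mx G -> G A -> exists2 e : R, 0 < e &
  forall B, G B -> (forall i j, `|B i j - A i j| < (e%:C)%C) -> B = A.
Proof.
move=> dG GA; have [_ [V /nbhs_ballP[e /= e0 eV] VG]] := dG _ GA.
have eE : e = ((complex.Re e)%:C)%C.
  by case: e e0 {eV} => a b; rewrite ltcE /= => /andP[/eqP-> _].
have re0 : 0 < complex.Re e by move: e0; rewrite {1}eE ltcR.
exists (complex.Re e) => // B GB BA; suff : (V `&` G) B by rewrite VG.
split=> //; apply: eV; split=> // i j; rewrite -ball_normE /= distrC.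
by have := BA i j; rewrite -eE.
Qed.

Lemma ge0_ReE (x : C) : 0 <= x -> x = ((complex.Re x)%:C)%C.
Proof. by case: x => a b; rewrite lecE /= => /andP[/eqP-> _]. Qed.

(** The bound [d] depends on the directions [M1], ..., [M4] but not on the coefficients, so it can
    be fixed before the element of the group is chosen. Four directions are what the outer product
    of x v + y w with its adjoint expands into. *)
Lemma discrete_mx_comb n (G : set 'M[C]_n) (A M1 M2 M3 M4 : 'M[C]_n) :
  discrete_mx G -> G A -> exists2 d : R, 0 < d &
  forall s1 s2 s3 s4 : C, `|s1| < (d%:C)%C -> `|s2| < (d%:C)%C -> `|s3| < (d%:C)%C ->
    `|s4| < (d%:C)%C -> G (A + s1 *: M1 + s2 *: M2 + s3 *: M3 + s4 *: M4) ->
    A + s1 *: M1 + s2 *: M2 + s3 *: M3 + s4 *: M4 = A.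
Proof.
move=> dG GA; have [e e0 eG] := discrete_mx_eq dG GA.
pose K : C := \sum_i \sum_j (`|M1 i j| + `|M2 i j| + `|M3 i j| + `|M4 i j|).
have K0 : 0 <= K by do 2 apply: sumr_ge0 => ? _; rewrite !addr_ge0.
have leK i j : `|M1 i j| + `|M2 i j| + `|M3 i j| + `|M4 i j| <= K.
  rewrite /K (bigD1 i) //= (bigD1 j) //=; apply: ler_wpDr.
    by do 2 apply: sumr_ge0 => ? _; rewrite !addr_ge0.
  by apply: ler_wpDr => //; apply: sumr_ge0 => ? _; rewrite !addr_ge0.
pose k := complex.Re K; have KE : K = (k%:C)%C := ge0_ReE K0.
have k0 : 0 <= k by move: K0; rewrite KE lecR.
have k1 : 0 < k + 1 by rewrite ltr_wpDl.
exists (e / (k + 1)); first by rewrite divr_gt0.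
set d := e / _ => s1 s2 s3 s4 h1 h2 h3 h4 GB; apply: eG => // i j.
rewrite !mxE; set m1 := M1 i j; set m2 := M2 i j; set m3 := M3 i j; set m4 := M4 i j.
have -> : A i j + s1 * m1 + s2 * m2 + s3 * m3 + s4 * m4 - A i j =
  s1 * m1 + s2 * m2 + s3 * m3 + s4 * m4 by ring.
apply: (@le_lt_trans _ _ ((d%:C)%C * K)).
  apply: le_trans (_ : (d%:C)%C * (`|m1| + `|m2| + `|m3| + `|m4|) <= _); last first.
    by apply: ler_wpM2l (leK i j); rewrite lecR divr_ge0 ?ltW.
  rewrite !mulrDr; do 3 (apply: le_trans (ler_normD _ _) _; apply: lerD; last by rewrite normrM ler_wpM2r // ltW).
  by rewrite normrM ler_wpM2r // ltW.
rewrite KE -rmorphM ltcR /d mulrAC ltr_pdivrMr // ltr_pM2l //; lra.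
Qed.

End Discrete.

HB.lock Definition form (C : numClosedFieldType) n (H : 'M[C]_n) (x y : 'cV[C]_n) : C :=
  (y^t* *m H *m x) 0 0.

(** The complex reflection with polar vector [v]: it multiplies [v] by [u] and fixes the orthogonal
    complement of [v]. *)
HB.lock Definition refl (C : numClosedFieldType) n (H : 'M[C]_n) (v : 'cV[C]_n) (u : C) :
  'M[C]_n := 1%:M + ((u - 1) / form H v v) *: (v *m (v^t* *m H)).

Section Form.
Context {C : numClosedFieldType} {n : nat}.
Implicit Types (H g M : 'M[C]_n) (v w x y : 'cV[C]_n) (u s : C).

Lemma adjmxM m k l (A : 'M[C]_(m, k)) (B : 'M[C]_(k, l)) : (A *m B)^t* = B^t* *m A^t*.
Proof. by rewrite trmx_mul map_mxM. Qed.

Lemma adjmxD m k (A B : 'M[C]_(m, k)) : (A + B)^t* = A^t* + B^t*.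
Proof. by rewrite linearD /= map_mxD. Qed.

Lemma adjmxZ m k s (A : 'M[C]_(m, k)) : (s *: A)^t* = s^* *: A^t*.
Proof. by rewrite linearZ /= map_mxZ. Qed.

Lemma adjmx1 : (1%:M : 'M[C]_n)^t* = 1%:M.
Proof. by rewrite trmx1 map_mx1. Qed.

Lemma formE H x y : y^t* *m H *m x = (form H x y)%:M.
Proof. by rewrite form.unlock; exact: mx11_scalar. Qed.

Lemma formDl H x x' y : form H (x + x') y = form H x y + form H x' y.
Proof. by rewrite form.unlock mulmxDr mxE. Qed.

Lemma formZl H s x y : form H (s *: x) y = s * form H x y.
Proof. by rewrite form.unlock -scalemxAr mxE. Qed.

Lemma formZr H s x y : form H x (s *: y) = s^* * form H x y.
Proof. by rewrite form.unlock adjmxZ -!scalemxAl mxE. Qed.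

Lemma form_conj H x y : H^t* = H -> (form H x y)^* = form H y x.
Proof.
move=> hH; rewrite form.unlock.
have -> : (x^t* *m H *m y) = (y^t* *m H *m x)^t*.
  by rewrite !adjmxM hH trmxCK mulmxA.
by rewrite [RHS]mxE [in RHS]mxE.
Qed.

Lemma reflE H v u : refl H v u = 1%:M + ((u - 1) / form H v v) *: (v *m (v^t* *m H)).
Proof. by rewrite refl.unlock. Qed.

Lemma refl_app H v u x : refl H v u *m x = x + ((u - 1) * form H x v / form H v v) *: v.
Proof.
rewrite !reflE mulmxDl mul1mx -scalemxAl -mulmxA formE mul_mx_scalar scalerA.
by congr (_ + _ *: _); ring.
Qed.

Definition preserves H g := g^t* *m H *m g = H.

Lemma form_preserves H g x y : preserves H g -> form H (g *m x) (g *m y) = form H x y.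
Proof. by move=> pg; rewrite form.unlock adjmxM -[in RHS]pg !mulmxA. Qed.

Lemma preserves1 H : preserves H 1%:M.
Proof. by rewrite /preserves adjmx1 mul1mx mulmx1. Qed.

Lemma preservesM H g g' : preserves H g -> preserves H g' -> preserves H (g *m g').
Proof.
by rewrite /preserves adjmxM => pg pg'; rewrite -[RHS]pg' -[in RHS]pg !mulmxA.
Qed.

Lemma preservesV H g : g \in unitmx -> preserves H g -> preserves H (invmx g).
Proof.
move=> ug pg; rewrite /preserves -[in LHS]pg !mulmxA -adjmxM mulmxV // adjmx1 mul1mx.
by rewrite -mulmxA mulmxV // mulmx1.
Qed.

Lemma preservesZ H s g : s * s^* = 1 -> preserves H g -> preserves H (s *: g).
Proof.
by move=> s1 pg; rewrite /preserves adjmxZ -!scalemxAl -scalemxAr scalerA mulrC s1 scale1r.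
Qed.

Lemma refl_preserves H v u : H^t* = H -> form H v v != 0 -> u * u^* = 1 ->
  preserves H (refl H v u).
Proof.
move=> hH h0 u1; set h := form H v v in h0 *.
have hh : h^* = h by rewrite /h form_conj.
have E1 : (v *m (v^t* *m H))^t* = H *m v *m v^t* by rewrite !adjmxM hH trmxCK.
rewrite /preserves reflE -/h adjmxD adjmx1 adjmxZ E1.
set k := (u - 1) / h.
set Q := H *m v *m v^t* *m H.
have E2 : H *m (v *m (v^t* *m H)) = Q by rewrite /Q !mulmxA.
have E3 : Q *m (v *m (v^t* *m H)) = h *: Q.
  have -> : Q = H *m v *m (v^t* *m H) by rewrite /Q !mulmxA.
  by rewrite -[LHS]mulmxA (mulmxA _ v) formE -/h mul_scalar_mx -scalemxAr.
rewrite mulmxDl mul1mx -scalemxAl -/Q mulmxDr mulmx1 -!scalemxAr mulmxDl E2 -scalemxAl E3.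
(* The left side equals (u u^* - 1) / h, so this is where [u] having modulus one enters. *)
have k0 : k^* + k + k * k^* * h = 0.
  rewrite /k rmorphM rmorphB /= rmorph1 fmorphV /= hh.
  have -> : (u^* - 1) / h + (u - 1) / h + (u - 1) / h * ((u^* - 1) / h) * h = (u * u^* - 1) / h by field.
  by rewrite u1 subrr mul0r.
by rewrite scalerDr !scalerA -addrA -[RHS]addr0 -!scalerDl addrA k0 scale0r.
Qed.

Lemma refl_conj H g v u : preserves H g -> g \in unitmx ->
  g *m refl H v u *m invmx g = refl H (g *m v) u.
Proof.
move=> pg ug; rewrite !reflE form_preserves // mulmxDr mulmx1 mulmxDl mulmxV //.
rewrite -scalemxAr -scalemxAl; congr (_ + _ *: _).
have -> : v^t* *m H = (g *m v)^t* *m H *m g by rewrite adjmxM -[in LHS]pg !mulmxA.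
by rewrite !mulmxA mulmxK.
Qed.

End Form.

Definition isometry_group (R : realType) n (H : 'M[R[i]]_n) (G : set 'M[R[i]]_n) :=
  [/\ G 1%:M, forall A B, G A -> G B -> G (A *m B),
      forall A, G A -> G (invmx A) & forall A, G A -> preserves H A /\ A \in unitmx].

Lemma expr_lt_eps (R : realType) (q eta : R) : 0 <= q < 1 -> 0 < eta ->
  exists k, q ^+ k < eta.
Proof.
move=> /andP[q0 q1] eta0; have : `|q| < 1 by rewrite ger0_norm.
move=> /cvg_expr /cvgrPdist_lt /(_ _ eta0) [k _ /(_ k (leqnn k))] /=.
by rewrite sub0r normrN ger0_norm ?exprn_ge0 // => h; exists k.
Qed.

(** * Jorgensen's inequality for two conjugate reflections *)

Section Jorgensen.
Context {R : realType} {n : nat}.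
Local Notation C := R[i].
Variables (H : 'M[C]_n) (G : set 'M[C]_n).
Hypotheses (hH : H^t* = H) (gG : isometry_group H G).

Lemma norm_lt_real (z : C) (r d : R) : 0 < d -> z * z^* = (r%:C)%C -> r < d ^+ 2 ->
  `|z| < (d%:C)%C.
Proof.
move=> d0 zr rd; rewrite -(@ltr_pXn2r _ 2) ?nnegrE ?normr_ge0 ?lecR ?(ltW d0) //.
by rewrite normCK zr -rmorphXn ltcR.
Qed.

Lemma scalemxM (a b : C) (v : 'cV[C]_n) (r : 'rV[C]_n) :
  (a *: v) *m (b *: r) = (a * b) *: (v *m r).
Proof. by rewrite -scalemxAl -scalemxAr scalerA. Qed.

Lemma outer_bilinear (a b a' b' : C) (v w : 'cV[C]_n) (r s : 'rV[C]_n) :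
  (a *: v + b *: w) *m (a' *: r + b' *: s) =
  (a * a') *: (v *m r) + (a * b') *: (v *m s) + (a' * b) *: (w *m r) + (b * b') *: (w *m s).
Proof. by rewrite mulmxDl !mulmxDr !scalemxM addrA (mulrC a' b). Qed.

Lemma outerE (a b : C) (v w : 'cV[C]_n) :
  (a *: v + b *: w) *m ((a *: v + b *: w)^t* *m H) =
  (a * a^*) *: (v *m (v^t* *m H)) + (a * b^*) *: (v *m (w^t* *m H))
  + (a^* * b) *: (w *m (v^t* *m H)) + (b * b^*) *: (w *m (w^t* *m H)).
Proof.
have -> : (a *: v + b *: w)^t* *m H = a^* *: (v^t* *m H) + b^* *: (w^t* *m H).
  by rewrite adjmxD !adjmxZ mulmxDl -!scalemxAl.
exact: outer_bilinear.
Qed.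

Lemma comb_outer (rho k s1 s2 s3 s4 : C) (X1 X2 X3 X4 : 'M[C]_n) :
  rho *: (1%:M + k *: ((s1 + 1) *: X1 + s2 *: X2 + s3 *: X3 + s4 *: X4)) =
  rho *: (1%:M + k *: X1) + s1 *: ((rho * k) *: X1) + s2 *: ((rho * k) *: X2)
  + s3 *: ((rho * k) *: X3) + s4 *: ((rho * k) *: X4).
Proof. by apply/matrixP => i j; rewrite !mxE; ring. Qed.

Section Iteration.
Variables (e : R) (rho u x0 : C).

(** [jor_c] and [jor_d] are the squared moduli of [jor_x] and [jor_y], the coordinates of the k-th
    polar vector along [v] and along a vector orthogonal to [v] (see [jor_xy]). *)
Fixpoint jor_c (c : R) (k : nat) : R :=
  if k is k'.+1 then 1 + e * jor_c c k' * (jor_c c k' - 1) else c.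

Fixpoint jor_d (c : R) (k : nat) : R :=
  if k is k'.+1 then e * jor_c c k' * jor_d c k' else 1.

Fixpoint jor_x (k : nat) : C :=
  if k is k'.+1 then rho * (1 + (u - 1) * (jor_x k' * (jor_x k')^*)) else x0.

Fixpoint jor_y (k : nat) : C :=
  if k is k'.+1 then rho * (u - 1) * (jor_x k')^* * jor_y k' else 1.

(** As long as c_k <= c, the factor e c_k is at most e c < 1, so both c_k - 1 and d_k shrink
    geometrically, while c_k - 1 stays positive. *)
Lemma jor_bound c k : 1 < c -> 0 < e -> e * c < 1 ->
  [/\ 1 < jor_c c k, jor_c c k <= c, jor_c c k - 1 <= (e * c) ^+ k * (c - 1),
      0 <= jor_d c k & jor_d c k <= (e * c) ^+ k].
Proof.
move=> c1 e0 ec; have c0 : 0 < c by lra.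
elim: k => [|k [IH1 IH2 IH3 IH4 IH5]] /=.
  by rewrite expr0 mul1r; split.
set x := jor_c c k in IH1 IH2 IH3 *.
have ex : 0 < e * x by rewrite mulr_gt0 //; lra.
have exec : e * x <= e * c by rewrite ler_pM2l.
have x1 : 0 < x - 1 by lra.
have h1 : 0 < e * x * (x - 1) by rewrite mulr_gt0.
have h2 : e * x * (x - 1) <= (e * c) * ((e * c) ^+ k * (c - 1)) by apply: ler_pM => //; lra.
have h3 : e * x * (x - 1) <= x - 1 by rewrite ger_pMl //; lra.
have h4 : e * x * jor_d c k <= e * c * (e * c) ^+ k by apply: ler_pM => //; lra.
split; rewrite ?exprS -?mulrA; move: h1 h2 h3 h4; rewrite -?mulrA; try lra.
by move=> *; rewrite mulrA mulr_ge0 //; lra.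
Qed.

Hypotheses (rho1 : rho * rho^* = 1) (u1 : u * u^* = 1) (ue : (u - 1) * (u - 1)^* = (e%:C)%C).

Lemma jor_xy c k : x0 * x0^* = (c%:C)%C ->
  jor_x k * (jor_x k)^* = ((jor_c c k)%:C)%C /\
  jor_y k * (jor_y k)^* = ((jor_d c k)%:C)%C.
Proof.
move=> hc; elim: k => [|k [IH1 IH2]] /=; first by rewrite rmorph1 mulr1.
(* Since |u| = 1, twice the real part of u - 1 is -|u - 1|^2. Hence |1 + (u - 1) a|^2 = 1 + e a (a -
   1) for real a, the recurrence of [jor_c]. *)
have uu : (u - 1) + (u - 1)^* = - (e%:C)%C.
  rewrite -ue !rmorphB /= !rmorph1.
  by rewrite mulrBl mul1r mulrBr u1 mulr1; ring.
set x := jor_x k in IH1 IH2 *; set y := jor_y k in IH2 *.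
split.
  rewrite IH1; set a := ((jor_c c k)%:C)%C.
  have -> : (rho * (1 + (u - 1) * a))^* = rho^* * (1 + (u - 1)^* * a).
    rewrite !rmorphM rmorphD rmorphM rmorph1; congr (_ * (1 + _ * _)).
    exact: conjc_real.
  have -> : ((1 + e * jor_c c k * (jor_c c k - 1))%:C)%C = 1 + (e%:C)%C * a * (a - 1).
    by rewrite rmorphD !rmorphM rmorphB rmorph1.
  rewrite mulrACA rho1 mul1r.
  transitivity (1 + ((u - 1) + (u - 1)^*) * a + (u - 1) * (u - 1)^* * a * a).
    by ring.
  by rewrite uu ue; ring.
rewrite !rmorphM /= conjCK.
transitivity ((rho * rho^*) * ((u - 1) * (u - 1)^*) * (x * x^*) * (y * y^*)).
  by ring.
by rewrite rho1 ue IH1 IH2 mul1r.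
Qed.

End Iteration.

(* Iterating [B |-> B A B^-1] from [B = g A g^-1] gives reflections with polar
   vectors [x_k v + y_k w], [w] orthogonal to [v], and angle parameters
   [c_(k+1) - 1 = |u - 1|^2 c_k (c_k - 1)], so they tend to [A] without
   reaching it. *)
Lemma jorgensen (rho u : C) (v : 'cV[C]_n) (g : 'M[C]_n) (c e : R) :
    rho * rho^* = 1 -> u * u^* = 1 -> (u - 1) * (u - 1)^* = (e%:C)%C ->
    G (rho *: refl H v u) -> G g -> form H v v != 0 ->
    form H (g *m v) v * (form H (g *m v) v)^* = (c%:C)%C * (form H v v) ^+ 2 ->
    1 < c -> 0 < e -> e * c < 1 -> ~ discrete_mx G.
Proof.
move=> rho1 u1 ue GA Gg h0 hc c1 e0 ec dG.
have [G1 GM GV Gp] := gG.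
set A := rho *: refl H v u in GA *.
set h := form H v v in h0 hc *.
have hh : h^* = h by rewrite /h form_conj.
pose x0 := form H (g *m v) v / h.
have x0c : x0 * x0^* = (c%:C)%C.
  rewrite /x0 rmorphM fmorphV /= hh mulrACA hc -mulrA expr2 mulrA.
  by rewrite -mulrA mulrACA divff // mulr1 mulr1.
pose w := g *m v - x0 *: v.
pose xs := jor_x rho u x0; pose ys := jor_y rho u x0.
pose vs k := xs k *: v + ys k *: w.
have wv : form H w v = 0.
  by rewrite /w -scaleN1r formDl formZl formZl mulN1r -/h /x0 divfK // subrr.
have vsv k : form H (vs k) v = xs k * h.
  by rewrite /vs formDl !formZl wv mulr0 addr0.
have vs0 : vs 0%N = g *m v by rewrite /vs /= scale1r /w addrC subrK.
(* B v is the polar vector of B A B^-1 by [refl_conj], so this computes the next polar vector; its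
   coordinates follow the recurrences of [jor_x] and [jor_y]. *)
have step k B : B = rho *: refl H (vs k) u -> form H (vs k) (vs k) = h ->
    B *m v = vs k.+1.
  move=> -> hk; rewrite -scalemxAl refl_app hk -(form_conj _ _ hH) vsv rmorphM /= hh.
  rewrite mulrA mulfK // /vs scalerDr scalerA scalerDr !scalerA /=.
  rewrite -/(xs k) -/(ys k) addrA -scalerDl; congr (_ *: _ + _ *: _); ring.
have main k : G (rho *: refl H (vs k) u) /\ form H (vs k) (vs k) = h.
  elim: k => [|k [IH1 IH2]].
    have [pg ug] := Gp _ Gg; rewrite vs0 (form_preserves _ _ pg); split; last exact: erefl.
    rewrite -(refl_conj _ _ pg ug) scalemxAl scalemxAr.
    exact: (GM _ _ (GM _ _ Gg GA) (GV _ Gg)).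
  have [pB uB] := Gp _ IH1; have Bv := step k _ erefl IH2.
  rewrite -Bv (form_preserves _ _ pB); split; last exact: erefl.
  rewrite -(refl_conj _ _ pB uB) scalemxAl scalemxAr.
  exact: (GM _ _ (GM _ _ IH1 GA) (GV _ IH1)).
pose K s := (rho * ((u - 1) / h)) *: s : 'M[C]_n.
have [d d0 dP] := discrete_mx_comb (K (v *m (v^t* *m H))) (K (v *m (w^t* *m H)))
  (K (w *m (v^t* *m H))) (K (w *m (w^t* *m H))) dG GA.
have c0 : 0 < c by lra.
have q01 : 0 <= e * c < 1 by rewrite ec mulr_ge0 ?ltW.
(* The squared moduli of the four coefficients below are at most q (c - 1)^2, q c (twice) and q,
   with q = (e c)^k. The denominator dominates all three factors. *)
pose eta := d ^+ 2 / (c + c ^+ 2 + 1).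
have D0 : 0 < c + c ^+ 2 + 1 by rewrite !addr_gt0 ?exprn_gt0.
have eta0 : 0 < eta by rewrite divr_gt0 // exprn_gt0.
have [k qk] := expr_lt_eps q01 eta0.
have [b1 b2 b3 b4 b5] := jor_bound k c1 e0 ec.
have [xx yy] := jor_xy rho1 u1 ue k x0c.
set ck := jor_c e c k in b1 b2 b3 xx; set dk := jor_d e c k in b4 b5 yy.
rewrite -/(xs k) in xx; rewrite -/(ys k) in yy.
set q := (e * c) ^+ k in qk b3 b5.
have qd : q * (c + c ^+ 2 + 1) < d ^+ 2 by rewrite -ltr_pdivlMr.
have q0 : 0 <= q by rewrite exprn_ge0 // mulr_ge0 ?ltW.
have qc : 0 <= q * c by rewrite mulr_ge0 // ltW.
have qcc : 0 <= q * c ^+ 2 by rewrite mulr_ge0 // exprn_ge0 // ltW.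
have qE : q * (c + c ^+ 2 + 1) = q * c + q * c ^+ 2 + q by ring.
have q1 : q <= 1 by rewrite exprn_ile1 //; case/andP: q01 => ? /ltW.
have cd : ck * dk <= c * q by apply: ler_pM => //; rewrite ltW // (lt_trans ltr01).
have dkck : dk * dk <= q by apply: le_trans (_ : q * q <= _); [apply: ler_pM | rewrite ler_piMr].
have qc1 : q * (c - 1) ^+ 2 = q * c ^+ 2 - 2 * (q * c) + q by ring.
have ckck : (ck - 1) ^+ 2 <= q * (c - 1) ^+ 2.
  apply: (@le_trans _ _ ((q * (c - 1)) ^+ 2)).
    by rewrite lerXn2r ?nnegrE ?mulr_ge0 // subr_ge0 ltW.
  by rewrite exprMn ler_wpM2r ?sqr_ge0 // expr2 ler_piMr.
pose s1 : C := xs k * (xs k)^* - 1; pose s2 := xs k * (ys k)^*.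
pose s3 := (xs k)^* * ys k; pose s4 := ys k * (ys k)^*.
have EB : rho *: refl H (vs k) u = A + s1 *: K (v *m (v^t* *m H)) + s2 *: K (v *m (w^t* *m H))
    + s3 *: K (w *m (v^t* *m H)) + s4 *: K (w *m (w^t* *m H)).
  have [_ hk] := main k; rewrite reflE hk /A reflE -/h /K outerE.
  rewrite -/s2 -/s3 -/s4 (_ : xs k * (xs k)^* = s1 + 1); last by rewrite subrK.
  exact: comb_outer.
have EA : rho *: refl H (vs k) u = A.
  rewrite EB; apply: dP; last by rewrite -EB; case: (main k).
  - apply: (@norm_lt_real _ ((ck - 1) ^+ 2)) => //; last by lra.
    by rewrite /s1 xx -rmorphB /= [X in _ * X]conjc_real -rmorphM expr2.
  - apply: (@norm_lt_real _ (ck * dk)) => //; last by lra.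
    by rewrite /s2 rmorphM /= conjCK mulrACA xx [X in _ * X]mulrC yy rmorphM.
  - apply: (@norm_lt_real _ (ck * dk)) => //; last by lra.
    by rewrite /s3 rmorphM /= conjCK mulrACA [X in X * _]mulrC xx yy rmorphM.
  - apply: (@norm_lt_real _ (dk * dk)) => //; last by lra.
    by rewrite /s4 yy [X in _ * X]conjc_real -rmorphM.
(* If the k-th reflection equals A, then A v = rho u v is the next polar vector, so |x_(k+1)| = 1;
   but c_(k+1) > 1. *)
have [_ hk] := main k.
have := step k _ erefl hk; rewrite EA /A.
rewrite -scalemxAl refl_app.
rewrite -/h (mulfK h0).
rewrite -[X in X + _ *: _]scale1r -scalerDl addrC subrK scalerA.
move=> /(congr1 (fun z => form H z v)); rewrite formZl vsv -/h => /(mulIf h0) xk.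
have [xx1 _] := jor_xy rho1 u1 ue k.+1 x0c.
have [b11 _ _ _ _] := jor_bound k.+1 c1 e0 ec.
move: xx1; rewrite -[jor_x _ _ _ _]/(xs k.+1) -xk rmorphM mulrACA rho1 u1 mulr1.
move=> /(congr1 (@complex.Re _)) ck1; move: b11.
by rewrite -[X in _ < X]/(complex.Re ((jor_c e c k.+1)%:C)%C) -ck1 ltxx.
Qed.

End Jorgensen.

(** * Recurrence of powers and products of two reflections *)

Section Recurrence.
Context {R : realType}.
Local Notation C := R[i].

Lemma pigeonhole_recurrence m (x : 'I_m -> nat -> R) (eps : R) : 0 < eps ->
  (forall l i, `|x l i| <= 1) ->
  exists i j, (i < j)%N /\ forall l, `|x l j - x l i| < eps.
Proof.
move=> eps0 x1; pose N := (Num.truncn eps^-1).+1.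
have N0 : 0 < N%:R :> R by rewrite ltr0n.
have Neps : 1 < eps * N%:R.
  rewrite mulrC -ltr_pdivrMr // div1r.
  by have /truncn_itv/andP[_] : 0 <= eps^-1 by rewrite invr_ge0 ltW.
pose y l i := (x l i + 1) * N%:R.
have y0 l i : 0 <= y l i.
  by rewrite mulr_ge0 ?(ltW N0) //; have := x1 l i; rewrite ler_norml; lra.
have y2 l i : (Num.truncn (y l i) < (2 * N).+1)%N.
  rewrite ltnS -(ler_nat R); apply: le_trans (_ : y l i <= _).
    by have /andP[] := truncn_itv (y0 l i).
  rewrite natrM ler_wpM2r ?(ltW N0) //; have := x1 l i; rewrite ler_norml; lra.
pose K := #|{ffun 'I_m -> 'I_(2 * N).+1}|.
pose phi (i : 'I_K.+1) : {ffun 'I_m -> 'I_(2 * N).+1} := [ffun l => inord (Num.truncn (y l i))].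
have /injectivePn[i [j ij phiij]] : ~~ injectiveb phi.
  apply/negP => /injectiveP/leq_card; rewrite card_ord -/K ltnn //.
have close l : `|x l j - x l i| < eps.
  have /(congr1 (@nat_of_ord _)) := congr1 (fun f : {ffun 'I_m -> 'I_(2 * N).+1} => f l) phiij.
  rewrite !ffunE !inordK // => tij.
  have := truncn_itv (y0 l i); have := truncn_itv (y0 l j); rewrite -tij.
  move=> /andP[a1 a2] /andP[b1 b2].
  rewrite -(ltr_pM2r N0); apply: lt_trans Neps.
  rewrite -{1}(gtr0_norm N0) -normrM (_ : _ * _ = y l j - y l i); last by rewrite /y; ring.
  by move: a1 a2 b1 b2; rewrite -natr1 ltr_norml => *; apply/andP; split; lra.
have /orP[ltij | ltij] : (i < j)%N || (j < i)%N by rewrite -neq_ltn.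
  by exists i, j.
by exists j, i; split=> // l; rewrite distrC.
Qed.

(** Pigeonhole on the six real coordinates gives i < j with close powers; division by the i-th
    power, of modulus one, turns this into closeness to 1 at j - i. Three numbers are needed: a
    scalar factor and two eigenvalues. *)
Lemma unit_recurrence (z1 z2 z3 : C) (d : R) : 0 < d ->
  z1 * z1^* = 1 -> z2 * z2^* = 1 -> z3 * z3^* = 1 ->
  exists2 n, (0 < n)%N & [/\ `|z1 ^+ n - 1| < (d%:C)%C, `|z2 ^+ n - 1| < (d%:C)%C &
    `|z3 ^+ n - 1| < (d%:C)%C].
Proof.
move=> d0 h1 h2 h3.
have sqE (z : C) : z * z^* = ((complex.Re z ^+ 2 + complex.Im z ^+ 2)%:C)%C.
  by case: z => a b; apply/eqP; rewrite eq_complex /=; apply/andP; split; apply/eqP; ring.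
have bnd (z : C) (n : nat) : z * z^* = 1 ->
    `|complex.Re (z ^+ n)| <= 1 /\ `|complex.Im (z ^+ n)| <= 1.
  move=> hz; have : z ^+ n * (z ^+ n)^* = 1 by rewrite rmorphXn -exprMn hz expr1n.
  rewrite sqE => /(congr1 (@complex.Re _)) /= h.
  have a2 := sqr_ge0 (complex.Re (z ^+ n)); have b2 := sqr_ge0 (complex.Im (z ^+ n)).
  by rewrite !ler_norml; split; apply/andP; split; nra.
pose zs (l : 'I_6) := nth 0 [:: z1; z1; z2; z2; z3; z3] l.
pose x (l : 'I_6) n := if odd l then complex.Im (zs l ^+ n) else complex.Re (zs l ^+ n).
have zs1 l : zs l * (zs l)^* = 1.
  by case: l; do 6 (case=> //).
have [||i [j [ij close]]] := @pigeonhole_recurrence 6 x (d / 2).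
- by rewrite divr_gt0.
- by move=> l n; rewrite /x; case: ifP => _; have [] := bnd (zs l) n (zs1 l).
exists (j - i)%N; first by rewrite subn_gt0.
have key (z : C) : z * z^* = 1 -> `|complex.Re (z ^+ j) - complex.Re (z ^+ i)| < d / 2 ->
    `|complex.Im (z ^+ j) - complex.Im (z ^+ i)| < d / 2 -> `|z ^+ (j - i) - 1| < (d%:C)%C.
  move=> hz hr hi.
  have z0 : `|z| = 1 by apply/eqP; rewrite -(@pexpr_eq1 _ _ 2) // normCK hz.
  have -> : `|z ^+ (j - i) - 1| = `|z ^+ j - z ^+ i|.
    have -> : z ^+ j - z ^+ i = (z ^+ (j - i) - 1) * z ^+ i.
      by rewrite mulrBl mul1r -exprD subnK // ltnW.
    by rewrite normrM normrX z0 expr1n mulr1.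
  apply: (norm_lt_real (r := (complex.Re (z ^+ j) - complex.Re (z ^+ i)) ^+ 2 +
    (complex.Im (z ^+ j) - complex.Im (z ^+ i)) ^+ 2)) => //.
    by rewrite sqE; case: (z ^+ j) => a b; case: (z ^+ i).
  have d2 : 0 <= d / 2 by rewrite divr_ge0 // ltW.
  have e1 : (complex.Re (z ^+ j) - complex.Re (z ^+ i)) ^+ 2 < (d / 2) ^+ 2.
    by move: hr; rewrite ltr_norml => /andP[]; nra.
  have e2 : (complex.Im (z ^+ j) - complex.Im (z ^+ i)) ^+ 2 < (d / 2) ^+ 2.
    by move: hi; rewrite ltr_norml => /andP[]; nra.
  have : d ^+ 2 = 4 * (d / 2) ^+ 2 by field.
  have := sqr_ge0 (d / 2); lra.
have cl (k : nat) (hk : (k < 6)%N) := close (Ordinal hk).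
split; apply: key => //.
- exact: (cl 0%N isT). - exact: (cl 1%N isT).
- exact: (cl 2%N isT). - exact: (cl 3%N isT).
- exact: (cl 4%N isT). - exact: (cl 5%N isT).
Qed.

End Recurrence.

Section Plane.
Context {C : fieldType} {n : nat}.
Implicit Types (M : 'M[C]_n.+1) (v w x : 'cV[C]_n.+1).

Lemma mulmx_ext (A B : 'M[C]_n.+1) : (forall x : 'cV[C]_n.+1, A *m x = B *m x) -> A = B.
Proof.
by move=> AB; apply/matrixP => i j; have := AB (delta_mx j 0); rewrite -!colE => /colP/(_ i); rewrite !mxE.
Qed.

Lemma plane_quad M v w (a b e f : C) : M *m v = a *: v + b *: w -> M *m w = e *: v + f *: w ->
  M *m (M *m v) = (a + f) *: (M *m v) - (a * f - b * e) *: v /\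
  M *m (M *m w) = (a + f) *: (M *m w) - (a * f - b * e) *: w.
Proof.
move=> Mv Mw; split.
  rewrite {1}Mv mulmxDr -!scalemxAr Mw Mv; apply/colP => i; rewrite !mxE; ring.
rewrite {1}Mw mulmxDr -!scalemxAr Mw Mv; apply/colP => i; rewrite !mxE; ring.
Qed.

Lemma quad_pow M x (la mu : C) k :
  M *m (M *m x) = (la + mu) *: (M *m x) - (la * mu) *: x ->
  (la - mu) *: (M ^+ k *m x) = la ^+ k *: (M *m x - mu *: x) - mu ^+ k *: (M *m x - la *: x).
Proof.
move=> Mx; elim: k => [|k IH].
  by rewrite mul1mx !expr0; apply/colP => i; rewrite !mxE; ring.
rewrite exprS -mulmxE -mulmxA scalemxAr IH mulmxBr -!scalemxAr !mulmxBr -!scalemxAr Mx.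
by apply/colP => i; rewrite !mxE !exprS; ring.
Qed.

(** A vector [x] outside the invariant plane need not satisfy the quadratic relation, but M x - x
    does once it lies in the plane. Summing [quad_pow] over the powers of M telescopes to M^k x - x;
    denominators are multiplied out. *)
Lemma quad_pow1 M x (la mu : C) k :
  let y := M *m x - x in
  M *m (M *m y) = (la + mu) *: (M *m y) - (la * mu) *: y ->
  ((la - mu) * (la - 1) * (mu - 1)) *: (M ^+ k *m x - x) =
  ((la ^+ k - 1) * (mu - 1)) *: (M *m y - mu *: y) - ((mu ^+ k - 1) * (la - 1)) *: (M *m y - la *: y).
Proof.
move=> y My; elim: k => [|k IH].
  by rewrite mul1mx !expr0; apply/colP => i; rewrite !mxE; ring.
have E : M ^+ k.+1 *m x - x = M ^+ k *m y + (M ^+ k *m x - x).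
  by rewrite exprSr -mulmxE -mulmxA addrA -mulmxDr subrK.
rewrite E scalerDr IH; have := quad_pow k My.
have -> : ((la - mu) * (la - 1) * (mu - 1)) *: (M ^+ k *m y) =
    ((la - 1) * (mu - 1)) *: ((la - mu) *: (M ^+ k *m y)).
  by rewrite scalerA; congr (_ *: _); ring.
move=> ->; move: (M *m y) => Q; move: y {My IH E} => y.
by apply/colP => i; rewrite !mxE !exprS; ring.
Qed.

End Plane.

Section Product.
Context {R : realType} {n : nat}.
Local Notation C := R[i].
Variables (H : 'M[C]_n.+1) (v w : 'cV[C]_n.+1) (u u' c : C).
Let hv := form H v v.
Let hw := form H w w.
Let M := refl H v u *m refl H w u'.
Hypotheses (hv0 : hv != 0) (hw0 : hw != 0)
  (hc : form H v w * form H w v = c * hv * hw).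

Let T := u + u' + (u - 1) * (u' - 1) * c.

Lemma prod_refl_plane :
  M *m v = (u + (u - 1) * (u' - 1) * c) *: v + ((u' - 1) * form H v w / hw) *: w /\
  M *m w = (u' * (u - 1) * form H w v / hv) *: v + u' *: w.
Proof.
have Av : refl H v u *m v = u *: v.
  by rewrite refl_app -/hv mulfK // -[X in X + _]scale1r -scalerDl addrC subrK.
have Bw : refl H w u' *m w = u' *: w.
  by rewrite refl_app -/hw mulfK // -[X in X + _]scale1r -scalerDl addrC subrK.
have Aw : refl H v u *m w = w + ((u - 1) * form H w v / hv) *: v.
  by rewrite refl_app.
have Bv : refl H w u' *m v = v + ((u' - 1) * form H v w / hw) *: w.
  by rewrite refl_app.
rewrite /M -!mulmxA Bv Bw mulmxDr -!scalemxAr Av Aw; split.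
  rewrite scalerDr scalerA addrA addrAC -scalerDl.
  congr (_ *: _ + _); congr (_ + _).
  transitivity ((u - 1) * (u' - 1) * (form H v w * form H w v) / hw / hv).
    by field; rewrite hv0 hw0.
  by rewrite hc; field; rewrite hv0 hw0.
rewrite scalerDr scalerA addrC; congr (_ *: _ + _); ring.
Qed.

Variables (la mu : C).
Hypotheses (hT : la + mu = T) (hd : la * mu = u * u').

Lemma prod_refl_quad (x : 'cV[C]_n.+1) : x = v \/ x = w ->
  M *m (M *m x) = (la + mu) *: (M *m x) - (la * mu) *: x.
Proof.
have [Mv Mw] := prod_refl_plane; have [qv qw] := plane_quad Mv Mw.
have -> : la + mu = u + (u - 1) * (u' - 1) * c + u' by rewrite hT /T; ring.
have -> : la * mu = (u + (u - 1) * (u' - 1) * c) * u' -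
    (u' - 1) * form H v w / hw * (u' * (u - 1) * form H w v / hv).
  rewrite hd; transitivity (u * u' + (u - 1) * (u' - 1) * u' * c
    - (u - 1) * (u' - 1) * u' * ((form H v w * form H w v) / hw / hv)).
    by rewrite hc; field; rewrite hv0 hw0.
  by field; rewrite hv0 hw0.
by case=> ->.
Qed.

Lemma prod_refl_sub1 (x : 'cV[C]_n.+1) : exists a b : C, M *m x - x = a *: v + b *: w.
Proof.
exists ((u - 1) * form H (refl H w u' *m x) v / hv), ((u' - 1) * form H x w / hw).
rewrite /M -mulmxA refl_app [X in X + _ *: v]refl_app -/hv -/hw.
by rewrite -[x + _ + _]addrA [x + _]addrC addrK addrC.
Qed.

Lemma prod_refl_quad1 (x : 'cV[C]_n.+1) : let y := M *m x - x in
  M *m (M *m y) = (la + mu) *: (M *m y) - (la * mu) *: y.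
Proof.
move=> y; rewrite /y; have [a [b ->]] := prod_refl_sub1 x.
have qv := prod_refl_quad (or_introl (erefl v)).
have qw := prod_refl_quad (or_intror (erefl w)).
rewrite !mulmxDr -!scalemxAr qv qw.
move: (M *m v) (M *m w) => P Q.
by apply/colP => i; rewrite !mxE; ring.
Qed.

(** M - 1 maps the whole space into the span of [v] and [w], so [quad_pow1] applies to every vector.
    The matrices on the right do not depend on [k]: M^k is near 1 as soon as la^k and mu^k are. *)
Lemma prod_refl_pow k : (la - mu) * (la - 1) * (mu - 1) != 0 ->
  M ^+ k = 1%:M
    + (la ^+ k - 1) *: (((mu - 1) / ((la - mu) * (la - 1) * (mu - 1))) *: ((M - mu%:M) *m (M - 1%:M)))
    + (mu ^+ k - 1) *: ((- (la - 1) / ((la - mu) * (la - 1) * (mu - 1))) *: ((M - la%:M) *m (M - 1%:M))).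
Proof.
move=> D0; apply: mulmx_ext => x.
have := quad_pow1 k (prod_refl_quad1 x).
set D := (la - mu) * (la - 1) * (mu - 1) in D0 *.
move=> /(canRL (scalerK D0)) E.
have E1 : (M - 1%:M) *m x = M *m x - x by rewrite mulmxBl mul1mx.
have E2 s (y : 'cV[C]_n.+1) : (M - s%:M) *m y = M *m y - s *: y by rewrite mulmxBl mul_scalar_mx.
have X1 : ((M - mu%:M) *m (M - 1%:M)) *m x = M *m (M *m x - x) - mu *: (M *m x - x).
  by rewrite -mulmxA E1 E2.
have X2 : ((M - la%:M) *m (M - 1%:M)) *m x = M *m (M *m x - x) - la *: (M *m x - x).
  by rewrite -mulmxA E1 E2.
rewrite -[LHS](subrK x) E {E E1 E2}.
move: X1 X2; set Y1 := (M - mu%:M) *m _; set Y2 := (M - la%:M) *m _ => X1 X2.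
rewrite (mulmxDl (1%:M + _) _ x) (mulmxDl 1%:M _ x) mul1mx -!scalemxAl X1 X2 {X1 X2}.
move: (M *m x - x) => y; move: (M *m y) D0 => Q D0.
by apply/colP => i; rewrite !mxE; field.
Qed.

Lemma prod_refl_eigen k : M ^+ k *m (M *m v - mu *: v) = la ^+ k *: (M *m v - mu *: v).
Proof.
have Mf : M *m (M *m v - mu *: v) = la *: (M *m v - mu *: v).
  rewrite mulmxBr -scalemxAr (prod_refl_quad (or_introl (erefl v))).
  by move: (M *m v) => Q; apply/colP => i; rewrite !mxE; ring.
elim: k => [|k IH]; first by rewrite !expr0 mul1mx scale1r.
by rewrite exprSr -mulmxE -mulmxA Mf -scalemxAr IH scalerA exprS.
Qed.

(** The coefficient of [w] in M v is nonzero because c and u' - 1 are. If M v were a multiple of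
    [v], then [w] would be too, and proportional vectors have c = 1. *)
Lemma prod_refl_eigen_neq0 : H^t* = H -> c != 1 -> c != 0 -> u' != 1 -> M *m v - mu *: v != 0.
Proof.
move=> hH c1 c0 u1; have [-> _] := prod_refl_plane.
set a := u + _; set b := _ / hw; apply/eqP => f0.
have p0 : form H v w != 0.
  apply/eqP => p0; move/eqP: hc; rewrite p0 mul0r eq_sym !mulf_eq0.
  by rewrite (negbTE c0) (negbTE hv0) (negbTE hw0).
have b0 : b != 0 by rewrite /b !mulf_neq0 ?invr_eq0 // subr_eq0.
pose s := (mu - a) / b.
have wE : w = s *: v.
  apply: (scalerI b0); rewrite scalerA /s mulrCA divff // mulr1 scalerBl.
  move/eqP: f0; rewrite addrAC addrC addr_eq0 => /eqP ->.
  by rewrite opprB.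
move/eqP: c1; apply; apply: (mulIf hv0); apply: (mulIf hw0).
rewrite -hc mul1r /hw; move: s wE => s ->.
rewrite formZl formZr formZl formZr -/hv; ring.
Qed.

End Product.

Section Elliptic.
Context {R : realType} {n : nat}.
Local Notation C := R[i].
Variables (H : 'M[C]_n.+1) (G : set 'M[C]_n.+1).
Hypotheses (hH : H^t* = H) (gG : isometry_group H G).

Lemma isometry_group_exp A k : G A -> G (A ^+ k).
Proof.
have [G1 GM _ _] := gG => GA.
elim: k => [|k IH]; first by rewrite expr0; exact: G1.
by rewrite exprS -mulmxE; exact: GM.
Qed.

Lemma complexP (x y : C) : complex.Re x = complex.Re y -> complex.Im x = complex.Im y -> x = y.
Proof. by case: x y => a b [a' b'] /= -> ->. Qed.

Lemma comb_pow (r x y : C) (N1 N2 : 'M[C]_n.+1) :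
  r *: (1%:M + x *: N1 + y *: N2) =
  1%:M + (r - 1) *: 1%:M + (r * x) *: N1 + (r * y) *: N2 + 0 *: 0.
Proof. by apply/matrixP => i j; rewrite !mxE; ring. Qed.

(** On the plane of [v] and [w] the product has trace cis (al + be) 2 cos th and determinant cis (2
    al + 2 be), hence eigenvalues cis (al + be + th) and cis (al + be - th). By recurrence a power
    of it is the identity, so their ratio cis (2 th) is a root of unity. *)
Lemma elliptic_discrete (rho rho' : C) (v w : 'cV[C]_n.+1) (al be th c : R) :
    rho * rho^* = 1 -> rho' * rho'^* = 1 ->
    G (rho *: refl H v (cis (2 * al))) -> G (rho' *: refl H w (cis (2 * be))) ->
    form H v v != 0 -> form H w w != 0 ->
    form H v w * form H w v = (c%:C)%C * form H v v * form H w w ->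
    c != 0 -> c != 1 -> sin al != 0 -> sin be != 0 -> sin th != 0 ->
    cos th = cos (al - be) - 2 * c * sin al * sin be ->
    discrete_mx G -> exists2 k : nat, (0 < k)%N & cos (k%:R * (2 * th)) = 1.
Proof.
move=> rho1 rho1' GA GB hv0 hw0 hc c0 c1 sal sbe sth hcos dG.
set u := cis (2 * al) in GA *; set u' := cis (2 * be) in GB *.
pose la := cis (al + be + th); pose mu := cis (al + be - th).
have hT : la + mu = u + u' + (u - 1) * (u' - 1) * (c%:C)%C.
  have cis_sum x y : cis (x + y) + cis (x - y) = cis x * (2 * cos y)%:C%C :> C.
    by rewrite !cisD cisN; case: (cis x) => a b; apply: complexP => /=; ring.
  have cis_sub1 t : cis (2 * t) - 1 = cis t * Complex 0 (2 * sin t) :> C.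
    rewrite mulr_natl /cis cos_mulr2n sin_mulr2n cos2sin2.
    by apply: complexP => /=; ring.
  rewrite /la /mu cis_sum hcos /u /u' !cis_sub1.
  have -> : cis (2 * al) + cis (2 * be) = cis (al + be) * (2 * cos (al - be))%:C%C :> C.
    by rewrite -cis_sum; congr (cis _ + cis _); ring.
  transitivity (cis (al + be) * ((2 * cos (al - be))%:C%C +
    Complex 0 (2 * sin al) * Complex 0 (2 * sin be) * c%:C%C)); last first.
    by rewrite cisD; ring.
  by congr (_ * _); apply: complexP => /=; ring.
have hd : la * mu = u * u' by rewrite /la /mu /u /u' -!cisD; congr cis; ring.
have u1 (t : R) : sin t != 0 -> cis (2 * t) != 1.
  move=> st; apply/eqP => /(congr1 (@complex.Re _)) /=; rewrite mulr_natl cos_mulr2n cos2sin2.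
  move=> h; have : sin t ^+ 2 = 0 by move: h; rewrite mulr2n; lra.
  by move/eqP; rewrite expf_eq0 (negbTE st).
have lamu : la != mu.
  apply/eqP; rewrite /la /mu 2!(cisD (al + be)) => /(mulfI (cis_neq0 _)) /(congr1 (@complex.Im _)) /=.
  by rewrite sinN => h; move/eqP: sth; apply; lra.
(* This is the characteristic polynomial at 1: for c different from 1, neither eigenvalue on the
   plane is 1, so M is diagonalizable on the whole space. *)
have l1m1 : (la - 1) * (mu - 1) = (u - 1) * (u' - 1) * (1 - (c%:C)%C).
  transitivity (la * mu - (la + mu) + 1); first by ring.
  by rewrite hT hd; ring.
have D0 : (la - mu) * (la - 1) * (mu - 1) != 0.
  rewrite -mulrA l1m1 !mulf_neq0 ?subr_eq0 //; [exact: u1 | exact: u1 |].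
  rewrite eq_sym; apply/eqP => /(congr1 (@complex.Re _)) /= /eqP; exact/negP.
pose M := refl H v u *m refl H w u'.
pose W := (rho * rho') *: M.
have GW : G W.
  by have [_ GM _ _] := gG; rewrite /W -scalerA scalemxAr scalemxAl; exact: (GM _ _ GA GB).
have [G1 _ _ _] := gG.
pose N1 := ((mu - 1) / ((la - mu) * (la - 1) * (mu - 1))) *: ((M - mu%:M) *m (M - 1%:M)).
pose N2 := (- (la - 1) / ((la - mu) * (la - 1) * (mu - 1))) *: ((M - la%:M) *m (M - 1%:M)).
have [d d0 dP] := discrete_mx_comb 1%:M N1 N2 0 dG G1.
have rr1 : (rho * rho') * (rho * rho')^* = 1 by rewrite rmorphM mulrACA rho1 rho1' mulr1.
have [k k0 [k1 k2 k3]] := unit_recurrence d0 rr1 (cis_conj (al + be + th)) (cis_conj (al + be - th)).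
exists k => //.
set r := rho * rho' in W GW rr1 k1 *.
have WE : W ^+ k = 1%:M + (r ^+ k - 1) *: 1%:M + (r ^+ k * (la ^+ k - 1)) *: N1
    + (r ^+ k * (mu ^+ k - 1)) *: N2 + 0 *: 0.
  rewrite /W exprZn (prod_refl_pow hv0 hw0 hc hT hd k D0) -/N1 -/N2.
  exact: comb_pow.
have nr : `|r ^+ k| = 1.
  by apply/eqP; rewrite -(@pexpr_eq1 _ _ 2) // normCK rmorphXn -exprMn rr1 expr1n.
have W1 : W ^+ k = 1%:M.
  rewrite WE; apply: dP.
  - exact: k1.
  - by rewrite normrM nr mul1r; exact: k2.
  - by rewrite normrM nr mul1r; exact: k3.
  - by rewrite normr0 ltcR.
  by rewrite -WE; exact: isometry_group_exp.
have MW z (f : 'cV[C]_n.+1) : M ^+ k *m f = z *: f -> f != 0 -> r ^+ k * z = 1.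
  move=> Mf f0; have : W ^+ k *m f = f by rewrite W1 mul1mx.
  rewrite /W exprZn -scalemxAl Mf scalerA -[RHS]scale1r => /eqP.
  by rewrite -subr_eq0 -scalerBl scaler_eq0 (negbTE f0) orbF subr_eq0 => /eqP.
have cC0 : (c%:C)%C != 0 :> C.
  by apply/eqP => /(congr1 (@complex.Re _)) /= /eqP; exact/negP.
have cC1 : (c%:C)%C != 1 :> C.
  by apply/eqP => /(congr1 (@complex.Re _)) /= /eqP; exact/negP.
have nz s : M *m v - s *: v != 0.
  by apply: prod_refl_eigen_neq0 hH cC1 cC0 (u1 _ sbe); [exact: hv0 | exact: hw0 | exact: hc].
have e1 := MW _ _ (prod_refl_eigen hv0 hw0 hc hT hd k)
  (nz mu).
have hT' : mu + la = u + u' + (u - 1) * (u' - 1) * (c%:C)%C by rewrite addrC.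
have hd' : mu * la = u * u' by rewrite mulrC.
have e2 := MW _ _ (prod_refl_eigen hv0 hw0 hc hT' hd' k)
  (nz la).
have : la ^+ k = mu ^+ k.
  apply: (mulfI (x := r ^+ k)); last by rewrite e1 e2.
  by rewrite -normr_eq0 nr oner_eq0.
rewrite /la /mu !cisX => E.
have : cis (k%:R * (2 * th)) = 1.
  apply: (mulfI (cis_neq0 ((al + be - th) * k%:R))); rewrite mulr1 -[RHS]E -cisD.
  by congr cis; ring.
by move/(congr1 (@complex.Re _)).
Qed.

End Elliptic.

(** * The groups [Gamma p tau] *)

Lemma ord3P (P : 'I_3 -> Prop) :
  P (@Ordinal 3 0 isT) -> P (@Ordinal 3 1 isT) -> P (@Ordinal 3 2 isT) -> forall i, P i.
Proof.
move=> P0 P1 P2 [[|[|[|i]]] hi] //.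
- by rewrite (_ : Ordinal hi = @Ordinal 3 0 isT) //; apply: val_inj.
- by rewrite (_ : Ordinal hi = @Ordinal 3 1 isT) //; apply: val_inj.
- by rewrite (_ : Ordinal hi = @Ordinal 3 2 isT) //; apply: val_inj.
Qed.

Lemma sum_ord3 (V : nmodType) (F : 'I_3 -> V) :
  \sum_i F i = F (@Ordinal 3 0 isT) + F (@Ordinal 3 1 isT) + F (@Ordinal 3 2 isT).
Proof.
rewrite !big_ord_recl big_ord0 addr0 addrA.
by congr (_ + _ + _); congr F; apply: val_inj.
Qed.

Lemma det_mx33 (F : comNzRingType) (m : nat -> nat -> F) :
  \det (\matrix_(i < 3, j < 3) m i j) =
    m 0%N 0%N * (m 1%N 1%N * m 2%N 2%N - m 1%N 2%N * m 2%N 1%N)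
    - m 0%N 1%N * (m 1%N 0%N * m 2%N 2%N - m 1%N 2%N * m 2%N 0%N)
    + m 0%N 2%N * (m 1%N 0%N * m 2%N 1%N - m 1%N 1%N * m 2%N 0%N).
Proof.
rewrite (expand_det_row _ ord0) !big_ord_recl big_ord0 /cofactor.
rewrite !(expand_det_row _ ord0) !big_ord_recl !big_ord0 /cofactor !det_mx11.
by rewrite !mxE /bump /=; ring.
Qed.

Section Circulant.
Context {R : realType}.
Local Notation C := R[i].
Local Notation J := (Jmx R).

Definition bas (k : nat) : 'cV[C]_3 := \col_(i < 3) ((i : nat) == k)%:R.
Definition col3 (z0 z1 z2 : C) : 'cV[C]_3 := \col_(i < 3) nth 0 [:: z0; z1; z2] i.
Definition circ (a : R) (x : C) : 'M[C]_3 :=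
  mx3 [:: [:: (a%:C)%C; x; x^*]; [:: x^*; (a%:C)%C; x]; [:: x; x^*; (a%:C)%C]].

Lemma col3E z0 z1 z2 : col3 z0 z1 z2 = z0 *: bas 0 + z1 *: bas 1 + z2 *: bas 2.
Proof. by apply/colP; elim/ord3P; rewrite !mxE /= ?mulr1 ?mulr0 ?addr0 ?add0r. Qed.

Lemma circ_herm a x : (circ a x)^t* = circ a x.
Proof.
by apply/matrixP; elim/ord3P; elim/ord3P; rewrite !mxE /= ?conjCK //; exact: conjc_real.
Qed.

Lemma form_bas H (i j : nat) (hi : (i < 3)%N) (hj : (j < 3)%N) :
  form H (bas j) (bas i) = H (Ordinal hi) (Ordinal hj).
Proof.
have bE k (hk : (k < 3)%N) : bas k = delta_mx (Ordinal hk) 0.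
  by apply/colP => l; rewrite !mxE andbT.
rewrite form.unlock !bE; rewrite -colE mxE.
rewrite (_ : (delta_mx (Ordinal hi) 0)^t* = delta_mx 0 (Ordinal hi)); last first.
  by rewrite trmx_delta map_delta_mx.
by rewrite -rowE mxE.
Qed.

Lemma form_mulmx H (z w : 'cV[C]_3) : form H z w = \sum_i (w i 0)^* * (H *m z) i 0.
Proof.
by rewrite form.unlock -mulmxA mxE; apply: eq_bigr => i _; rewrite !mxE.
Qed.

Lemma J_bas0 : J *m bas 0 = bas 1.
Proof. by apply/colP; elim/ord3P; rewrite !mxE sum_ord3 !mxE /= ?mulr1 ?mulr0 ?addr0 ?add0r. Qed.
Lemma J_bas1 : J *m bas 1 = bas 2.
Proof. by apply/colP; elim/ord3P; rewrite !mxE sum_ord3 !mxE /= ?mulr1 ?mulr0 ?addr0 ?add0r. Qed.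
Lemma J_bas2 : J *m bas 2 = bas 0.
Proof. by apply/colP; elim/ord3P; rewrite !mxE sum_ord3 !mxE /= ?mulr1 ?mulr0 ?addr0 ?add0r. Qed.

Lemma J_adj : J^t* *m J = 1%:M.
Proof.
apply/matrixP; elim/ord3P; elim/ord3P; rewrite !mxE sum_ord3 !mxE /=;
by rewrite ?rmorph0 ?rmorph1 ?mulr1 ?mulr0 ?addr0 ?add0r.
Qed.

Lemma J_unit : J \in unitmx.
Proof. by have [] := mulmx1_unit J_adj. Qed.

Lemma J_circ a x : J *m circ a x = circ a x *m J.
Proof.
apply/matrixP; elim/ord3P; elim/ord3P; rewrite !mxE !sum_ord3 !mxE /=;
by rewrite ?mulr1 ?mulr0 ?mul1r ?mul0r ?addr0 ?add0r.
Qed.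

Lemma J_preserves a x : preserves (circ a x) J.
Proof. by rewrite /preserves -mulmxA -J_circ mulmxA J_adj mul1mx. Qed.

(* Polar vector of the complex line spanned by [bas 0] and [bas 1]. *)
Definition polar (a : R) (x : C) : 'cV[C]_3 :=
  let A := (a%:C)%C in col3 (x ^+ 2 - A * x^*) (x^* ^+ 2 - A * x) (A ^+ 2 - x * x^*).

(** [polar a x] is the last column of the adjugate of [circ a x], and [d] is the determinant. *)
Lemma circ_polar (a d : R) x : (d%:C)%C = (a%:C)%C ^+ 3 + x ^+ 3 + x^* ^+ 3 - 3 * (a%:C)%C * x * x^* ->
  circ a x *m polar a x = (d%:C)%C *: bas 2.
Proof.
move=> hd; apply/colP; elim/ord3P; rewrite !mxE sum_ord3 !mxE /= ?hd ?mulr1 ?mulr0; ring.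
Qed.

Lemma det_circ a x : \det (circ a x) = (a%:C)%C ^+ 3 + x ^+ 3 + x^* ^+ 3 - 3 * (a%:C)%C * x * x^*.
Proof.
rewrite /circ /mx3; set s := [:: _; _; _].
by rewrite (det_mx33 (fun i j => nth 0 (nth [::] s i) j)) /=; ring.
Qed.

Lemma refl_bas_mx H (i : nat) (hi : (i < 3)%N) u : refl H (bas i) u =
  \matrix_(k, l) ((k == l)%:R + (u - 1) / H (Ordinal hi) (Ordinal hi) * ((k : nat) == i)%:R * H (Ordinal hi) l).
Proof.
rewrite reflE (form_bas H hi hi); apply/matrixP => k l; rewrite !mxE big_ord1 !mxE.
rewrite mulrA; congr (_ + _ * _); rewrite (bigD1 (Ordinal hi)) //= !mxE eqxx rmorph1 mul1r.
rewrite big1 ?addr0 // => j ji; rewrite !mxE (_ : (j : nat) == i = false) ?rmorph0 ?mul0r //.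
exact: negbTE.
Qed.

End Circulant.

Section Gamma.
Context {R : realType}.
Local Notation C := R[i].
Local Notation J := (Jmx R).
Variables (p : nat) (tau : C).
Hypothesis p2 : (2 <= p)%N.

Let th : R := pi / p%:R.
Let a : R := 2 * sin th.
Definition xcoef : C := - 'i * cis (- (psi R p / 6)) * tau.
Local Notation x := xcoef.
Let H := circ a x.
Let G := Gamma p tau.

Lemma psiE : psi R p = 2 * th.
Proof. by rewrite /psi mulrA. Qed.

Lemma a_gt0 : 0 < a.
Proof.
rewrite /a mulr_gt0 // sin_gt0_pi // /th divr_gt0 ?pi_gt0 ?ltr0n ?(leq_trans _ p2) //=.
by rewrite ltr_pdivrMr ?ltr0n ?(leq_trans _ p2) // ltr_pMr ?pi_gt0 // ltr1n.
Qed.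

Lemma xcoef_conj : x^* = 'i * cis (psi R p / 6) * tau^*.
Proof. by rewrite /x !rmorphM rmorphN /= conjCi opprK cisN conjCK. Qed.

Lemma HmxE : Hmx p tau = H.
Proof.
have ha : cplx (2 * sin (psi R p / 2)) = (a%:C)%C.
  by rewrite /cplx psiE (_ : 2 * th / 2 = th) //; lra.
by rewrite /Hmx -xcoef_conj ha.
Qed.

Lemma cis_sub1 : cis (2 * th) - 1 = 'i * (a%:C)%C * cis th.
Proof.
rewrite -complexiE mulr_natl /cis cos_mulr2n sin_mulr2n cos2sin2 /a.
by apply: complexP => /=; ring.
Qed.

Lemma R1E : R1mx p tau = cis (- (psi R p / 3)) *: refl H (bas 0) (cis (2 * th)).
Proof.
have a0 : (a%:C)%C != 0 :> C.
  by apply/eqP => /(congr1 (@complex.Re _)) /= h; have := a_gt0; rewrite h ltxx.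
rewrite (refl_bas_mx _ (isT : (0 < 3)%N)).
have -> : H (@Ordinal 3 0 isT) (@Ordinal 3 0 isT) = (a%:C)%C by rewrite !mxE.
have -> : (cis (2 * th) - 1) / (a%:C)%C = 'i * cis th.
  by rewrite cis_sub1; field.
rewrite /R1mx psiE.
apply/matrixP; elim/ord3P; elim/ord3P; rewrite !mxE /= ?mulr0 ?mul0r ?addr0 ?mulr1 ?mul1r //.
- have -> : 'i * cis th * (a%:C)%C = cis (2 * th) - 1 by rewrite cis_sub1; ring.
  by rewrite addrCA subrr addr0 -cisD; congr cis; lra.
- rewrite /x psiE; transitivity (- ('i * 'i) * (cis (- (2 * th / 3)) * cis th * cis (- (2 * th / 6))) * tau); last by ring.
  rewrite -expr2 sqrCi opprK mul1r -!cisD (_ : _ + _ + _ = 0) ?cis0 ?mul1r //; lra.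
- rewrite xcoef_conj psiE.
  transitivity (('i * 'i) * (cis (- (2 * th / 3)) * cis th * cis (2 * th / 6)) * tau^*); last by ring.
  rewrite -expr2 sqrCi -!cisD mulN1r; congr (- cis _ * _); lra.
all: by ring.
Qed.

Lemma refl_mul (K : 'M[C]_3) v u u' : form K v v != 0 ->
  refl K v u *m refl K v u' = refl K v (u * u').
Proof.
move=> h0; apply: mulmx_ext => y; rewrite -mulmxA !refl_app formDl formZl.
rewrite -addrA -scalerDl; congr (_ + _ *: _); field; exact: h0.
Qed.

Lemma refl1 (K : 'M[C]_3) v : refl K v 1 = 1%:M.
Proof. by rewrite reflE subrr mul0r scale0r addr0. Qed.

Lemma refl_exp (K : 'M[C]_3) v (rho u : C) k : form K v v != 0 ->
  (rho *: refl K v u) ^+ k = rho ^+ k *: refl K v (u ^+ k).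
Proof.
move=> h0; rewrite exprZn; congr (_ *: _); elim: k => [|k IH]; first by rewrite !expr0 refl1.
by rewrite !exprS IH -mulmxE refl_mul.
Qed.

Lemma refl_unit (K : 'M[C]_3) v (rho u : C) : form K v v != 0 -> rho != 0 -> u != 0 ->
  rho *: refl K v u \in unitmx.
Proof.
move=> h0 r0 u0; suff E : (rho *: refl K v u) *m (rho^-1 *: refl K v u^-1) = 1%:M.
  by have [h _] := mulmx1_unit E; exact: h.
by rewrite -scalemxAl -scalemxAr scalerA (divff r0) scale1r (refl_mul _ _ h0) (divff u0) refl1.
Qed.

Lemma aC_neq0 : (a%:C)%C != 0 :> C.
Proof. by apply/eqP => /(congr1 (@complex.Re _)) /= h; have := a_gt0; rewrite h ltxx. Qed.

Lemma form_bas_diag k : (k < 3)%N -> form H (bas k) (bas k) = (a%:C)%C.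
Proof. by move=> hk; rewrite (form_bas _ hk hk) /H /circ mxE; case: k hk => [|[|[|k]]]. Qed.

Lemma gamma_isometry : isometry_group H G.
Proof.
have fb0 : form H (bas 0) (bas 0) != 0 by rewrite form_bas_diag // aC_neq0.
split; [exact: generated_1 | exact: generated_mul | exact: generated_inv |].
move=> A; elim=> [B [->|->]| |B B' _ [IH1 IH2] _ [IH3 IH4]|B _ [IH1 IH2]].
- rewrite R1E; split; last by apply: refl_unit; rewrite ?cis_neq0.
  by apply: preservesZ (cis_conj _) _; apply: refl_preserves (circ_herm _ _) fb0 (cis_conj _).
- by split; [exact: J_preserves | exact: J_unit].
- by split; [exact: preserves1 | exact: unitmx1].
- by split; [exact: preservesM | rewrite unitmx_mul IH2].
- by split; [exact: preservesV | rewrite unitmx_inv].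
Qed.

Lemma G_J : G J. Proof. by apply: generated_in; right. Qed.

Lemma G_conj g rho v u : G g -> G (rho *: refl H v u) -> G (rho *: refl H (g *m v) u).
Proof.
have [_ GM GV Gp] := gamma_isometry => Gg GA; have [pg ug] := Gp _ Gg.
rewrite -(refl_conj _ _ pg ug) scalemxAl scalemxAr.
exact: (GM _ _ (GM _ _ Gg GA) (GV _ Gg)).
Qed.

Let rho1 : C := cis (- (psi R p / 3)).
Let u : C := cis (2 * th).

Lemma G_refl0 : G (rho1 *: refl H (bas 0) u).
Proof. by rewrite /rho1 /u -R1E; apply: generated_in; left. Qed.

Lemma G_refl1 : G (rho1 *: refl H (bas 1) u).
Proof. by rewrite -J_bas0; exact: (G_conj G_J G_refl0). Qed.

Lemma G_refl2 : G (rho1 *: refl H (bas 2) u).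
Proof. by rewrite -J_bas1; exact: (G_conj G_J G_refl1). Qed.

Definition tau2 : R := complex.Re tau ^+ 2 + complex.Im tau ^+ 2.

Lemma x_conj : x * x^* = (tau2%:C)%C.
Proof.
rewrite /x !rmorphM rmorphN /= conjCi opprK.
transitivity (- ('i * 'i) * (cis (- (psi R p / 6)) * (cis (- (psi R p / 6)))^*) * (tau * tau^*)); first by ring.
rewrite cis_conj -expr2 sqrCi opprK !mul1r /tau2; case: tau => A B.
by apply: complexP => /=; ring.
Qed.

(** The determinant of H_tau as a real number ([discE]). The term in tau^3 is twice the real part of
    x^3, where x^3 = i e^(-i th) tau^3. *)
Definition disc : R :=
  a ^+ 3 - 3 * a * tau2 - 2 * (cos th * complex.Im (tau ^+ 3) - sin th * complex.Re (tau ^+ 3)).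

Lemma discE : (disc%:C)%C = (a%:C)%C ^+ 3 + x ^+ 3 + x^* ^+ 3 - 3 * (a%:C)%C * x * x^*.
Proof.
have x3 : x ^+ 3 = 'i * cis (- th) * tau ^+ 3.
  have i3 : (- 'i) ^+ 3 = 'i :> C.
    by transitivity (- ('i ^+ 2) * 'i : C); [ring | rewrite sqrCi opprK mul1r].
  rewrite /x !exprMn i3 cisX; congr (_ * cis _ * _).
  by rewrite psiE; lra.
have xc3 : x^* ^+ 3 = (x ^+ 3)^* by rewrite rmorphXn.
rewrite -mulrA x_conj xc3 x3 -complexiE /disc.
case: (tau ^+ 3) => A B; rewrite /cis cosN sinN -rmorphXn.
by apply: complexP => /=; ring.
Qed.

Local Notation z := (polar a x).

Lemma form_polar w : form H z w = (disc%:C)%C * (w (@Ordinal 3 2 isT) 0)^*.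
Proof.
by rewrite form_mulmx (circ_polar discE) sum_ord3 !mxE /= !mulr0 mulr1 !add0r mulrC.
Qed.

Lemma polar2 : z (@Ordinal 3 2 isT) 0 = ((a ^+ 2 - tau2)%:C)%C.
Proof. by rewrite mxE /= x_conj rmorphB rmorphXn. Qed.

Lemma form_polar_polar : form H z z = ((disc * (a ^+ 2 - tau2))%:C)%C.
Proof. by rewrite form_polar polar2 rmorphM; congr (_ * _); exact: conjc_real. Qed.

End Gamma.

(** * The three criteria for [Gamma p tau] *)

Lemma polar1_conj (R : realType) (b : R) (y : R[i]) :
  (y^* ^+ 2 - (b%:C)%C * y)^* = y ^+ 2 - (b%:C)%C * y^*.
Proof.
rewrite rmorphB rmorphXn rmorphM /= conjCK; congr (_ - _ * _); exact: conjc_real.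
Qed.

Lemma real_normE (R : realType) (t b e : R) :
  (((t - b ^+ 2) ^+ 2 - b * e)%:C)%C = ((t%:C)%C - (b%:C)%C ^+ 2) ^+ 2 - (b%:C)%C * (e%:C)%C.
Proof. by rewrite rmorphB rmorphXn rmorphB rmorphXn rmorphM. Qed.

Lemma center_coef (R : realType) (e b q : R) : b != 0 -> q != 0 ->
  e * e = - e / (b * q) * b * (e * (- q)).
Proof. by move=> b0 q0; field; rewrite ?b0 ?q0. Qed.

Lemma center_trace (R : realType) (e b q C S : R) : b != 0 -> q != 0 ->
  (2 * C * q - 2 * S * e) / (2 * q) = C - 2 * (- e / (b * q)) * (b / 2) * (- S).
Proof. by move=> b0 q0; field; rewrite ?b0 ?q0. Qed.

Section Criteria.
Context {R : realType}.
Local Notation C := R[i].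
Local Notation J := (Jmx R).
Variables (p : nat) (tau : C).
Hypothesis p2 : (2 <= p)%N.

Let th : R := pi / p%:R.
Let a : R := 2 * sin th.
Local Notation x := (xcoef p tau).
Let H := circ a x.
Let G := Gamma p tau.
Local Notation z := (polar a x).
Local Notation d := (disc p tau).
Let D : R := tau2 tau - a ^+ 2.

Lemma real_neq0 (r : R) : r != 0 -> (r%:C)%C != 0 :> C.
Proof. by move=> r0; apply/eqP => /(congr1 (@complex.Re _)) /= /eqP; exact/negP. Qed.

Lemma cis_sub1E (t : R) : cis (2 * t) - 1 = cis t * Complex 0 (2 * sin t).
Proof.
rewrite mulr_natl /cis cos_mulr2n sin_mulr2n cos2sin2.
by apply: complexP => /=; ring.
Qed.

Lemma polar_form_neq0 : D != 0 -> d != 0 -> form H z z != 0.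
Proof.
move=> D0 d0; rewrite form_polar_polar real_neq0 // mulf_neq0 // -oppr_eq0 opprB.
exact: D0.
Qed.

Section Center.
Variables (m h : nat) (phi : R).
Hypotheses (hphi : 2 - tau2 tau = 2 * cos phi) (sphi : sin phi != 0)
  (hm : cis (phi * m%:R) = cis (h%:R * pi)) (D0 : D != 0) (d0 : d != 0).
Let beta : R := m%:R * th + h%:R * pi / 2.
Let u : C := cis (2 * th).

(* [phi] is chosen so that [R1 R2] has eigenvalues [cis (2 th + phi)] and
   [cis (2 th - phi)] on the span of [bas 0] and [bas 1], hence its [m]-th power is
   scalar there. *)
Lemma G_center : exists2 rho : C, rho * rho^* = 1 & G (rho *: refl H z (cis (- (2 * beta)))).
Proof.
have aC := aC_neq0 (R := R) p2.
have e00 : form H (bas 0) (bas 0) != 0 by rewrite form_bas_diag.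
have e11 : form H (bas 1) (bas 1) != 0 by rewrite form_bas_diag.
have e01 : form H (bas 0) (bas 1) = x^*.
  by rewrite (form_bas _ (isT : (1 < 3)%N) (isT : (0 < 3)%N)) mxE.
have e10 : form H (bas 1) (bas 0) = x.
  by rewrite (form_bas _ (isT : (0 < 3)%N) (isT : (1 < 3)%N)) mxE.
pose c : C := ((tau2 tau)%:C)%C / (a%:C)%C ^+ 2.
have hc : form H (bas 0) (bas 1) * form H (bas 1) (bas 0)
    = c * form H (bas 0) (bas 0) * form H (bas 1) (bas 1).
  rewrite e01 e10 !form_bas_diag // -/th -/a mulrC x_conj /c; field; exact: aC.
pose la := cis (2 * th + phi); pose mu := cis (2 * th - phi).
(* On the span of [bas 0] and [bas 1] the trace is u (2 - |tau|^2); this is why [phi] is defined by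
   2 - |tau|^2 = 2 cos phi. *)
have hT : la + mu = u + u + (u - 1) * (u - 1) * c.
  have -> : la + mu = u * ((2 * cos phi)%:C)%C.
    rewrite /la /mu /u !cisD cisN; case: (cis (2 * th)) => r i.
    by apply: complexP => /=; ring.
  have -> : (u - 1) * (u - 1) * c = - u * ((tau2 tau)%:C)%C.
    rewrite /u cis_sub1 -/th -/a /c.
    transitivity (('i * 'i) * (cis th * cis th) * ((tau2 tau)%:C)%C).
      by field; exact: aC.
    by rewrite -expr2 sqrCi -cisD mulN1r; congr (- cis _ * _); ring.
  by rewrite -hphi rmorphB /= rmorph_nat; ring.
have hd : la * mu = u * u by rewrite /la /mu /u -!cisD; congr cis; ring.
have lamu : la - mu != 0.
  rewrite subr_eq0; apply/eqP; rewrite /la /mu 2!(cisD (2 * th)) => /(mulfI (cis_neq0 _)).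
  by move=> /(congr1 (@complex.Im _)) /=; rewrite sinN => e; move/eqP: sphi; apply; lra.
pose La := cis (2 * beta).
have lam : la ^+ m = La.
  rewrite /la cisX mulrDl cisD hm /La -cisD; congr cis; rewrite /beta; lra.
have mum : mu ^+ m = La.
  have hm' : cis (- (phi * m%:R)) = cis (h%:R * pi) :> C.
    rewrite cisN hm -cisN -[LHS]mulr1 -(cis_nat2pi h) -cisD; congr cis; lra.
  rewrite /mu cisX mulrBl cisD hm' /La -cisD; congr cis; rewrite /beta; lra.
pose M := refl H (bas 0) u *m refl H (bas 1) u.
have Mb (y : 'cV[C]_3) : y = bas 0 \/ y = bas 1 -> M ^+ m *m y = La *: y.
  move=> hy; apply: (scalerI lamu).
  rewrite (quad_pow m (prod_refl_quad e00 e11 hc hT hd hy)) lam mum -/M scalerA.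
  move: (M *m y) => Q.
  by apply/colP => i; rewrite !mxE; ring.
have zz := polar_form_neq0 D0 d0.
have zb0 : form H z (bas 0) = 0 by rewrite form_polar mxE /= rmorph0 mulr0.
have zb1 : form H z (bas 1) = 0 by rewrite form_polar mxE /= rmorph0 mulr0.
have Mz1 : M *m z = z.
  by rewrite -mulmxA (refl_app _ (bas 1)) zb1 mulr0 mul0r scale0r addr0 refl_app zb0 mulr0 mul0r scale0r addr0.
have Mz k : M ^+ k *m z = z.
  elim: k => [|k IH]; first by rewrite expr0 mul1mx.
  by rewrite exprSr -mulmxE -mulmxA Mz1 IH.
have La0 : La != 0 by exact: cis_neq0.
have hH := circ_herm a x.
have bz0 : form H (bas 0) z = 0 by rewrite -(form_conj _ _ hH) zb0 rmorph0.
have bz1 : form H (bas 1) z = 0 by rewrite -(form_conj _ _ hH) zb1 rmorph0.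
(* M^m is the scalar [La] on the plane and fixes [z]. These span the space, because the last
   coordinate a^2 - |tau|^2 of [z] is nonzero. *)
have E : M ^+ m = La *: refl H z La^-1.
  apply: mulmx_ext => y; apply/eqP; rewrite -subr_eq0 -mulmxBl; apply/eqP.
  set X := M ^+ m - _.
  have X0 : X *m bas 0 = 0.
    rewrite /X mulmxBl (Mb _ (or_introl erefl)) -scalemxAl refl_app bz0.
    by rewrite mulr0 mul0r scale0r addr0 subrr.
  have X1 : X *m bas 1 = 0.
    rewrite /X mulmxBl (Mb _ (or_intror erefl)) -scalemxAl refl_app bz1.
    by rewrite mulr0 mul0r scale0r addr0 subrr.
  have Xz : X *m z = 0.
    rewrite /X mulmxBl Mz -scalemxAl refl_app (mulfK zz).
    by rewrite -[X in X + _ *: _]scale1r -scalerDl [1 + _]addrC subrK scalerA divff // scale1r subrr.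
  have X2 : X *m bas 2 = 0.
    have D0' : ((a ^+ 2 - tau2 tau)%:C)%C != 0 :> C.
      by rewrite real_neq0 // -oppr_eq0 opprB; exact: D0.
    apply: (scalerI D0'); rewrite scaler0; move: Xz.
    rewrite /polar col3E !mulmxDr -!scalemxAr X0 X1 !scaler0 !add0r x_conj.
    by rewrite -rmorphXn -rmorphB.
  have -> : y = y (@Ordinal 3 0 isT) 0 *: bas 0 + y (@Ordinal 3 1 isT) 0 *: bas 1
      + y (@Ordinal 3 2 isT) 0 *: bas 2.
    by rewrite -col3E; apply/colP; elim/ord3P; rewrite !mxE.
  by rewrite !mulmxDr -!scalemxAr X0 X1 X2 !scaler0 !addr0.
pose r1 : C := cis (- (psi R p / 3)).
exists ((r1 * r1) ^+ m * La).
  by rewrite rmorphM rmorphXn rmorphM mulrACA cis_conj -exprMn mulrACA !cis_conj !mulr1 expr1n.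
have [_ GM _ _] := gamma_isometry tau p2.
have GW : G ((r1 * r1) *: M).
  rewrite /M -scalerA scalemxAr scalemxAl.
  exact: (GM _ _ (G_refl0 tau p2) (G_refl1 tau p2)).
have := isometry_group_exp (gamma_isometry tau p2) m GW.
by rewrite exprZn E scalerA cisV.
Qed.

Lemma G_center_exp j : exists2 rho : C, rho * rho^* = 1 &
  G (rho *: refl H z (cis (2 * (- (j%:R * beta))))).
Proof.
have [rho rho1 GC] := G_center; exists (rho ^+ j).
  by rewrite rmorphXn -exprMn rho1 expr1n.
have := isometry_group_exp (gamma_isometry tau p2) j GC.
rewrite refl_exp ?polar_form_neq0 // cisX.
by have -> : - (2 * beta) * j%:R = 2 * (- (j%:R * beta)) by ring.
Qed.

Lemma J_col (w : 'cV[C]_3) :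
  J *m w = col3 (w (@Ordinal 3 2 isT) 0) (w (@Ordinal 3 0 isT) 0) (w (@Ordinal 3 1 isT) 0).
Proof.
by apply/colP; elim/ord3P; rewrite !mxE sum_ord3 !mxE /= ?mul1r ?mul0r ?addr0 ?add0r.
Qed.

(** Jacobi's identity for a 2 x 2 minor of the adjugate: its diagonal entries are -D, the
    off-diagonal ones this number and its conjugate, and the minor equals det H times the diagonal
    entry [a] of H. *)
Lemma polar1_norm : (x^* ^+ 2 - (a%:C)%C * x) * (x^* ^+ 2 - (a%:C)%C * x)^* = ((D ^+ 2 - a * d)%:C)%C.
Proof.
rewrite polar1_conj.
rewrite /D real_normE -(x_conj p) discE -/th -/a; ring.
Qed.

(** With g = J the parameter of [jorgensen] is c = |<J z, z>|^2 / <z, z>^2 = 1 - a d / D^2. Thus d <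
    0 says c > 1, and the inequality says e c < 1 for e = 4 sin^2 (j beta). *)
Lemma not_discrete_jorgensen j : sin (j%:R * beta) != 0 -> d < 0 ->
  4 * sin (j%:R * beta) ^+ 2 * (D ^+ 2 - a * d) < D ^+ 2 -> ~ discrete_mx G.
Proof.
move=> s0 dneg hlt.
have a0 : 0 < a := a_gt0 p2; have D2 : 0 < D ^+ 2 by rewrite exprn_even_gt0.
have [rho rho1 GC] := G_center_exp j.
pose e := 4 * sin (j%:R * beta) ^+ 2; pose c := (D ^+ 2 - a * d) / D ^+ 2.
have ad : a * d < 0 by rewrite (pmulr_rlt0 _ a0).
apply: (jorgensen (c := c) (e := e) (circ_herm a x) (gamma_isometry tau p2) rho1 (cis_conj _) _ GC (G_J p tau)).
- rewrite cis_sub1E rmorphM mulrACA cis_conj mul1r /e sinN.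
  by apply: complexP => /=; ring.
- exact: (polar_form_neq0 D0 d0).
- have -> : form H (J *m z) z = (form H z (J *m z))^* by rewrite form_conj ?circ_herm.
  rewrite conjCK form_polar J_col form_polar_polar -/th -/a.
  rewrite [(col3 _ _ _) _ _]mxE /= [(polar _ _) _ _]mxE /= rmorphM /= conjCK.
  rewrite (_ : ((d%:C)%C)^* = (d%:C)%C); last exact: conjc_real.
  transitivity ((d%:C)%C ^+ 2 * ((x^* ^+ 2 - (a%:C)%C * x) * (x^* ^+ 2 - (a%:C)%C * x)^*)); first by ring.
  rewrite polar1_norm -rmorphXn -rmorphM -rmorphXn -rmorphM; congr (_ %:C)%C.
  rewrite /c /D; field; exact: D0.
- by rewrite /c ltr_pdivlMr // mul1r ltrDl oppr_gt0.
- by rewrite /e mulr_gt0 // exprn_even_gt0.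
by rewrite /c mulrA ltr_pdivrMr // mul1r.
Qed.

(* [R1] and [J C^j J^-1], with [C] the reflection of [G_center]. *)
Lemma discrete_center j :
    sin (j%:R * beta) != 0 -> d + a * D != 0 ->
    (2 * cos (th + j%:R * beta) * D - 2 * sin (j%:R * beta) * d) ^+ 2 < 4 * D ^+ 2 ->
    discrete_mx G -> exists (t : R) (k : nat), [/\ (0 < k)%N,
      2 * cos (th + j%:R * beta) * D - 2 * sin (j%:R * beta) * d = 2 * cos t * D &
      cos (k%:R * (2 * t)) = 1].
Proof.
move=> s0 c1 hlt dG; set b := j%:R * beta in s0 hlt *.
set N := 2 * cos (th + b) * D - 2 * sin b * d in hlt *.
have a0 : 0 < a := a_gt0 p2; have D2 : 0 < D ^+ 2 by rewrite exprn_even_gt0.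
have [rho rho1 GC] := G_center_exp j.
pose y := N / (2 * D).
have D20 : 2 * D != 0 by rewrite mulf_neq0 // pnatr_eq0.
have y2 : y ^+ 2 < 1.
  rewrite /y exprMn exprVn ltr_pdivrMr ?exprn_even_gt0 // mul1r exprMn; lra.
have y1 : -1 < y < 1 by apply/andP; split; nra.
have y1' : -1 <= y <= 1 by case/andP: y1 => *; apply/andP; split; exact: ltW.
pose t := acos y.
have ct : cos t = y by rewrite /t acosK // in_itv.
have st : sin t != 0.
  rewrite /t sin_acos // sqrtr_eq0 -ltNge subr_gt0 //.
(* Here <bas 0, J z> = d, <bas 0, bas 0> = a and <J z, J z> = - d D, which gives c = d^2 / (- a d
   D). *)
pose c := - d / (a * D).
have zJ : form H (J *m z) (bas 0) = (d%:C)%C.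
  rewrite form_mulmx mulmxA -J_circ -mulmxA (circ_polar (discE p tau)) -scalemxAr J_bas2.
  by rewrite sum_ord3 !mxE /= rmorph1 !rmorph0 !mul0r !addr0 mul1r mulr1.
have hH := circ_herm a x.
have Jz : form H (bas 0) (J *m z) = (d%:C)%C.
  by rewrite -(form_conj _ _ hH) zJ; exact: conjc_real.
have JJ : form H (J *m z) (J *m z) = ((d * (a ^+ 2 - tau2 tau))%:C)%C.
  by rewrite (form_preserves _ _ (J_preserves a x)) form_polar_polar.
have a00 : a != 0 by rewrite gt_eqF.
have [] := elliptic_discrete (al := th) (be := - b) (th := t) (c := c) hH (gamma_isometry tau p2)
  (cis_conj _) rho1 (G_refl0 tau p2) (G_conj p2 (G_J p tau) GC) _ _ _ _ _ _ _ st _ dG.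
- rewrite form_bas_diag //; exact: (aC_neq0 p2).
- rewrite (form_preserves _ _ (J_preserves a x)); exact: (polar_form_neq0 D0 d0).
- rewrite Jz zJ JJ form_bas_diag // -/th -/a -!rmorphM; congr (_ %:C)%C.
  rewrite (_ : a ^+ 2 - tau2 tau = - D); last by rewrite opprB.
  exact: (center_coef d a00 D0).
- by rewrite /c mulf_eq0 oppr_eq0 (negbTE d0) invr_eq0 mulf_eq0 (negbTE a00) (negbTE D0).
- apply/eqP => c1'; move/eqP: c1; apply.
  have : c * (a * D) = a * D by rewrite c1' mul1r.
  by rewrite /c (divfK (mulf_neq0 a00 D0)) => <-; rewrite addrN.
- by apply/eqP => s; move: a0; rewrite /a s mulr0 ltxx.
- by rewrite sinN oppr_eq0.
- rewrite ct /y /N /c opprK sinN -/th.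
  have -> : sin th = a / 2 by rewrite /a mulrAC divff ?mul1r // pnatr_eq0.
  exact: (center_trace _ _ _ a00 D0).
by move=> k k0 ck; exists t, k; split=> //; rewrite ct /y mulrAC mulrC divfK.
Qed.

End Center.

End Criteria.

Section Word.
Context {R : realType}.
Local Notation C := R[i].
Variables (p : nat) (tau : C).
Hypothesis p2 : (2 <= p)%N.

Let th : R := pi / p%:R.
Let a : R := 2 * sin th.
Local Notation x := (xcoef p tau).
Let H := circ a x.
Let G := Gamma p tau.
Let A : R := complex.Re (tau ^+ 3).
Let B : R := complex.Im (tau ^+ 3).
Let K : R := (a * cos th + B) ^+ 2 + (2 * tau2 tau - A - a * sin th) ^+ 2.

Lemma xcoef_cube : x ^+ 3 = 'i * cis (- th) * tau ^+ 3.
Proof.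
have i3 : (- 'i) ^+ 3 = 'i :> C.
  by transitivity (- ('i ^+ 2) * 'i : C); [ring | rewrite sqrCi opprK mul1r].
rewrite /xcoef !exprMn i3 cisX; congr (_ * cis _ * _).
by rewrite psiE -/th; lra.
Qed.

(** Expanding the reflections gives q = a + i e^(i th) (2 |tau|^2 - tau^3). [K] is the squared
    modulus of e^(-i th) q, read off from its real and imaginary parts. *)
Lemma word_form : let q := form H ((refl H (bas 1) (cis (2 * th)) *m refl H (bas 2) (cis (2 * th))) *m bas 0) (bas 0) in
  q * q^* = (K%:C)%C.
Proof.
move=> q.
have aC : (a%:C)%C != 0 := aC_neq0 p2.
have e01 : form H (bas 0) (bas 1) = x^* by rewrite (form_bas _ (isT : (1 < 3)%N) (isT : (0 < 3)%N)) mxE.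
have e10 : form H (bas 1) (bas 0) = x by rewrite (form_bas _ (isT : (0 < 3)%N) (isT : (1 < 3)%N)) mxE.
have e02 : form H (bas 0) (bas 2) = x by rewrite (form_bas _ (isT : (2 < 3)%N) (isT : (0 < 3)%N)) mxE.
have e20 : form H (bas 2) (bas 0) = x^* by rewrite (form_bas _ (isT : (0 < 3)%N) (isT : (2 < 3)%N)) mxE.
have e21 : form H (bas 2) (bas 1) = x by rewrite (form_bas _ (isT : (1 < 3)%N) (isT : (2 < 3)%N)) mxE.
have diag k : (k < 3)%N -> form H (bas k) (bas k) = (a%:C)%C := form_bas_diag p tau (k := k).
have sE : (cis (2 * th) - 1) = 'i * (a%:C)%C * cis th := cis_sub1 p.
have qE : q = (a%:C)%C + 'i * cis th * (2 * ((tau2 tau)%:C)%C - tau ^+ 3).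
  rewrite /q -mulmxA !refl_app formDl formDl !formZl formDl formZl.
  rewrite e01 e10 e02 e20 e21 !diag // sE.
  transitivity ((a%:C)%C + 2 * 'i * cis th * (x * x^*) + ('i * 'i) * (cis th * cis th) * x ^+ 3).
    by field; exact: aC.
  rewrite x_conj xcoef_cube -expr2 sqrCi -cisD.
  transitivity ((a%:C)%C + 'i * (2 * cis th * ((tau2 tau)%:C)%C) - 'i * (cis (th + th) * cis (- th)) * tau ^+ 3).
    by ring.
  by rewrite -cisD addrK; ring.
rewrite qE -complexiE /K /A /B; case: (tau ^+ 3) => A' B'; rewrite /cis.
have h := cos2Dsin2 th.
apply: complexP => /=; last by ring.
transitivity (a ^+ 2 + 2 * a * (cos th * B' - sin th * (2 * tau2 tau - A')) +
  (cos th ^+ 2 + sin th ^+ 2) * ((2 * tau2 tau - A') ^+ 2 + B' ^+ 2)); first by ring.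
transitivity ((cos th ^+ 2 + sin th ^+ 2) * a ^+ 2 + 2 * a * (cos th * B' - sin th * (2 * tau2 tau - A')) +
  ((2 * tau2 tau - A') ^+ 2 + B' ^+ 2)); last by ring.
by rewrite h; ring.
Qed.

(* [R1] and its conjugate by [R2 R3]. *)
Lemma discrete_word : 0 < K < 4 -> K != a ^+ 2 -> discrete_mx G ->
  exists (t : R) (k : nat), [/\ (0 < k)%N, 2 - K = 2 * cos t & cos (k%:R * (2 * t)) = 1].
Proof.
move=> /andP[K0 K4] Ka dG.
have a0 : 0 < a := a_gt0 p2.
have a00 : a != 0 by rewrite gt_eqF.
have a20 : a ^+ 2 != 0 by rewrite expf_neq0.
have [_ GM _ Gp] := gamma_isometry tau p2.
pose y := 1 - K / 2.
have y1 : -1 < y < 1 by rewrite /y; apply/andP; split; lra.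
have y1' : -1 <= y <= 1 by case/andP: y1 => *; apply/andP; split; exact: ltW.
pose t := acos y.
have ct : cos t = y by rewrite /t acosK // in_itv.
have st : sin t != 0.
  rewrite /t sin_acos // sqrtr_eq0 -ltNge subr_gt0.
  by case/andP: y1 => *; nra.
pose r1 : C := cis (- (psi R p / 3)).
pose M := refl H (bas 1) (cis (2 * th)) *m refl H (bas 2) (cis (2 * th)).
have GW : G ((r1 * r1) *: M).
  rewrite /M -scalerA scalemxAr scalemxAl.
  exact: (GM _ _ (G_refl1 tau p2) (G_refl2 tau p2)).
have [pW _] := Gp _ GW.
set w := ((r1 * r1) *: M) *m bas 0.
have GB : G (r1 *: refl H w (cis (2 * th))) := G_conj p2 GW (G_refl0 tau p2).
have wv : form H w (bas 0) * (form H w (bas 0))^* = (K%:C)%C.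
  rewrite /w -scalemxAl formZl rmorphM mulrACA word_form rmorphM mulrACA.
  by rewrite !cis_conj !mul1r.
have hH := circ_herm a x.
have d0 : form H (bas 0) (bas 0) = (a%:C)%C by rewrite form_bas_diag.
have aC : (a%:C)%C != 0 := aC_neq0 p2.
have ww : form H w w = (a%:C)%C by rewrite /w (form_preserves _ _ pW).
have [] := elliptic_discrete (al := th) (be := th) (th := t) (c := K / a ^+ 2) hH (gamma_isometry tau p2)
  (cis_conj _) (cis_conj _) (G_refl0 tau p2) GB _ _ _ _ _ _ _ st _ dG.
- by rewrite d0.
- by rewrite ww.
- rewrite -(form_conj w (bas 0) hH) mulrC wv d0 ww -!rmorphM; congr (_ %:C)%C.
  by field; exact: a00.
- by rewrite mulf_neq0 ?invr_eq0 // gt_eqF.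
- apply/eqP => c1; move/eqP: Ka; apply.
  by rewrite -[LHS](divfK a20) c1 mul1r.
- by apply/eqP => s; move: a0; rewrite /a s mulr0 ltxx.
- by apply/eqP => s; move: a0; rewrite /a s mulr0 ltxx.
- rewrite ct subrr cos0 /y.
  have -> : sin th = a / 2 by rewrite /a mulrAC divff ?mul1r // pnatr_eq0.
  by field; exact: a00.
by move=> k k0 ck; exists t, k; split=> //; rewrite ct /y; lra.
Qed.

End Word.

(** * Certificates for small p *)

Definition tcos (n d : nat) : texp := Tcos (N.of_nat n) (Pos.of_nat d).
(* [sin t = cos (t + 3 pi / 2)] *)
Definition tsin (n d : nat) : texp := tcos (4 * n + 3 * d) (4 * d).
Definition tsub (e f : texp) : texp := Tadd e (Topp f).
Definition tsqr (e : texp) : texp := Tmul e e.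
Definition t2mul (e : texp) : texp := Tmul (TZ 2) e.

(* [s] encodes the real and imaginary parts of [tau]. *)
Section Formulas.
Variables (s : texp * texp) (p m h j : nat).
Definition f_a : texp := t2mul (tsin 1 (2 * p)).
Definition f_norm : texp := Tadd (tsqr s.1) (tsqr s.2).
Definition f_re3 : texp := tsub (Tmul s.1 (tsqr s.1)) (Tmul (TZ 3) (Tmul s.1 (tsqr s.2))).
Definition f_im3 : texp := tsub (Tmul (TZ 3) (Tmul (tsqr s.1) s.2)) (Tmul s.2 (tsqr s.2)).
Definition f_disc : texp :=
  tsub (tsub (Tmul f_a (tsqr f_a)) (Tmul (TZ 3) (Tmul f_a f_norm)))
    (t2mul (tsub (Tmul (tcos 1 (2 * p)) f_im3) (Tmul (tsin 1 (2 * p)) f_re3))).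
Definition f_D : texp := tsub f_norm (tsqr f_a).
(** The angle is j beta = j (m pi / p + h pi / 2), as a fraction of 2 pi; [f_trace] adds pi / p to
    it. *)
Definition f_sin : texp := tsin (2 * j * m + j * h * p) (4 * p).
Definition f_jor : texp :=
  tsub (tsqr f_D) (Tmul (Tmul (TZ 4) (tsqr f_sin)) (tsub (tsqr f_D) (Tmul f_a f_disc))).
Definition f_trace : texp :=
  tsub (Tmul (t2mul (tcos (2 + 2 * j * m + j * h * p) (4 * p))) f_D)
    (Tmul (t2mul f_sin) f_disc).
Definition f_word : texp :=
  Tadd (tsqr (Tadd (Tmul f_a (tcos 1 (2 * p))) f_im3))
    (tsqr (tsub (tsub (t2mul f_norm) f_re3) (Tmul f_a (tsin 1 (2 * p))))).

Definition bsqr (b : Z * Z) := bmul b b.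
Definition bsub (b c : Z * Z) := badd b (bopp c).

(* Same as [(tball k f_a, tball k f_disc, tball k f_D)], but every cosine is
   approximated only once. *)
Definition balls (k : N) : (Z * Z) * (Z * Z) * (Z * Z) :=
  let re := tball k s.1 in let im := tball k s.2 in
  let re2 := bsqr re in let im2 := bsqr im in
  let c := tball k (tcos 1 (2 * p)) in let sn := tball k (tsin 1 (2 * p)) in
  let a := bmul (bcst 2) sn in let a2 := bsqr a in
  let n := badd re2 im2 in
  let re3 := bsub (bmul re re2) (bmul (bcst 3) (bmul re im2)) in
  let im3 := bsub (bmul (bcst 3) (bmul re2 im)) (bmul im im2) in
  (a,
   bsub (bsub (bmul a a2) (bmul (bcst 3) (bmul a n)))
     (bmul (bcst 2) (bsub (bmul c im3) (bmul sn re3))),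
   bsub n a2).

Definition btrace (k : N) (d D sb : Z * Z) : Z * Z :=
  bsub (bmul (bmul (bcst 2) (tball k (tcos (2 + 2 * j * m + j * h * p) (4 * p)))) D)
    (bmul (bmul (bcst 2) sb) d).

Definition bnz (b : Z * Z) : bool := bpos (bsqr b).

Definition jor_check : bool :=
  let: (a, d, D) := balls 1 in let sb := tball 1 f_sin in
  let sb2 := bsqr sb in let D2 := bsqr D in
  [&& bpos sb2, bpos (bopp d), bpos D2 &
      bpos (bsub D2 (bmul (bmul (bcst 4) sb2) (bsub D2 (bmul a d))))].

Definition big_trace (tr D : Z * Z) : bool :=
  let D2 := bsqr D in
  bpos D2 && bpos (bsub (bsqr tr) (bmul (bcst 4) D2)).

(** The tests at exponent 1 are the hypotheses of [discrete_center]; the last one, at exponent [k],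
    shows that the conjugate of 2 cos t = N / D exceeds 2 in absolute value. *)
Definition center_check (M : positive) (k : N) : bool :=
  let: (a, d, D) := balls 1 in let sb := tball 1 f_sin in let D2 := bsqr D in
  let: (_, d', D') := balls k in
  [&& bnz sb, bnz d, bpos D2, bnz (badd d (bmul a D)) &
  [&& bpos (bsub (bmul (bcst 4) D2) (bsqr (btrace 1 d D sb))),
      twf M f_trace, twf M f_D, (Z.gcd (Z.of_N k) (Zpos M) =? 1)%Z &
      big_trace (btrace k d' D' (tball k f_sin)) D']].

Definition word_check (M : positive) (k : N) : bool :=
  let w := tball 1 f_word in
  [&& bpos w, bpos (bsub (bcst 4) w), bnz (bsub w (bsqr (tball 1 f_a))),
      twf M f_word, (Z.gcd (Z.of_N k) (Zpos M) =? 1)%Z &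
      big_trace (bsub (bcst 2) (tball k f_word)) (bcst 1)].
End Formulas.

Section Soundness.
Context {R : realType}.
Local Notation ev := (teval R 1).

Lemma tevalD k e f : teval R k (Tadd e f) = teval R k e + teval R k f. Proof. by []. Qed.
Lemma tevalM k e f : teval R k (Tmul e f) = teval R k e * teval R k f. Proof. by []. Qed.
Lemma tevalN k e : teval R k (Topp e) = - teval R k e. Proof. by []. Qed.
Lemma tevalZ k n : teval R k (TZ (Z.of_nat n)) = n%:R. Proof. exact: ZR_nat. Qed.
Lemma tevalB k e f : teval R k (tsub e f) = teval R k e - teval R k f. Proof. by []. Qed.
Lemma teval_sqr k e : teval R k (tsqr e) = teval R k e ^+ 2. Proof. by rewrite expr2. Qed.
Lemma teval_2 k e : teval R k (t2mul e) = 2 * teval R k e.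
Proof. by rewrite -[2](tevalZ k 2). Qed.

Definition tevalE := (teval_sqr, teval_2, tevalB, tevalN, tevalM, tevalD).

Lemma bnz_neq0 k e : bnz (tball k e) -> teval R k e != 0.
Proof.
move=> /(@tpos_gt0 R k (tsqr e)); rewrite teval_sqr; apply: contraTneq => ->.
by rewrite expr0n ltxx.
Qed.

Lemma big_trace_lt k n d : big_trace (tball k n) (tball k d) ->
  teval R k d != 0 /\ 4 * teval R k d ^+ 2 < teval R k n ^+ 2.
Proof.
rewrite /big_trace => /andP[Dk big]; split; first exact: bnz_neq0.
move: big => /(@tpos_gt0 R k (tsub (tsqr n) (Tmul (TZ 4) (tsqr d)))).
by rewrite tevalB tevalM 2!teval_sqr (tevalZ k 4) subr_gt0.
Qed.

Lemma ballsE k s p : balls s p k =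
  (tball k (f_a p), tball k (f_disc s p), tball k (f_D s p)).
Proof. by []. Qed.

Lemma tcosE n d : (0 < d)%N -> ev (tcos n d) = cos (2 * pi * n%:R / d%:R).
Proof.
move=> d0; rewrite /tcos /teval (_ : Z.of_N (1 * N.of_nat n) = Z.of_nat n); last by lia.
by rewrite (_ : Zpos (Pos.of_nat d) = Z.of_nat d) ?ZR_nat //; lia.
Qed.

Lemma tsinE n d : (0 < d)%N -> ev (tsin n d) = sin (2 * pi * n%:R / d%:R).
Proof.
move=> d0; rewrite /tsin tcosE ?muln_gt0 // natrD !natrM.
have dR : d%:R != 0 :> R by rewrite pnatr_eq0 -lt0n.
have -> : 2 * pi * (4 * n%:R + 3 * d%:R) / (4 * d%:R) = 2 * pi * n%:R / d%:R - pi / 2 + pi *+ 2 :> R.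
  by rewrite -[pi *+ 2]mulr_natl; field.
by rewrite cosD2pi cosBpihalf.
Qed.

Variables (s : texp * texp) (tau : R[i]).
Hypothesis (hs : tau = Complex (ev s.1) (ev s.2)).
Variables (p : nat).
Hypothesis p2 : (2 <= p)%N.
Let th : R := pi / p%:R.
Let a : R := 2 * sin th.

Let p0 : (0 < p)%N. Proof. exact: leq_trans p2. Qed.
Let pR : p%:R != 0 :> R. Proof. by rewrite pnatr_eq0 -lt0n p0. Qed.

Lemma ev_cos1 : ev (tcos 1 (2 * p)) = cos th.
Proof. by rewrite tcosE ?muln_gt0 // natrM; congr cos; rewrite /th; field. Qed.

Lemma ev_sin1 : ev (tsin 1 (2 * p)) = sin th.
Proof. by rewrite tsinE ?muln_gt0 // natrM; congr sin; rewrite /th; field. Qed.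

Lemma ev_a : ev (f_a p) = a.
Proof. by rewrite /f_a teval_2 ev_sin1. Qed.

Lemma ev_norm : ev (f_norm s) = tau2 tau.
Proof. by rewrite /f_norm !tevalE /tau2 hs. Qed.

Lemma ev_re3 : ev (f_re3 s) = complex.Re (tau ^+ 3).
Proof.
rewrite /f_re3 !tevalE (tevalZ 1 3) hs.
by rewrite !exprS expr0 /=; ring.
Qed.

Lemma ev_im3 : ev (f_im3 s) = complex.Im (tau ^+ 3).
Proof.
rewrite /f_im3 !tevalE (tevalZ 1 3) hs.
by rewrite !exprS expr0 /=; ring.
Qed.

Lemma ev_disc : ev (f_disc s p) = disc p tau.
Proof.
rewrite /f_disc !(ev_a, ev_norm, ev_re3, ev_im3, ev_cos1, ev_sin1, tevalE) (tevalZ 1 3).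
by rewrite /disc -/th -/a; ring.
Qed.

Lemma ev_D : ev (f_D s p) = tau2 tau - a ^+ 2.
Proof. by rewrite /f_D !(ev_norm, ev_a, tevalE). Qed.

Lemma ev_word : ev (f_word s p) =
  (a * cos th + complex.Im (tau ^+ 3)) ^+ 2 + (2 * tau2 tau - complex.Re (tau ^+ 3) - a * sin th) ^+ 2.
Proof.
by rewrite /f_word !(ev_a, ev_norm, ev_re3, ev_im3, ev_cos1, ev_sin1, tevalE).
Qed.

Lemma word_check_sound M k : word_check s p M k -> ~ discrete_mx (Gamma p tau).
Proof.
rewrite /word_check => /and5P[K0 K4 Ka wf /andP[/Z.eqb_eq gcd1 big]] dG.
have {big} [_ big] := @big_trace_lt k (tsub (TZ 2) (f_word s p)) (TZ 1) big.
move: K0 => /(@tpos_gt0 R 1 (f_word s p)) K0.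
move: K4 => /(@tpos_gt0 R 1 (tsub (TZ 4) (f_word s p))) K4.
move: Ka => /(@bnz_neq0 1 (tsub (f_word s p) (tsqr (f_a p)))) Ka.
rewrite ev_word in K0; rewrite tevalB ev_word (tevalZ 1 4) in K4.
rewrite tevalB teval_sqr ev_word ev_a subr_eq0 in Ka.
have [] := discrete_word p2 _ _ dG.
- by rewrite K0 -subr_gt0.
- exact: Ka.
move=> t [n [n0 Kt ct]].
have one k' : teval R k' (TZ 1) = 1 by exact: (tevalZ k' 1).
have wf' : twf M (tsub (TZ 2) (f_word s p)) by exact: wf.
have Nt : ev (tsub (TZ 2) (f_word s p)) = 2 * cos t * ev (TZ 1).
  by rewrite tevalB ev_word (tevalZ 1 2) one Kt mulr1.
have D1 k' : teval R k' (TZ 1) != 0 by rewrite one oner_neq0.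
have h := @rational_angle_conj R M k (tsub (TZ 2) (f_word s p)) (TZ 1) t n wf' isT gcd1 n0 (D1 _) Nt ct (D1 k).
by move: big; rewrite ltNge h.
Qed.

Section Center.
Variables (m h j : nat) (phi : R).
Hypotheses (hphi : 2 - tau2 tau = 2 * cos phi) (sphi : sin phi != 0)
  (hm : cis (phi * m%:R) = cis (h%:R * pi)).
Let b : R := j%:R * (m%:R * th + h%:R * pi / 2).

Lemma ev_sin : ev (f_sin p m h j) = sin b.
Proof.
rewrite /f_sin tsinE ?muln_gt0 // natrD !natrM; congr sin.
by rewrite /b /th; field.
Qed.

Lemma ev_trace : ev (f_trace s p m h j) =
  2 * cos (th + b) * (tau2 tau - a ^+ 2) - 2 * sin b * disc p tau.
Proof.
rewrite /f_trace !(ev_sin, ev_D, ev_disc, tevalE) tcosE ?muln_gt0 //.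
rewrite [(4 * p)%:R]natrM !natrD !natrM (_ : 2 * pi * _ / _ = th + b) //.
by rewrite /b /th; field.
Qed.

Lemma jor_check_sound : jor_check s p m h j -> ~ discrete_mx (Gamma p tau).
Proof.
rewrite /jor_check ballsE => /and4P[].
move=> /bnz_neq0 s0 /(@tpos_gt0 R 1 (Topp (f_disc s p))) d0 /bnz_neq0 D0.
move=> /(@tpos_gt0 R 1 (f_jor s p m h j)) hlt.
rewrite ev_sin in s0; rewrite !(ev_disc, tevalE) oppr_gt0 in d0; rewrite ev_D in D0.
rewrite /f_jor !(ev_D, ev_sin, ev_a, ev_disc, tevalE) (tevalZ 1 4) subr_gt0 in hlt.
have d0' : disc p tau != 0 by rewrite lt_eqF.
exact: (not_discrete_jorgensen p2 hphi sphi hm D0 d0' s0 d0 hlt).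
Qed.

Lemma center_check_sound M k : center_check s p m h j M k -> ~ discrete_mx (Gamma p tau).
Proof.
rewrite /center_check !ballsE => /and5P[/bnz_neq0 s0 /bnz_neq0 d0 /bnz_neq0 D0].
move=> /(@bnz_neq0 1 (Tadd (f_disc s p) (Tmul (f_a p) (f_D s p)))) c1 /and5P[].
move=> /(@tpos_gt0 R 1 (tsub (Tmul (TZ 4) (tsqr (f_D s p))) (tsqr (f_trace s p m h j)))) hlt.
move=> wf1 wf2 /Z.eqb_eq gcd1 /(@big_trace_lt k (f_trace s p m h j)) [Dk big] dG.
have D1 := D0.
rewrite ev_sin in s0; rewrite ev_disc in d0; rewrite ev_D in D0.
rewrite !(ev_disc, ev_a, ev_D, tevalE) in c1.
rewrite !(ev_trace, ev_D, tevalE) (tevalZ 1 4) subr_gt0 in hlt.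
have [t [n [n0 Nt ct]]] := discrete_center p2 hphi sphi hm D0 d0 s0 c1 hlt dG.
have := @rational_angle_conj R M k (f_trace s p m h j) (f_D s p) t n wf1 wf2 gcd1 n0 D1 _ ct Dk.
rewrite ev_trace ev_D => /(_ Nt) hle.
by move: big; rewrite ltNge hle.
Qed.

End Center.
End Soundness.

(** * The sporadic values and their angles *)

Section CosineSums.
Context {R : realType}.
Implicit Type x : R.

Lemma sin_telescope x y : 2 * (sin x * cos y) = sin (y + x) - sin (y - x).
Proof. by rewrite sinD sinB; ring. Qed.

(** Multiplied by sin (pi / 5), the sum telescopes to sin pi = 0; likewise for 7. *)
Lemma cos_sum5 : 1 + 2 * cos (2 * pi / 5) + 2 * cos (4 * pi / 5) = 0 :> R.
Proof.
have p0 := pi_gt0 R; have s0 : sin (pi / 5) != 0 :> R by rewrite gt_eqF // sin_gt0_pi //; lra.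
apply: (mulfI s0); rewrite mulr0.
have := sin_telescope (pi / 5) (2 * pi / 5); have := sin_telescope (pi / 5) (4 * pi / 5).
rewrite (_ : 4 * pi / 5 + pi / 5 = pi); last by lra.
rewrite (_ : 2 * pi / 5 - pi / 5 = pi / 5); last by lra.
rewrite (_ : 4 * pi / 5 - pi / 5 = 2 * pi / 5 + pi / 5); last by lra.
by rewrite sinpi; lra.
Qed.

Lemma cos_sum7 : 1 + 2 * cos (2 * pi / 7) + 2 * cos (4 * pi / 7) + 2 * cos (6 * pi / 7) = 0 :> R.
Proof.
have p0 := pi_gt0 R; have s0 : sin (pi / 7) != 0 :> R by rewrite gt_eqF // sin_gt0_pi //; lra.
apply: (mulfI s0); rewrite mulr0.
have := sin_telescope (pi / 7) (2 * pi / 7); have := sin_telescope (pi / 7) (4 * pi / 7).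
have := sin_telescope (pi / 7) (6 * pi / 7).
rewrite (_ : 6 * pi / 7 + pi / 7 = pi); last by lra.
rewrite (_ : 2 * pi / 7 - pi / 7 = pi / 7); last by lra.
rewrite (_ : 4 * pi / 7 - pi / 7 = 2 * pi / 7 + pi / 7); last by lra.
rewrite (_ : 6 * pi / 7 - pi / 7 = 4 * pi / 7 + pi / 7); last by lra.
by rewrite sinpi; lra.
Qed.

Lemma cos_sub2pi x y : x + y = 2 * pi -> cos x = cos y.
Proof. by move=> h; rewrite (_ : x = - y + pi *+ 2) ?cosD2pi ?cosN // -[_ *+ 2]mulr_natl; lra. Qed.

Lemma cos_pi3 : cos (pi / 3) = 1 / 2 :> R.
Proof.
have p0 := pi_gt0 R; have s0 : sin (pi / 3) != 0 :> R by rewrite gt_eqF // sin_gt0_pi //; lra.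
apply: (mulfI s0); have := sin_telescope (pi / 3) (pi / 3).
rewrite subrr sin0 (_ : pi / 3 + pi / 3 = pi - pi / 3); last by lra.
by rewrite sinB sinpi cospi; lra.
Qed.

Lemma cos_double x : cos (2 * x) = 2 * cos x ^+ 2 - 1.
Proof. by rewrite mulr_natl cos_mulr2n -mulr_natl. Qed.

End CosineSums.

(** Encodes cis (2 pi / b) + q cis (- pi / b), the common shape of all sporadic values except
    sigma_4: b = 6 up to sigma_3, b = 9 from sigma_5 on. *)
Definition tpair (b : nat) (q : texp) : texp * texp :=
  (Tadd (tcos 1 b) (Tmul (tcos 1 (2 * b)) q), tsub (tsin 1 b) (Tmul (tsin 1 (2 * b)) q)).

Definition tsigma (j : nat) : texp * texp :=
  match j with
  | 1 => tpair 6 (t2mul (tcos 1 8))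
  | 2 => tpair 6 (t2mul (tcos 1 10))
  | 3 => tpair 6 (t2mul (tcos 1 5))
  | 4 => (Tadd (Tadd (tcos 1 7) (tcos 2 7)) (tcos 4 7), Tadd (Tadd (tsin 1 7) (tsin 2 7)) (tsin 4 7))
  | 5 => tpair 9 (t2mul (tcos 1 5))
  | 6 => tpair 9 (t2mul (tcos 2 5))
  | 7 => tpair 9 (t2mul (tcos 1 7))
  | 8 => tpair 9 (t2mul (tcos 2 7))
  | _ => tpair 9 (t2mul (tcos 3 7))
  end.

Section SigmaValues.
Context {R : realType}.
Local Notation ev := (teval R 1).
Definition is_value (s : texp * texp) (tau : R[i]) := tau = Complex (ev s.1) (ev s.2).

Lemma tpair_value b u v (q : R) e : (0 < b)%N -> u = 2 * pi / b%:R -> v = pi / b%:R ->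
  q = ev e -> is_value (tpair b e) (cis u + cis (- v) * cplx q).
Proof.
move=> b0 -> -> ->; have b0' : b%:R != 0 :> R by rewrite pnatr_eq0 -lt0n.
rewrite /is_value tevalD tevalB !tevalM !tsinE ?muln_gt0 // !tcosE ?muln_gt0 // mulr1 natrM.
rewrite (_ : 2 * pi / (2 * b%:R) = pi / b%:R); last by field.
rewrite /cis /cplx cosN sinN; congr Complex; rewrite /= !mulr0 ?subr0 ?add0r //.
by rewrite mulNr.
Qed.

Lemma sigma_value (j : nat) : (1 <= j <= 9)%N -> is_value (tsigma j) (sigma R j).
Proof.
have two n d x : (0 < d)%N -> x = 2 * pi * n%:R / d%:R -> 2 * cos x = ev (t2mul (tcos n d)).
  by move=> d0 ->; rewrite teval_2 tcosE.
case: j => [|[|[|[|[|[|[|[|[|[|//]]]]]]]]]] // _; rewrite /tsigma /sigma;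
  try by apply: tpair_value => //; try apply: two => //; lra.
rewrite /is_value !tevalD !tsinE // !tcosE // /cis; congr Complex;
by rewrite /=; congr (_ + _ + _); congr (_ _); lra.
Qed.

Lemma tau2_pair b (q : R) : (0 < b)%N ->
  tau2 (cis (2 * pi / b%:R) + cis (- (pi / b%:R)) * cplx q) = 1 + q ^+ 2 + 2 * q * cos (3 * pi / b%:R).
Proof.
move=> b0; have b0' : b%:R != 0 :> R by rewrite pnatr_eq0 -lt0n.
rewrite (_ : 3 * pi / b%:R = 2 * pi / b%:R + pi / b%:R); last by field.
set u := 2 * pi / _; set v := pi / _.
rewrite cosD /tau2 /cis /cplx cosN sinN /= !mulr0 subr0 add0r.
by have := cos2Dsin2 u; have := cos2Dsin2 v; nra.
Qed.

Definition is_angle (m h : nat) (tau : R[i]) := exists phi : R,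
  [/\ 2 - tau2 tau = 2 * cos phi, sin phi != 0 & cis (phi * m%:R) = cis (h%:R * pi)].

Lemma angle0 m k (phi : R) tau : 0 < phi < pi -> m%:R * phi = 2 * pi * k%:R ->
  2 - tau2 tau = 2 * cos phi -> is_angle m 0 tau.
Proof.
move=> phi0 hm h2; exists phi; split=> //; first by rewrite gt_eqF // sin_gt0_pi.
by rewrite mulrC hm mul0r -[in RHS](mulr0 (2 * pi)) !(cis_nat2pi _) // (cis_nat2pi 0).
Qed.

Lemma angle_right (tau : R[i]) : tau2 tau = 2 -> is_angle 2 1 tau.
Proof.
move=> h; exists (pi / 2); split; first by rewrite h cos_pihalf; ring.
  by rewrite sin_pihalf oner_neq0.
by rewrite divfK ?mul1r.
Qed.

Lemma tau2_pair6 (q : R) : tau2 (cis (pi / 3) + cis (- (pi / 6)) * cplx q) = 1 + q ^+ 2.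
Proof.
rewrite (_ : pi / 3 = 2 * pi / 6%:R); last by lra.
by rewrite tau2_pair // (_ : 3 * pi / 6%:R = pi / 2) ?cos_pihalf; [ring | lra].
Qed.

Lemma tau2_pair9 (q : R) :
  tau2 (cis (2 * pi / 9) + cis (- (pi / 9)) * cplx q) = 1 + q ^+ 2 + q.
Proof.
rewrite (tau2_pair q (b := 9)) // (_ : 3 * pi / 9%:R = pi / 3) ?cos_pi3; [by field | by lra].
Qed.

Lemma tau2_sigma4 : tau2 (sigma R 4) = 2.
Proof.
rewrite /sigma /tau2 /cis /=.
have h x y : cos x * cos y + sin x * sin y = cos (y - x) :> R by rewrite cosB; ring.
have h1 := h (2 * pi / 7) (4 * pi / 7); have h2 := h (4 * pi / 7) (8 * pi / 7).
have h3 := h (2 * pi / 7) (8 * pi / 7).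
move: h1 h2 h3; rewrite (_ : 4 * pi / 7 - 2 * pi / 7 = 2 * pi / 7); last by lra.
rewrite (_ : 8 * pi / 7 - 4 * pi / 7 = 4 * pi / 7); last by lra.
rewrite (_ : 8 * pi / 7 - 2 * pi / 7 = 6 * pi / 7); last by lra.
have := cos_sum7 (R := R); have := cos2Dsin2 (2 * pi / 7 : R).
have := cos2Dsin2 (4 * pi / 7 : R); have := cos2Dsin2 (8 * pi / 7 : R).
lra.
Qed.

(** The default 7 of [nth] is the value for j = 7, 8, 9; the entry at index 0 is filler. *)
Definition sigma_m (j : nat) : nat := nth 7%N [:: 0; 3; 5; 5; 2; 2; 2]%N j.
Definition sigma_h (j : nat) : nat := (4 <= j <= 6)%N.

(** |tau|^2 is 3 for sigma_1 and 2 for sigma_4, sigma_5, sigma_6. In the other cases the relation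
    between the cosines of multiples of 2 pi / 5 or 2 pi / 7 turns 2 - |tau|^2 into a single 2 cos
    phi. *)
Lemma sigma_angle (j : nat) : (1 <= j <= 9)%N -> is_angle (sigma_m j) (sigma_h j) (sigma R j).
Proof.
have p0 := pi_gt0 R.
have dbl x y : y = 2 * x -> (2 * cos x) ^+ 2 = 2 + 2 * cos y :> R.
  by move=> ->; rewrite cos_double; ring.
have c5 := cos_sum5 (R := R); have c7 := cos_sum7 (R := R).
have e1 : cos (8 * pi / 5) = cos (2 * pi / 5) :> R by apply: cos_sub2pi; lra.
have e2 : cos (8 * pi / 7) = cos (6 * pi / 7) :> R by apply: cos_sub2pi; lra.
have e3 : cos (12 * pi / 7) = cos (2 * pi / 7) :> R by apply: cos_sub2pi; lra.
case: j => [|[|[|[|[|[|[|[|[|[|//]]]]]]]]]] // _; rewrite /sigma_m /sigma_h /=.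
- apply: (@angle0 3 1 (2 * pi / 3)); [by apply/andP; split; lra | by rewrite mulr1; field |].
  rewrite tau2_pair6 (dbl _ (pi / 2)); last by lra.
  by rewrite cos_pihalf (_ : 2 * pi / 3 = pi - pi / 3) ?cosB ?cospi ?sinpi ?cos_pi3; lra.
- apply: (@angle0 5 2 (4 * pi / 5)); [by apply/andP; split; lra | by field |].
  by rewrite tau2_pair6 (dbl _ (2 * pi / 5)); lra.
- apply: (@angle0 5 1 (2 * pi / 5)); [by apply/andP; split; lra | by field |].
  by rewrite tau2_pair6 (dbl _ (4 * pi / 5)); lra.
- by apply: angle_right; exact: tau2_sigma4.
- by apply: angle_right; rewrite tau2_pair9 (dbl _ (4 * pi / 5)); lra.
- by apply: angle_right; rewrite tau2_pair9 (dbl _ (8 * pi / 5)); lra.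
- apply: (@angle0 7 3 (6 * pi / 7)); [by apply/andP; split; lra | by field |].
  by rewrite tau2_pair9 (dbl _ (4 * pi / 7)); lra.
- apply: (@angle0 7 1 (2 * pi / 7)); [by apply/andP; split; lra | by field |].
  by rewrite tau2_pair9 (dbl _ (8 * pi / 7)); lra.
- apply: (@angle0 7 2 (4 * pi / 7)); [by apply/andP; split; lra | by field |].
  by rewrite tau2_pair9 (dbl _ (12 * pi / 7)); lra.
Qed.

End SigmaValues.

(* [J] lists pairs (j, values of p) for [jor_check], [C] triples (p, j, k) for
   [center_check]; the lcm is a common denominator of all angles. *)
Definition certified (s : texp * texp) (m h : nat) (M : Z) (J : seq (nat * seq nat))
    (C : seq (nat * nat * N)) : bool :=
  all (fun c => all (fun p => (2 <= p)%N && jor_check s p m h c.1) c.2) J &&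
  all (fun c => let: (p, j, k) := c in
    (2 <= p)%N && center_check s p m h j (Z.to_pos (Z.lcm M (16 * Z.of_nat p))) k) C.

Lemma certified_sound (R : realType) s m h M J C (tau : R[i]) p : certified s m h M J C ->
  is_value s tau -> is_angle m h tau ->
  p \in flatten (unzip2 J) ++ [seq c.1.1 | c <- C] -> ~ discrete_mx (Gamma p tau).
Proof.
move=> /andP[/allP hJ /allP hC] vs [phi [h1 h2 h3]].
rewrite mem_cat => /orP[/flattenP[l /mapP[c cJ ->] pl]|/mapP[[[p' j] k] cC ->]].
  by have /allP/(_ p pl)/andP[p2 hj] := hJ c cJ; exact: (jor_check_sound vs p2 h1 h2 h3 hj).
by have /andP[p2 hk] := hC _ cC; exact: (center_check_sound vs p2 h1 h2 h3 hk).
Qed.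

Definition tconj (s : texp * texp) : texp * texp := (s.1, Topp s.2).
Definition tsporadic (c : bool) (j : nat) : texp * texp :=
  if c then tconj (tsigma j) else tsigma j.
Definition sporadic_value (R : realType) (c : bool) (j : nat) : R[i] :=
  if c then (sigma R j)^* else sigma R j.

Section Tables.
Context {R : realType}.

Lemma tau2_conj (tau : R[i]) : tau2 tau^* = tau2 tau.
Proof. by case: tau => x y; rewrite /tau2 /= sqrrN. Qed.

Lemma tsporadic_value c (j : nat) : (1 <= j <= 9)%N ->
  is_value (tsporadic c j) (sporadic_value R c j).
Proof.
move=> /sigma_value v; case: c; rewrite /tsporadic /sporadic_value; last exact: v.
by rewrite (v R).
Qed.

Lemma sporadic_angle c (j : nat) : (1 <= j <= 9)%N ->
  is_angle (sigma_m j) (sigma_h j) (sporadic_value R c j).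
Proof.
move=> /(@sigma_angle R)[phi h]; case: c; exists phi => //.
by rewrite /sporadic_value tau2_conj.
Qed.

Lemma certified_sporadic c (j a n : nat) (e : seq nat) M J C p : (1 <= j <= 9)%N ->
  certified (tsporadic c j) (sigma_m j) (sigma_h j) M J C ->
  all (fun p => (p \in e) || (p \in flatten (unzip2 J) ++ [seq c.1.1 | c <- C])) (iota a n) ->
  (a <= p < a + n)%N -> p \notin e -> ~ discrete_mx (Gamma p (sporadic_value R c j)).
Proof.
move=> hj cert /allP h pa /negPf pe.
have := h p; rewrite mem_iota pe => /(_ pa).
exact: certified_sound cert (tsporadic_value c hj) (sporadic_angle c hj).
Qed.

Lemma small_sigma1 p : (7 <= p < 60)%N -> ~ discrete_mx (Gamma p (sigma R 1)).
Proof.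
(* In the first list [j] brings j m pi / p + j h pi / 2 close to a multiple of pi, so that C^j is
   nearly scalar. 48 is a common denominator for [tsigma 1], where [tsin] quadruples denominators.
   The later tables are built in the same way. *)
move=> hp; have cert : certified (tsporadic false 1) 3 0 48
    [:: (1, iota 20 40); (3, [:: 8; 10]); (4, [:: 11; 13; 14]); (5, [:: 16; 17]); (6, [:: 19])]%N
    [:: (7%N, 2%N, 5%num); (9%N, 2%N, 5%num); (12%N, 3%N, 7%num); (15%N, 3%N, 13%num); (18%N, 4%N, 13%num)] by vm_compute.
exact: (@certified_sporadic false 1 7 53 [:: ]%N _ _ _ _ isT cert isT hp isT).
Qed.

Lemma small_sigma1_conj p : (5 <= p < 8)%N -> ~ discrete_mx (Gamma p (sigma R 1)^*).
Proof.
move=> hp; have cert : certified (tsporadic true 1) 3 0 48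
    [:: (2, [:: 7])]%N
    [:: (5%N, 1%N, 7%num); (6%N, 1%N, 7%num)] by vm_compute.
exact: (@certified_sporadic true 1 5 3 [:: ]%N _ _ _ _ isT cert isT hp isT).
Qed.

Lemma small_sigma2 p : (6 <= p < 60)%N -> ~ discrete_mx (Gamma p (sigma R 2)).
Proof.
move=> hp; have cert : certified (tsporadic false 2) 5 0 240
    [:: (1, iota 31 29); (2, [:: 9; 11]); (3, [:: 8; 13; 14; 16; 17]); (4, [:: 18; 19; 21; 22; 23]); (5, [:: 12; 24; 26; 27; 28; 29])]%N
    [:: (6%N, 1%N, 7%num); (7%N, 1%N, 11%num); (10%N, 1%N, 7%num); (15%N, 2%N, 7%num); (20%N, 2%N, 7%num); (25%N, 2%N, 7%num); (30%N, 2%N, 7%num)] by vm_compute.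
exact: (@certified_sporadic false 2 6 54 [:: ]%N _ _ _ _ isT cert isT hp isT).
Qed.

Lemma small_sigma2_conj p : (6 <= p < 20)%N -> ~ discrete_mx (Gamma p (sigma R 2)^*).
Proof.
move=> hp; have cert : certified (tsporadic true 2) 5 0 240
    [:: (2, [:: 9; 11]); (3, [:: 7; 8; 13; 14; 16; 17]); (4, [:: 18; 19]); (5, [:: 12])]%N
    [:: (6%N, 1%N, 13%num); (10%N, 1%N, 7%num); (15%N, 1%N, 13%num)] by vm_compute.
exact: (@certified_sporadic true 2 6 14 [:: ]%N _ _ _ _ isT cert isT hp isT).
Qed.

Lemma small_sigma4 p : (5 <= p < 7)%N -> ~ discrete_mx (Gamma p (sigma R 4)).
Proof.
move=> hp; have cert : certified (tsporadic false 4) 2 1 28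
    [:: (1, [:: 5])]%N
    [:: (6%N, 1%N, 11%num)] by vm_compute.
exact: (@certified_sporadic false 4 5 2 [:: ]%N _ _ _ _ isT cert isT hp isT).
Qed.

Lemma small_sigma4_conj p : (7 <= p < 60)%N -> p \notin [:: 8; 12]%N -> ~ discrete_mx (Gamma p (sigma R 4)^*).
Proof.
move=> hp pe; have cert : certified (tsporadic true 4) 2 1 28
    [:: (2, iota 27 33); (3, [:: 10; 11; 13; 14; 15; 16]); (5, [:: 7; 17; 18; 19; 21; 22; 23; 24; 25; 26]); (7, [:: 9])]%N
    [:: (20%N, 3%N, 13%num)] by vm_compute.
exact: (@certified_sporadic true 4 7 53 [:: 8; 12]%N _ _ _ _ isT cert isT hp pe).
Qed.

Lemma small_sigma5 p : (7 <= p < 60)%N -> p \notin [:: 8; 12]%N -> ~ discrete_mx (Gamma p (sigma R 5)).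
Proof.
move=> hp pe; have cert : certified (tsporadic false 5) 2 1 360
    [:: (2, iota 28 32); (3, [:: 10; 11; 13; 14; 15; 16]); (5, [:: 7; 17; 18; 19; 21; 22; 23; 24; 25; 26; 27]); (7, [:: 9])]%N
    [:: (20%N, 3%N, 7%num)] by vm_compute.
exact: (@certified_sporadic false 5 7 53 [:: 8; 12]%N _ _ _ _ isT cert isT hp pe).
Qed.

Lemma small_sigma6 : ~ discrete_mx (Gamma 5 (sigma R 6)).
Proof.
have cert : certified (tsporadic false 6) 2 1 360
    [::]
    [:: (5%N, 1%N, 7%num)] by vm_compute.
exact: (@certified_sporadic false 6 5 1 [:: ]%N _ _ _ 5 isT cert isT isT isT).
Qed.

Lemma small_sigma6_conj : ~ discrete_mx (Gamma 5 (sigma R 6)^*).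
Proof.
have cert : certified (tsporadic true 6) 2 1 360
    [::]
    [:: (5%N, 1%N, 13%num)] by vm_compute.
exact: (@certified_sporadic true 6 5 1 [:: ]%N _ _ _ 5 isT cert isT isT isT).
Qed.

Lemma small_sigma7 p : (5 <= p < 60)%N -> p \notin [:: 7; 14]%N -> ~ discrete_mx (Gamma p (sigma R 7)).
Proof.
move=> hp pe; have cert : certified (tsporadic false 7) 7 0 504
    [:: (1, [:: 8; 44; 45; 46; 47; 48; 49; 50; 51; 52; 53; 54; 55; 56; 57; 58; 59]); (2, [:: 13; 15; 16]); (3, [:: 10; 11; 19; 20; 22; 23; 24]); (4, [:: 9; 25; 26; 27; 29; 30; 31; 32; 33]); (5, [:: 12; 17; 18; 34; 36; 37; 38; 39; 40; 41]); (6, [:: 43])]%N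
    [:: (5%N, 2%N, 13%num); (6%N, 5%N, 5%num); (21%N, 2%N, 5%num); (28%N, 3%N, 5%num); (35%N, 4%N, 11%num); (42%N, 4%N, 5%num)] by vm_compute.
exact: (@certified_sporadic false 7 5 55 [:: 7; 14]%N _ _ _ _ isT cert isT hp pe).
Qed.

(** For this pair and the next two, beta = m pi / p + h pi / 2 equals pi. Then C is scalar and
    carries no information, hence the recourse to the word R2 R3. *)
Lemma word_sigma1_conj : ~ discrete_mx (Gamma 3 (sigma R 1)^*).
Proof.
by apply: (@word_check_sound _ _ _ (@tsporadic_value true 1 isT) 3 isT 1152 7%num); vm_compute.
Qed.

Lemma word_sigma4 : ~ discrete_mx (Gamma 4 (sigma R 4)).
Proof.
by apply: (@word_check_sound _ _ _ (@tsporadic_value false 4 isT) 4 isT 224 5%num); vm_compute.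
Qed.

Lemma word_sigma5_conj : ~ discrete_mx (Gamma 4 (sigma R 5)^*).
Proof.
by apply: (@word_check_sound _ _ _ (@tsporadic_value true 5 isT) 4 isT 1440 19%num); vm_compute.
Qed.

End Tables.

(** Taking determinants in the diagonalization gives |det P|^2 det H as the product of the diagonal
    entries; as 2 + 1 = 3, none of them is zero and exactly one is negative. *)
Lemma signature_disc_lt0 (R : realType) p (tau : R[i]) : has_signature (Hmx p tau) 2 1 -> disc p tau < 0.
Proof.
move=> [P [d [Pu hd pos neg]]].
have prod_lt0 : \prod_i d 0 i < 0.
  set A := [set i | 0 < d 0 i]%SET in pos; set B := [set i | d 0 i < 0]%SET in neg.
  have BA : B = (~: A)%SET.
    apply/eqP; rewrite eqEcard neg cardsCs finset.setCK card_ord pos leqnn andbT.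
    by apply/fintype.subsetP => i; rewrite !inE => h; rewrite -leNgt ltW.
  have [b Bb] : exists b, B = [set b]%SET by apply/cards1P; rewrite neg.
  rewrite (bigID (mem A)) /= pmulr_rlt0; last by apply: prodr_gt0 => i; rewrite inE.
  rewrite (eq_bigl (mem B)); last by move=> i; rewrite BA !inE.
  have bB : b \in B by rewrite Bb finset.set11.
  by rewrite Bb big_set1; move: bB; rewrite inE.
have := congr1 determinant hd; rewrite !det_mulmx det_diag.
rewrite det_map_mx det_tr HmxE det_circ -discE.
have -> : \prod_i map_mx (@cplx R) d 0 i = ((\prod_i d 0 i)%:C)%C :> R[i].
  by rewrite rmorph_prod; apply: eq_bigr => i _; rewrite mxE.
have : \det P != 0 by rewrite -unitfE -unitmxE.
case: (\det P) => u v uv0 E.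
have {}E : (u ^+ 2 + v ^+ 2) * disc p tau = \prod_i d 0 i.
  by have := congr1 (@complex.Re _) E; rewrite /= !(mulr0, subr0) => <-; ring.
move: prod_lt0; rewrite -E pmulr_rlt0 // lt_neqAle addr_ge0 ?sqr_ge0 // andbT eq_sym.
by rewrite paddr_eq0 ?sqr_ge0 // !sqrf_eq0; move: uv0; rewrite eq_complex.
Qed.

(** * Large p *)

Section LargeP.
Context {R : realType}.

Lemma pi_lt : pi < 63 / 20 :> R.
Proof.
have : bpos (badd (bcst 63) (bopp (bscale 20 bpi))) by vm_compute.
move/(bin_pos (bin_add (bin_cst 63) (bin_opp (bin_scale 20 (@bin_pi R))))).
by rewrite (_ : 63%Z = Z.of_nat 63) // (_ : 20%Z = Z.of_nat 20) // !ZR_nat; lra.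
Qed.

Lemma cos_quadratic (x : R) : 0 <= x -> 1 - x ^+ 2 / 2 <= cos x.
Proof.
move=> x0; apply: le_trans (@cosT_le_cos R 0 x x0 isT).
by rewrite /cosT 2!big_ord_recr big_ord0 /= !expr0 expr1 fact0 (_ : (1.*2)`! = 2%N) //; lra.
Qed.

Lemma sin_sqr_le (x : R) : 0 <= x <= 1 -> sin x ^+ 2 <= x ^+ 2.
Proof.
move=> /andP[x0 x1]; have := cos_quadratic x0; have := cos2Dsin2 x; nra.
Qed.

(** For p >= 60, pi < 63 / 20 gives pi / p <= 21 / 400 and thus the bound on [a]; 4 (7 * 21 / 400)^2
    is just below 541 / 1000. In the proof 459 / 1000 is the complement to 1, and 1 / 80 bounds
    a^2. *)
Lemma jorgensen_estimate (a d s t : R) : 0 <= a -> a <= 21 / 200 -> 4 * s <= 541 / 1000 ->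
  3 / 4 <= t -> d < 0 -> - d <= 3 * a * t + t ^+ 2 + t ->
  4 * s * ((t - a ^+ 2) ^+ 2 - a * d) < (t - a ^+ 2) ^+ 2.
Proof.
move=> a0 a1 s4 t34 d0 d1.
have d2 : - d <= 63 / 200 * t + t ^+ 2 + t.
  have : a * t <= 21 / 200 * t by apply: ler_wpM2r; lra.
  by lra.
have ad : - (a * d) <= 21 / 200 * (63 / 200 * t + t ^+ 2 + t).
  by rewrite -mulrN; apply: ler_pM => //; clear -d0; lra.
have ad0 : 0 <= - (a * d) by rewrite -mulrN mulr_ge0 // oppr_ge0 ltW.
have a2 : a ^+ 2 <= 1 / 80.
  by have := @lerXn2r R 2 a (21 / 200); clear -a0 a1; rewrite !nnegrE a0 => /(_ isT); lra.
have D1 : (t - 1 / 80) ^+ 2 <= (t - a ^+ 2) ^+ 2.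
  by clear -a2 t34; apply: lerXn2r; rewrite ?nnegrE; lra.
move: D1; have := sqr_ge0 (t - a ^+ 2); move: ((t - a ^+ 2) ^+ 2) => E E0 D1.
have ht : 541 / 1000 * (21 / 200 * (63 / 200 * t + t ^+ 2 + t)) < 459 / 1000 * (t - 1 / 80) ^+ 2.
  by clear -t34; nra.
have hE : 4 * s * (E - a * d) <= 541 / 1000 * (E - a * d).
  by apply: ler_wpM2r => //; clear -ad0 E0; lra.
clear -hE ht D1 ad; lra.
Qed.

(** The power [j] is such that C^j has angle 2 N th up to sign and full turns, which tends to 0 as p
    grows. *)
Lemma large_p_not_discrete p (tau : R[i]) m h j N : (60 <= p)%N -> (0 < N <= 7)%N ->
  is_angle m h tau ->
  (forall th : R, sin (j%:R * (m%:R * th + h%:R * pi / 2)) ^+ 2 = sin (N%:R * th) ^+ 2) ->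
  3 / 4 <= tau2 tau -> disc p tau < 0 -> ~ discrete_mx (Gamma p tau).
Proof.
move=> p60 /andP[N0 N7] [phi [h1 h2 h3]] hj t34 d0.
have p2 : (2 <= p)%N by exact: leq_trans p60.
have pi0 := pi_gt0 R; have pi315 := pi_lt.
pose th : R := pi / p%:R.
have pR : 60 <= p%:R :> R by rewrite ler_nat.
have NR : (1 <= N%:R :> R) && (N%:R <= 7 :> R) by rewrite ler1n N0 ler_nat.
have th0 : 0 < th by rewrite divr_gt0 //; lra.
have th1 : th <= 21 / 400 by rewrite /th ler_pdivrMr; nra.
have a0 := a_gt0 p2 : 0 < 2 * sin th.
have a1 : 2 * sin th <= 21 / 200.
  have : sin th ^+ 2 <= th ^+ 2 by apply: sin_sqr_le; lra.
  by nra.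
have Nth : 0 < N%:R * th <= 147 / 400 by clear -NR th0 th1; nra.
have s0 : sin (j%:R * (m%:R * th + h%:R * pi / 2)) != 0.
  rewrite -sqrf_eq0 hj sqrf_eq0 gt_eqF // sin_gt0_pi //; have := pi_ge2 R; lra.
have D0 : tau2 tau - (2 * sin th) ^+ 2 != 0 by rewrite gt_eqF //; clear -t34 a0 a1; nra.
have dn0 : disc p tau != 0 by rewrite lt_eqF.
suff hlt : 4 * sin (j%:R * (m%:R * th + h%:R * pi / 2)) ^+ 2 *
    ((tau2 tau - (2 * sin th) ^+ 2) ^+ 2 - 2 * sin th * disc p tau) <
    (tau2 tau - (2 * sin th) ^+ 2) ^+ 2.
  exact: (not_discrete_jorgensen p2 h1 h2 h3 D0 dn0 s0 d0 hlt).
rewrite hj.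
have s4 : 4 * sin (N%:R * th) ^+ 2 <= 541 / 1000.
  have : sin (N%:R * th) ^+ 2 <= (N%:R * th) ^+ 2 by clear -Nth; apply: sin_sqr_le; lra.
  by clear -Nth; nra.
pose u := cos th * complex.Im (tau ^+ 3) - sin th * complex.Re (tau ^+ 3).
have u2 : u ^+ 2 <= tau2 tau ^+ 3.
  have -> : tau2 tau ^+ 3 = complex.Im (tau ^+ 3) ^+ 2 + complex.Re (tau ^+ 3) ^+ 2.
    by rewrite /tau2; case: (tau) => x y; rewrite !exprS expr0 /=; ring.
  rewrite /u; have := cos2Dsin2 th; set c := cos th; set s := sin th; set A := complex.Re _; set B := complex.Im _.
  by have := sqr_ge0 (c * A + s * B); clear; nra.
(* u <= |tau|^3 by Cauchy-Schwarz, and |tau|^3 is the geometric mean of |tau|^4 and |tau|^2. *)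
have u1 : u <= (tau2 tau ^+ 2 + tau2 tau) / 2.
  by have := sqr_ge0 (tau2 tau - 1); clear -u2 t34; nra.
have d1 : - disc p tau <= 3 * (2 * sin th) * tau2 tau + tau2 tau ^+ 2 + tau2 tau.
  have := exprn_ge0 3 (ltW a0); rewrite /disc -/th; move: u1; rewrite /u; clear; lra.
exact: (jorgensen_estimate (ltW a0) a1 s4 t34 d0 d1).
Qed.

(** Supplies the sign of det H for the infinite families of the theorem, from tau itself. The term
    -2 cos th Im tau^3 dominates: sin th Re tau^3 <= 15 (21 / 400) Im tau^3 < (9 / 10) Im tau^3, and
    a^3 <= 3 a |tau|^2. *)
Lemma disc_lt0 p s (tau : R[i]) : (60 <= p)%N -> is_value s tau -> 3 / 4 <= tau2 tau ->
  tpos 1 (f_im3 s) -> tpos 1 (tsub (Tmul (TZ 15) (f_im3 s)) (f_re3 s)) -> disc p tau < 0.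
Proof.
move=> p60 vs t34 /(@tpos_gt0 R); rewrite (ev_im3 vs) => B0 /(@tpos_gt0 R).
rewrite tevalB tevalM (tevalZ 1 15) (ev_im3 vs) (ev_re3 vs) => AB.
have p2 : (2 <= p)%N by exact: leq_trans p60.
have pi0 := pi_gt0 R; have pi315 := pi_lt.
pose th : R := pi / p%:R.
have pR : 60 <= p%:R :> R by rewrite ler_nat.
have th0 : 0 < th by rewrite divr_gt0 //; lra.
have th1 : th <= 21 / 400 by rewrite /th ler_pdivrMr; nra.
have a0 := a_gt0 p2 : 0 < 2 * sin th.
have a1 : 2 * sin th <= 21 / 200.
  have : sin th ^+ 2 <= th ^+ 2 by apply: sin_sqr_le; lra.
  by nra.
have c1 := cos_quadratic (ltW th0).
rewrite /disc -/th; move: B0 AB; set A := complex.Re _; set B := complex.Im _ => B0 AB.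
have c2 : 9 / 10 <= cos th by nra.
have s0 : 0 <= sin th by clear -a0; lra.
have h1 : sin th * A <= sin th * (15 * B) by apply: ler_wpM2l => //; clear -AB; lra.
have h2 : sin th * B <= 21 / 400 * B by apply: (ler_wpM2r (ltW B0)); clear -a1; lra.
have h3 : 9 / 10 * B <= cos th * B by exact: (ler_wpM2r (ltW B0) c2).
have h4 : (2 * sin th) ^+ 3 <= 3 * (2 * sin th) * tau2 tau by nra.
lra.
Qed.

End LargeP.

(** * Assembling the theorem *)

Section Final.
Context {R : realType}.

(** The smallest value, 2 - 2 cos (2 pi / 7), about 0.753, occurs at sigma_8. *)
Lemma tau2_sigma_ge (j : nat) : (1 <= j <= 9)%N -> 3 / 4 <= tau2 (sigma R j).
Proof.
move=> hj; have : all (fun j => tpos 1 (tsub (Tmul (TZ 4) (f_norm (tsigma j))) (TZ 3))) (iota 1 9).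
  by vm_compute.
move=> /allP/(_ j); rewrite mem_iota => /(_ hj)/(@tpos_gt0 R).
by rewrite tevalB tevalM (tevalZ 1 4) (tevalZ 1 3) (ev_norm (sigma_value hj)); lra.
Qed.

Lemma tau2_sporadic_ge c (j : nat) : (1 <= j <= 9)%N -> 3 / 4 <= tau2 (sporadic_value R c j).
Proof. by case: c => hj; rewrite /sporadic_value ?tau2_conj tau2_sigma_ge. Qed.

Lemma sporadic_large c p (j : nat) : (60 <= p)%N -> (1 <= j <= 9)%N ->
  disc p (sporadic_value R c j) < 0 -> ~ discrete_mx (Gamma p (sporadic_value R c j)).
Proof.
move=> p60 hj d0; have t34 := tau2_sporadic_ge c hj; have := sporadic_angle (R := R) c hj.
have [h1|h0] := boolP (4 <= j <= 6)%N.
  have [-> ->] : sigma_m j = 2%N /\ sigma_h j = 1%N.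
    by rewrite /sigma_h h1; case: j h1 {hj d0 t34} => [|[|[|[|[|[|[|]]]]]]].
  (* For h = 1 the angle beta = 2 th + pi / 2 is not small, but 2 beta = 4 th + pi is small modulo
     pi; hence j = 2 and N = 4. For h = 0, j = 1 and N = m suffice. *)
  move=> ang; apply: (@large_p_not_discrete R p _ 2 1 2 4 p60 isT ang _ t34 d0) => th.
  rewrite (_ : 2%:R * _ = 4%:R * th + pi); last by field.
  by rewrite sinDpi sqrrN.
rewrite /sigma_h (negPf h0) => ang.
apply: (@large_p_not_discrete R p _ (sigma_m j) 0 1 (sigma_m j) p60 _ ang _ t34 d0) => [|th].
  by case: j hj {h0 d0 t34 ang} => [|[|[|[|[|[|[|[|[|[|]]]]]]]]]].
by rewrite mul1r !mul0r addr0.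
Qed.

Lemma large_sporadic c p (j : nat) : (1 <= j <= 9)%N ->
  tpos 1 (f_im3 (tsporadic c j)) ->
  tpos 1 (tsub (Tmul (TZ 15) (f_im3 (tsporadic c j))) (f_re3 (tsporadic c j))) ->
  (60 <= p)%N -> ~ discrete_mx (Gamma p (sporadic_value R c j)).
Proof.
move=> hj h1 h2 p60; apply: (sporadic_large p60 hj).
exact: (disc_lt0 p60 (tsporadic_value c hj) (tau2_sporadic_ge c hj) h1 h2).
Qed.

Lemma finite_discrete : finite_set [set pt : nat * R[i] |
    sporadic_triangle_pair pt.1 pt.2 /\ discrete_mx (Gamma pt.1 pt.2)].
Proof.
pose S : set R[i] := (sigma R @` `I_10) `|` ((fun j => (sigma R j)^*) @` `I_10).
apply: (@sub_finite_set _ _ (`I_60 `*` S)); last first.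
  by apply: finite_setX; rewrite ?finite_setU; try split; try exact: finite_image; exact: finite_II.
move=> [p tau] /= [[p2 [j hj htau] sig] dG]; split=> /=.
  rewrite ltnNge; apply/negP => p60.
  have d0 := signature_disc_lt0 sig.
  by case: htau d0 dG => -> d0; [exact: (@sporadic_large false) | exact: (@sporadic_large true)].
have j10 : (j < 10)%N by case/andP: hj.
by case: htau => ->; [left | right]; exists j.
Qed.

End Final.

Theorem theorem9p1 (R : realType) :
  finite_set [set pt : nat * R[i] |
    sporadic_triangle_pair pt.1 pt.2 /\ discrete_mx (Gamma pt.1 pt.2)] /\
  (forall p : nat, (7 <= p)%N -> ~ discrete_mx (Gamma p (sigma R 1))) /\
  (forall p : nat, p \in [:: 3; 5; 6; 7]%N ->
     ~ discrete_mx (Gamma p (sigma R 1)^*)) /\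
  (forall p : nat, (6 <= p)%N -> ~ discrete_mx (Gamma p (sigma R 2))) /\
  (forall p : nat, (6 <= p <= 19)%N -> ~ discrete_mx (Gamma p (sigma R 2)^*)) /\
  (forall p : nat, p \in [:: 4; 5; 6]%N -> ~ discrete_mx (Gamma p (sigma R 4))) /\
  (forall p : nat, (2 <= p)%N -> p \notin [:: 2; 3; 4; 5; 6; 8; 12]%N ->
     ~ discrete_mx (Gamma p (sigma R 4)^*)) /\
  (forall p : nat, (2 <= p)%N -> p \notin [:: 2; 3; 4; 5; 6; 8; 12]%N ->
     ~ discrete_mx (Gamma p (sigma R 5))) /\
  ~ discrete_mx (Gamma 4 (sigma R 5)^*) /\
  (~ discrete_mx (Gamma 5 (sigma R 6)) /\
   ~ discrete_mx (Gamma 5 (sigma R 6)^*)) /\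
  (forall p : nat, (2 <= p)%N -> p \notin [:: 2; 3; 4; 7; 14]%N ->
     ~ discrete_mx (Gamma p (sigma R 7))).
Proof.
split; first exact: finite_discrete.
(* Turns a list of exceptions that contains 2, ..., a - 1 into the lower bound p >= a. *)
have from (e : seq nat) a p : (2 <= p)%N -> p \notin e ->
    all (fun q => q \in e) (iota 2 (a - 2)) -> (a <= p)%N.
  move=> p2 pe /allP h; rewrite leqNgt; apply/negP => pa.
  by have := h p; rewrite mem_iota (negPf pe); lia.
split.
  move=> p p7; have [p60|] := ltnP p 60; first by apply: small_sigma1; rewrite p7.
  by apply: (@large_sporadic R false p 1); vm_compute.
split.
  move=> p; rewrite !inE => /or4P[]/eqP->; first exact: word_sigma1_conj.
  - exact: small_sigma1_conj.
  - exact: small_sigma1_conj.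
  - exact: small_sigma1_conj.
split.
  move=> p p6; have [p60|] := ltnP p 60; first by apply: small_sigma2; rewrite p6.
  by apply: (@large_sporadic R false p 2); vm_compute.
split; first by move=> p; exact: small_sigma2_conj.
split.
  move=> p; rewrite !inE => /or3P[]/eqP->; first exact: word_sigma4.
  - exact: small_sigma4.
  - exact: small_sigma4.
split.
  move=> p p2 pe; have [p60|] := ltnP p 60; last first.
    by apply: (@large_sporadic R true p 4); vm_compute.
  apply: small_sigma4_conj; first by rewrite p60 (from _ 7 p p2 pe).
  by move: pe; rewrite !inE !negb_or => /and5P[_ _ _ _ /and3P[_ -> ->]].
split.
  move=> p p2 pe; have [p60|] := ltnP p 60; last first.
    by apply: (@large_sporadic R false p 5); vm_compute.
  apply: small_sigma5; first by rewrite p60 (from _ 7 p p2 pe).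
  by move: pe; rewrite !inE !negb_or => /and5P[_ _ _ _ /and3P[_ -> ->]].
split; first exact: word_sigma5_conj.
split; first by split; [exact: small_sigma6 | exact: small_sigma6_conj].
move=> p p2 pe; have [p60|] := ltnP p 60; last first.
  by apply: (@large_sporadic R false p 7); vm_compute.
apply: small_sigma7; first by rewrite p60 (from _ 5 p p2 pe).
by move: pe; rewrite !inE !negb_or => /and5P[_ _ _ -> ->].
Qed.
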